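(* Let $S$ be a self-adjoint operator in $\mathcal{H}$, bounded from below, with $(S-zI_{\mathcal{H}})^{-1}$ trace class for some (and hence for all) $z\in\rho(S)$. Let $\gamma$ be a counterclockwise oriented simple contour encircling $\sigma(S)\backslash\{0\}$, as described in the context. Suppose that $$\big|\mathrm{tr}_{\mathcal{H}}\big((S-zI_{\mathcal{H}})^{-1}[I_{\mathcal{H}}-P(0;S)]\big)\big|$$ is polynomially bounded on $\gamma$. Then $$\zeta(s;S)=-\frac{1}{2\pi i}\oint_{\gamma}dz\, z^{-s}\Big[\mathrm{tr}_{\mathcal{H}}\big((S-zI_{\mathcal{H}})^{-1}\big)+z^{-1}m(0;S)\Big]$$ for $\mathrm{Re}(s)>0$ sufficiently large.
   Context: $\mathcal{H}$ is a separable complex Hilbert space with identity operator $I_{\mathcal{H}}$; $\sigma(\cdot)$, $\rho(\cdot)$ denote spectrum and resolvent set; $\mathrm{tr}_{\mathcal{H}}$ is the trace of trace class operators. $P(0;S)$ is the spectral projection of $S$ corresponding to the eigenvalue $0$ (it is $0$ if $0\notin\sigma(S)$), and $m(0;S)=\dim(\ker(S))$. Under the hypotheses $S$ has purely discrete spectrum; write $\sigma(S)=\{\lambda_j\}_{j\in J}$, with $J\subset\mathbb{Z}$ an appropriate index set and every eigenvalue repeated according to its multiplicity. The spectral zeta function of $S$ is $$\zeta(s;S):=\sum_{j\in J,\ \lambda_j\neq 0}\lambda_j^{-s}$$ for $\mathrm{Re}(s)>0$ sufficiently large such that the series converges absolutely. Branch of $z^{-s}$: fix $\theta\in(\pi/2,\pi)$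 and take the branch cut of $z^{-s}$ to be the ray $R_\theta=\{te^{i\theta}\mid t\in[0,\infty)\}$, with $\arg z\in(\theta-2\pi,\theta)$, so that $\arg z=0$ for $z>0$ and $\arg z=-\pi$ for $z<0$. Contour: $\gamma$ is a simple (piecewise smooth) contour which comes in from infinity in the upper half-plane above the positive real axis, passes to the left of $\sigma(S)$, and returns to infinity in the lower half-plane below the positive real axis (outside a compact set it consists of two straight half-lines along which $\mathrm{Re}(z)\to+\infty$, e.g., parallel to the positive real axis). It encircles $\sigma(S)\backslash\{0\}$ counterclockwise, that is, all nonzero points of $\sigma(S)$ lie in its interior; it dips under the point $0$, so that $0$ lies neither on $\gamma$ nor in the interior of $\gamma$; and $\gamma$ has no contact with $R_\theta$. *)

(* Defs.v *)
From Stdlib Require Import Reals ZArith List ClassicalEpsilon.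
From Coquelicot Require Import Coquelicot.
Open Scope R_scope.

(* Antilinear in the first slot, linear in the second. *)
Record HilbertSpace := {
  hilbert_carrier :> CompleteNormedModule C_AbsRing;
  inner : hilbert_carrier -> hilbert_carrier -> C;
  inner_plus_r : forall x y z,
    inner x (plus y z) = (inner x y + inner x z)%C;
  inner_scal_r : forall x (c : C) y,
    inner x (scal c y) = (c * inner x y)%C;
  inner_conj : forall x y, inner y x = Cconj (inner x y);
  inner_norm : forall x, inner x x = RtoC (norm x ^ 2)
}.
Arguments inner {h} _ _.

Definition separable (H : HilbertSpace) : Prop :=
  exists d : nat -> H, forall (x : H) (eps : R), 0 < eps ->
    exists n, norm (minus x (d n)) < eps.

(* Indexed by nat also in finite dimension, by padding with zero vectors. *)
Definition orthonormal_basis {H : HilbertSpace} (e : nat -> H) : Prop :=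
  (forall n, e n = zero \/ norm (e n) = 1) /\
  (forall m n, m <> n -> inner (e m) (e n) = RtoC 0) /\
  (forall x, (forall n, inner (e n) x = RtoC 0) -> x = zero).

Definition has_dim {H : HilbertSpace} (W : H -> Prop) (n : nat) : Prop :=
  exists b : nat -> H,
    (forall i, (1 <= i <= n)%nat -> W (b i)) /\
    (forall c : nat -> C,
       sum_n_m (fun i => scal (c i) (b i)) 1 n = zero ->
       forall i, (1 <= i <= n)%nat -> c i = RtoC 0) /\
    (forall x, W x ->
       exists c : nat -> C, x = sum_n_m (fun i => scal (c i) (b i)) 1 n).

(* [is_linear] is Coquelicot's predicate for bounded linear maps. *)

(* B = |T|, i.e. B >= 0 and B^2 = T^* T. *)
Definition is_absolute_value {H : HilbertSpace} (T B : H -> H) : Prop :=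
  is_linear B /\
  (forall x, 0 <= Re (inner x (B x)) /\ Im (inner x (B x)) = 0) /\
  (forall x y, inner x (B (B y)) = inner (T x) (T y)).

Definition trace_class {H : HilbertSpace} (T : H -> H) : Prop :=
  is_linear T /\
  exists (B : H -> H) (e : nat -> H),
    is_absolute_value T B /\ orthonormal_basis e /\
    ex_series (fun n => Re (inner (e n) (B (e n)))).

Definition is_trace {H : HilbertSpace} (T : H -> H) (l : C) : Prop :=
  forall e : nat -> H, orthonormal_basis e ->
    is_series (V := C_R_NormedModule) (fun n => inner (e n) (T (e n))) l.

Definition trace {H : HilbertSpace} (T : H -> H) : C :=
  iota (T := C_R_CompleteNormedModule) (is_trace T).

(* The values of [op_fun] outside of [dom] are irrelevant. *)
Record operator (H : HilbertSpace) := {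
  dom : H -> Prop;
  op_fun :> H -> H;
  dom_zero : dom zero;
  dom_plus : forall x y, dom x -> dom y -> dom (plus x y);
  dom_scal : forall (c : C) x, dom x -> dom (scal c x);
  op_plus : forall x y, dom x -> dom y ->
    op_fun (plus x y) = plus (op_fun x) (op_fun y);
  op_scal : forall (c : C) x, dom x -> op_fun (scal c x) = scal c (op_fun x)
}.
Arguments dom {H} _ _.
Arguments op_fun {H} _ _.

Definition densely_defined {H : HilbertSpace} (A : operator H) : Prop :=
  forall (x : H) (eps : R), 0 < eps ->
    exists y, dom A y /\ norm (minus x y) < eps.

(* The left-hand side of the equivalence says that (y, w) is in the graph of
   the adjoint of A. *)
Definition self_adjoint {H : HilbertSpace} (A : operator H) : Prop :=
  densely_defined A /\
  forall y w : H,
    (forall x, dom A x -> inner (A x) y = inner x w) <-> (dom A y /\ A y = w).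

Definition bounded_below {H : HilbertSpace} (A : operator H) : Prop :=
  exists c : R, forall x, dom A x -> c * norm x ^ 2 <= Re (inner x (A x)).

Definition is_resolvent {H : HilbertSpace} (A : operator H) (z : C)
    (B : H -> H) : Prop :=
  is_linear B /\
  (forall x, dom A (B x) /\ minus (A (B x)) (scal z (B x)) = x) /\
  (forall x, dom A x -> B (minus (A x) (scal z x)) = x).

Definition resolvent_set {H : HilbertSpace} (A : operator H) (z : C) : Prop :=
  exists B, is_resolvent A z B.

Definition spectrum {H : HilbertSpace} (A : operator H) (z : C) : Prop :=
  ~ resolvent_set A z.

(* (A - z)^{-1}; meaningful for z in the resolvent set only. *)
Definition resolvent {H : HilbertSpace} (A : operator H) (z : C) : H -> H :=
  epsilon (inhabits (fun x : H => x)) (is_resolvent A z).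

Definition eigenspace {H : HilbertSpace} (A : operator H) (z : C) (x : H)
    : Prop :=
  dom A x /\ A x = scal z x.

(* m(z; A) = dim ker (A - z); meaningful when this dimension is finite. *)
Definition multiplicity {H : HilbertSpace} (A : operator H) (z : C) : nat :=
  epsilon (inhabits 0%nat) (has_dim (eigenspace A z)).

Definition path_derive (g : R -> C) (t : R) : C :=
  (Derive (fun u => Re (g u)) t, Derive (fun u => Im (g u)) t).

Definition ex_contour_int (g : R -> C) (f : C -> C) : Prop :=
  ex_RInt_gen (V := C_R_NormedModule)
    (fun t => (f (g t) * path_derive g t)%C)
    (Rbar_locally m_infty) (Rbar_locally p_infty).

Definition contour_int (g : R -> C) (f : C -> C) : C :=
  RInt_gen (V := C_R_CompleteNormedModule)
    (fun t => (f (g t) * path_derive g t)%C)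
    (Rbar_locally m_infty) (Rbar_locally p_infty).

Definition circle (c : C) (r : R) (t : R) : C :=
  (c + RtoC r * (cos t, sin t))%C.

Definition circle_int (c : C) (r : R) (f : C -> C) : C :=
  RInt (V := C_R_CompleteNormedModule)
    (fun t => (f (circle c r t) * path_derive (circle c r) t)%C) 0 (2 * PI).

(* P(z0; A) = - (2 pi i)^{-1} \oint_{|z - z0| = r} (A - z)^{-1} dz (as a weak
   integral), for z0 isolated in the spectrum or in the resolvent set, and any
   sufficiently small r. *)
Definition is_spectral_proj {H : HilbertSpace} (A : operator H) (z0 : C)
    (P : H -> H) : Prop :=
  exists r0 : R, 0 < r0 /\
    (forall z, 0 < Cmod (z - z0) <= r0 -> resolvent_set A z) /\
    forall r, 0 < r <= r0 -> forall x y : H,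
      inner y (P x) =
      (- / (RtoC (2 * PI) * Ci)
         * circle_int z0 r (fun z => inner y (resolvent A z x)))%C.

Definition spectral_proj {H : HilbertSpace} (A : operator H) (z0 : C)
    : H -> H :=
  epsilon (inhabits (fun x : H => x)) (is_spectral_proj A z0).

(* The argument in (theta - 2 pi, theta), for z off the cut R_theta. *)
Definition carg (theta : R) (z : C) : R :=
  epsilon (inhabits 0) (fun a =>
    theta - 2 * PI < a < theta /\ z = (RtoC (Cmod z) * (cos a, sin a))%C).

Definition cexp (z : C) : C := (RtoC (exp (Re z)) * (cos (Im z), sin (Im z)))%C.

(* [cpow theta z w] is z^w, for z off the cut R_theta. *)
Definition cpow (theta : R) (z w : C) : C :=
  cexp (w * (ln (Cmod z), carg theta z)).

Definition on_cut (theta : R) (z : C) : Prop :=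
  exists r : R, 0 <= r /\ z = (RtoC r * (cos theta, sin theta))%C.

Definition has_card {X : Type} (P : X -> Prop) (n : nat) : Prop :=
  exists l : list X, NoDup l /\ length l = n /\ forall x, In x l <-> P x.

(* The spectrum of A is { lam j | j in J }, each point occurring as often as
   the dimension of its eigenspace, which has to be finite. *)
Definition spectral_enum {H : HilbertSpace} (A : operator H)
    (J : Z -> Prop) (lam : Z -> C) : Prop :=
  (forall z, spectrum A z <-> exists j, J j /\ lam j = z) /\
  (forall z, exists n,
     has_dim (eigenspace A z) n /\ has_card (fun j => J j /\ lam j = z) n).

(* The sum of an absolutely convergent family indexed by Z. *)
Definition is_Zsum (a : Z -> C) (l : C) : Prop :=
  ex_series (fun n => Cmod (a (Z.of_nat n))) /\
  ex_series (fun n => Cmod (a (- Z.of_nat n - 1)%Z)) /\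
  exists l1 l2 : C,
    is_series (V := C_R_NormedModule) (fun n => a (Z.of_nat n)) l1 /\
    is_series (V := C_R_NormedModule) (fun n => a (- Z.of_nat n - 1)%Z) l2 /\
    l = (l1 + l2)%C.

Definition is_zeta (theta : R) {H : HilbertSpace} (A : operator H) (s l : C)
    : Prop :=
  exists (J : Z -> Prop) (lam : Z -> C),
    spectral_enum A J lam /\
    is_Zsum (fun j =>
      if excluded_middle_informative (J j /\ lam j <> RtoC 0)
      then cpow theta (lam j) (- s) else RtoC 0) l.

Definition ex_zeta (theta : R) {H : HilbertSpace} (A : operator H) (s : C)
    : Prop :=
  exists l, is_zeta theta A s l.

Definition zeta (theta : R) {H : HilbertSpace} (A : operator H) (s : C) : C :=
  iota (T := C_R_CompleteNormedModule) (is_zeta theta A s).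

Definition piecewise_C1 (g : R -> R) : Prop :=
  exists l : list R,
    (forall t, ~ In t l -> ex_derive g t /\ continuous (Derive g) t) /\
    (forall t, In t l ->
       (exists d : R, filterlim (Derive g) (at_left t) (locally d)) /\
       (exists d : R, filterlim (Derive g) (at_right t) (locally d))).

Definition joined_off (g : R -> C) (p q : C) : Prop :=
  exists c : R -> C,
    (forall t, continuous c t) /\ c 0 = p /\ c 1 = q /\
    forall t u, 0 <= t <= 1 -> c t <> g u.

(* The component of the complement of the (unbounded) contour g that lies
   between its two half-lines, i.e. that contains all large positive reals. *)
Definition interior (g : R -> C) (p : C) : Prop :=
  exists X : R, forall x, X <= x -> joined_off g p (RtoC x).

Record encircling_contour (theta : R) {H : HilbertSpace} (A : operator H)
    (g : R -> C) : Prop := {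
  contour_continuous : forall t, continuous g t;
  contour_simple : forall t u, g t = g u -> t = u;
  contour_C1_Re : piecewise_C1 (fun t => Re (g t));
  contour_C1_Im : piecewise_C1 (fun t => Im (g t));
  (* comes in from infinity above the positive real axis *)
  contour_in : exists (a : R) (u : C), 0 < Re u /\ forall t, t <= a ->
    g t = (g a + RtoC (a - t) * u)%C /\ 0 < Im (g t);
  (* returns to infinity below the positive real axis *)
  contour_out : exists (b : R) (v : C), 0 < Re v /\ forall t, b <= t ->
    g t = (g b + RtoC (t - b) * v)%C /\ Im (g t) < 0;
  contour_left : exists t, Im (g t) = 0 /\
    forall z, spectrum A z -> z <> RtoC 0 -> Re (g t) < Re z;
  contour_encircles : forall z, spectrum A z -> z <> RtoC 0 -> interior g z;
  contour_not_zero : forall t, g t <> RtoC 0;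
  contour_zero_outside : ~ interior g (RtoC 0);
  contour_off_cut : forall t, ~ on_cut theta (g t)
}.

(* Main.v *)
Require Import Defs.
From Stdlib Require Import Reals Psatz ZArith List Permutation.
From Stdlib Require Import Classical ClassicalEpsilon FunctionalExtensionality ssreflect.
From Coquelicot Require Import Coquelicot.
Open Scope R_scope.
Local Open Scope general_if_scope.

(* With T = (S - z0)^(-1) of trace class, T^* T = |T|^2 is positive and Hilbert-Schmidt; diagonalising it by
   eigenvectors of S gives an orthonormal basis with S f_n = mu_n f_n and sum |mu_n - z0|^(-1) finite. Hence
   tr (S - z)^(-1) = sum 1/(mu_n - z), and adding m(0; S)/z cancels the terms with mu_n = 0. The integral of
   z^(-s)/(mu_n - z) along the contour is - 2 pi i mu_n^(-s): the logarithmic part is 2 pi i because mu_n can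
   be joined off the contour to a large real X, where explicit logarithms apply, and the regular part has a
   primitive on a strip in the variable log z. The contour has positive distance to the nonzero mu_n, so the
   n-th integrand is at most C |mu_n - z0|^(-1) / (1 + t^2) for Re s > 3, and sum and integral commute. *)

(** The resolvent T need not be self-adjoint, as z0 may be non-real; hence T^* T is diagonalised.
    Its eigenspaces can mix two eigenvalues of S, those at equal distance from z0, so eigenvectors
    of S have to be selected inside them at every step. The sum of |mu_n - z0|^(-1) is finite
    because it is the trace of |T|, read in the new basis. The bound 3 on Re s counts powers: z^(-s)
    decays at least like |z|^(-3), one power is lost when |mu_n - z|^(-1) is replaced by |mu_n -
    z0|^(-1) uniformly in n, and |z|^(-2) is integrable along the contour. Residues are computed
    with primitives only: not the contour but the pole is moved. The variable log z - log p has
    imaginary part below 2 pi in modulus, where e^w - 1 vanishes only at 0; this is why the regular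
    part is regular. Finally [trace] and [zeta] are defined by description: the trace must be
    computed in every orthonormal basis, and the zeta sum must not depend on the enumeration of the
    spectrum. *)

Local Notation Cis_series := (is_series (V := C_R_NormedModule)).
Local Notation Csum_n := (sum_n (G := C_AbelianGroup)).
Local Notation Cis_RInt := (is_RInt (V := C_R_NormedModule)).
Local Notation Cex_RInt := (ex_RInt (V := C_R_NormedModule)).
Local Notation Cis_RInt_gen f l :=
  (is_RInt_gen (V := C_R_NormedModule) f (Rbar_locally m_infty) (Rbar_locally p_infty) l).

(** * Hilbert space preliminaries *)

Lemma C_eq (a b : C) : Re a = Re b -> Im a = Im b -> a = b.
Proof. by case: a => ? ?; case: b => ? ? /= -> ->. Qed.

Lemma Cmod_sqr (a : C) : Cmod a ^ 2 = Re a ^ 2 + Im a ^ 2.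
Proof. exact: Cmod2_alt. Qed.

Lemma inner_scal_l {H : HilbertSpace} (c : C) (x y : H) :
  inner (scal c x) y = (Cconj c * inner x y)%C.
Proof.
  by rewrite inner_conj inner_scal_r Cmult_conj -inner_conj.
Qed.

Lemma inner_plus_l {H : HilbertSpace} (x y z : H) :
  inner (plus x y) z = (inner x z + inner y z)%C.
Proof.
  by rewrite inner_conj inner_plus_r Cplus_conj -!inner_conj.
Qed.

Lemma inner_opp_r {H : HilbertSpace} (x y : H) : inner x (opp y) = (- inner x y)%C.
Proof.
  rewrite -(scal_opp_one y) inner_scal_r.
  rewrite /opp /one /=. ring.
Qed.

Lemma inner_opp_l {H : HilbertSpace} (x y : H) : inner (opp x) y = (- inner x y)%C.
Proof. by rewrite inner_conj inner_opp_r Copp_conj -inner_conj. Qed.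

Lemma inner_zero_r {H : HilbertSpace} (x : H) : inner x zero = RtoC 0.
Proof.
  rewrite -(scal_zero_l (K := C_AbsRing) (zero : H)) inner_scal_r /zero /=. ring.
Qed.

Lemma inner_zero_l {H : HilbertSpace} (x : H) : inner zero x = RtoC 0.
Proof. rewrite inner_conj inner_zero_r. apply: C_eq => /=; lra. Qed.

Lemma inner_minus_r {H : HilbertSpace} (x y z : H) :
  inner x (minus y z) = (inner x y - inner x z)%C.
Proof. by rewrite /minus inner_plus_r inner_opp_r. Qed.

Lemma inner_minus_l {H : HilbertSpace} (x y z : H) :
  inner (minus x y) z = (inner x z - inner y z)%C.
Proof. by rewrite /minus inner_plus_l inner_opp_l. Qed.

Lemma inner_sum_r {H : HilbertSpace} (x : H) (u : nat -> H) (n m : nat) :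
  inner x (sum_n_m u n m) = sum_n_m (fun k => inner x (u k)) n m.
Proof.
  case: (le_lt_dec n m) => [le|lt]; last first.
    by rewrite !sum_n_m_zero // inner_zero_r.
  elim: m le => [|m IH] le.
    by replace n with 0%nat by lia; rewrite !sum_n_n.
  case: (Nat.eq_dec n (S m)) => [->|ne]; first by rewrite !sum_n_n.
  rewrite !sum_n_Sm; try lia. by rewrite inner_plus_r IH //; lia.
Qed.

Ltac inner_simpl := rewrite ?(inner_plus_r, inner_plus_l, inner_minus_r, inner_minus_l,
  inner_opp_r, inner_opp_l, inner_scal_r, inner_scal_l, inner_zero_r, inner_zero_l).

Lemma norm_sqr {H : HilbertSpace} (x : H) : norm x ^ 2 = Re (inner x x).
Proof. by rewrite inner_norm. Qed.

Lemma Im_inner_self {H : HilbertSpace} (x : H) : Im (inner x x) = 0.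
Proof. by rewrite inner_norm. Qed.

Lemma norm_eq0 {H : HilbertSpace} (x : H) : norm x = 0 -> x = zero.
Proof. exact: norm_eq_zero. Qed.

Lemma inner_self_eq0 {H : HilbertSpace} (x : H) : inner x x = RtoC 0 -> x = zero.
Proof.
  move=> h. apply: norm_eq0. have := norm_sqr x. rewrite h /= => e. nra.
Qed.

Lemma minus_eq_zero_eq {H : HilbertSpace} (x y : H) : minus x y = zero -> x = y.
Proof.
  move=> h. by rewrite -(plus_zero_r x) -(plus_opp_l y) plus_assoc -/(minus x y) h plus_zero_l.
Qed.

(* Identities between vectors are checked by pairing with an arbitrary vector, which turns them into ring identities in C. *)
Lemma inner_ext {H : HilbertSpace} (x y : H) :
  (forall w, inner w x = inner w y) -> x = y.
Proof.
  move=> h. apply: minus_eq_zero_eq. apply: inner_self_eq0.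
  rewrite inner_minus_r h. ring.
Qed.

Ltac vec := apply: inner_ext => ?; inner_simpl; try ring.

(** Boundedness is left out: symmetry and positivity are all that the Cauchy-Schwarz inequality for
    the form <x, A y> uses, and the identity is an instance, which gives the usual inequality. *)
Record pos_op {H : HilbertSpace} (A : H -> H) : Prop := {
  po_plus : forall x y, A (plus x y) = plus (A x) (A y);
  po_scal : forall (c : C) x, A (scal c x) = scal c (A x);
  po_sym : forall x y, inner x (A y) = inner (A x) y;
  po_pos : forall x, 0 <= Re (inner x (A x)) }.

Lemma pos_op_id {H : HilbertSpace} : pos_op (fun x : H => x).
Proof. split=> // x. rewrite inner_norm /=. have := norm_ge_0 x. nra. Qed.

(** Positivity of the form at x - t w y, with w = <y, A x> and t real, gives a quadratic in t, which
    is evaluated at t = 1/b with b = <y, A y>. *)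
Lemma pos_op_CS {H : HilbertSpace} (A : H -> H) (x y : H) : pos_op A ->
  Cmod (inner x (A y)) ^ 2 <= Re (inner x (A x)) * Re (inner y (A y)).
Proof.
  move=> hA.
  set w := inner y (A x).
  have wE : inner x (A y) = Cconj w by rewrite (po_sym _ hA) inner_conj.
  have key : forall t : R,
    0 <= Re (inner x (A x)) - 2 * t * Cmod w ^ 2 + t ^ 2 * Cmod w ^ 2 * Re (inner y (A y)).
    move=> t. have := po_pos _ hA (plus x (scal (- t * w)%C y)).
    rewrite (po_plus _ hA) (po_scal _ hA). inner_simpl. rewrite -/w wE.
    have im : Im (inner y (A y)) = 0.
      have := po_sym _ hA y y. rewrite (inner_conj _ y (A y)) => e.
      have /= : Im (inner y (A y)) = Im (Cconj (inner y (A y))) by rewrite -e.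
      rewrite /Im. lra.
    move: im. rewrite Cmod_sqr. case: (inner y (A y)) => b1 b2 /= ->.
    case: (inner x (A x)) => a1 a2 /=.
    case: w {wE} => w1 w2 /=. lra.
  have -> : Cmod (inner x (A y)) = Cmod w by rewrite wE Cmod_conj.
  move: key (po_pos _ hA x) (po_pos _ hA y).
  set a := Re (inner x (A x)). set b := Re (inner y (A y)). set m := Cmod w ^ 2.
  move=> key ha hb.
  have hm : 0 <= m by rewrite /m; nra.
  case: (Req_dec b 0) => [b0|bn].
    (* For b = 0 the quadratic is linear in t, and t = (a + 1)/(2 m) would give it the value -1 if m
       were positive. *)
    rewrite b0 Rmult_0_r. apply: Rnot_lt_le => hlt.
    have := key ((a + 1) / (2 * m)). rewrite b0.
    replace (a - 2 * ((a + 1) / (2 * m)) * m + ((a + 1) / (2 * m)) ^ 2 * m * 0) with (-1); first lra.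
    field. lra.
  have := key (/ b).
  replace (a - 2 * / b * m + (/ b) ^ 2 * m * b) with (a - m / b) by (field; lra).
  move=> h. have h2 : m / b * b <= a * b by apply: Rmult_le_compat_r; lra.
  replace (m / b * b) with m in h2 by (field; lra). done.
Qed.

Lemma Cauchy_Schwarz {H : HilbertSpace} (x y : H) :
  Cmod (inner x y) <= norm x * norm y.
Proof.
  have := pos_op_CS (fun x => x) x y pos_op_id. rewrite -!norm_sqr => h.
  apply: Rsqr_incr_0_var; last by apply: Rmult_le_pos; exact: norm_ge_0.
  rewrite /Rsqr. nra.
Qed.

Lemma norm_plus_sqr {H : HilbertSpace} (x y : H) :
  norm (plus x y) ^ 2 = norm x ^ 2 + 2 * Re (inner x y) + norm y ^ 2.
Proof.
  rewrite !norm_sqr. inner_simpl. rewrite (inner_conj _ x y).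
  case: (inner x y) => a b; rewrite /Re /=; lra.
Qed.

Lemma norm_minus_sqr {H : HilbertSpace} (x y : H) :
  norm (minus x y) ^ 2 = norm x ^ 2 - 2 * Re (inner x y) + norm y ^ 2.
Proof.
  rewrite !norm_sqr. inner_simpl. rewrite (inner_conj _ x y).
  case: (inner x y) => a b; rewrite /Re /=; lra.
Qed.

Lemma norm_scal_C {H : HilbertSpace} (c : C) (x : H) : norm (scal c x) = Cmod c * norm x.
Proof.
  have h : norm (scal c x) ^ 2 = (Cmod c * norm x) ^ 2.
    rewrite Rpow_mult_distr Cmod_sqr !norm_sqr. inner_simpl.
    rewrite inner_norm. case: c => a b; rewrite /Re /=; lra.
  apply: Rsqr_inj; first exact: norm_ge_0.
    by apply: Rmult_le_pos; [exact: Cmod_ge_0|exact: norm_ge_0].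
  rewrite /Rsqr. nra.
Qed.

Lemma norm_minus_sym {H : HilbertSpace} (x y : H) : norm (minus x y) = norm (minus y x).
Proof. by rewrite -norm_opp opp_minus. Qed.

Lemma norm_minus_triangle {H : HilbertSpace} (x y z : H) :
  norm (minus x z) <= norm (minus x y) + norm (minus y z).
Proof.
  rewrite (minus_trans y x z). exact: norm_triangle.
Qed.

Lemma cauchy_limit {H : HilbertSpace} (u : nat -> H) :
  (forall eps, 0 < eps -> exists N, forall n m, (N <= n)%nat -> (N <= m)%nat ->
     norm (minus (u n) (u m)) < eps) ->
  exists y, is_lim_seq (fun n => norm (minus (u n) y)) 0.
Proof.
  move=> h.
  have [y hy] : exists y, filterlim u eventually (locally y).
    apply/(filterlim_locally_cauchy (F := eventually)) => eps.
    have [N hN] := h eps (cond_pos eps).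
    exists (fun n => (N <= n)%nat). split; first by exists N.
    move=> n m hn hm. apply: (norm_compat1 (V := H)).
    exact: hN.
  exists y. apply/is_lim_seq_spec => eps.
  (* Balls of the uniform structure agree with norm balls only up to [norm_factor], so the radius is
     divided by it. *)
  have hf : 0 < eps / (norm_factor (V := H)).
    apply: Rdiv_lt_0_compat; first exact: cond_pos. exact: norm_factor_gt_0.
  have /= := (proj1 (filterlim_locally u y) hy (mkposreal _ hf)).
  move=> [N hN]. exists N => n hn.
  have /= := norm_compat2 (V := H) y (u n) (mkposreal _ hf) (hN n hn).
  rewrite Rminus_0_r Rabs_pos_eq; last exact: norm_ge_0.
  replace (norm_factor * (eps / norm_factor)) with (eps : R); first done.
  field. apply: Rgt_not_eq. exact: (norm_factor_gt_0 (V := H)).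
Qed.

Lemma limit_seq_unique {H : HilbertSpace} (u : nat -> H) (x y : H) :
  is_lim_seq (fun n => norm (minus (u n) x)) 0 ->
  is_lim_seq (fun n => norm (minus (u n) y)) 0 -> x = y.
Proof.
  move=> hx hy. apply: minus_eq_zero_eq. apply: norm_eq0.
  have h := is_lim_seq_plus' _ _ _ _ hx hy. rewrite Rplus_0_l in h.
  apply: Rle_antisym; last exact: norm_ge_0.
  have := is_lim_seq_le (fun _ => norm (minus x y)) _ _ _ _ (is_lim_seq_const _) h.
  apply=> n. rewrite (norm_minus_sym (u n) x). exact: norm_minus_triangle.
Qed.

Lemma is_lim_seq_norm_squeeze (u v : nat -> R) :
  (forall n, 0 <= u n <= v n) -> is_lim_seq v 0 -> is_lim_seq u 0.
Proof.
  move=> h hv. exact: (is_lim_seq_le_le (fun _ => 0) u v _ h (is_lim_seq_const _) hv).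
Qed.

(** * Series, Bessel and Parseval *)

(** The balls of [C_R_NormedModule] are products of intervals, so passing to [Cmod] costs a factor
    sqrt 2. *)
Lemma Cseq_lim_iff (u : nat -> C) (l : C) :
  filterlim u eventually (locally (T := C_R_NormedModule) l) <->
  is_lim_seq (fun n => Cmod (u n - l)) 0.
Proof.
  split=> h.
  - apply/is_lim_seq_spec => eps.
    have hs : 0 < eps / sqrt 2 by apply: Rdiv_lt_0_compat; [exact: cond_pos | apply: sqrt_lt_R0; lra].
    have [N hN] := proj1 (filterlim_locally (F := eventually) u l) h (mkposreal _ hs).
    exists N => n hn. rewrite Rminus_0_r Rabs_pos_eq; last exact: Cmod_ge_0.
    have := C_NormedModule_mixin_compat2 l (u n) (mkposreal _ hs) (hN n hn).
    rewrite /=. replace (sqrt 2 * (eps / sqrt 2)) with (eps : R); first done.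
    field. apply: Rgt_not_eq. apply: sqrt_lt_R0; lra.
  - apply/filterlim_locally => eps.
    have [N hN] := proj2 (is_lim_seq_spec _ _) h eps.
    exists N => n hn. apply: C_NormedModule_mixin_compat1.
    have := hN n hn. by rewrite Rminus_0_r Rabs_pos_eq; last exact: Cmod_ge_0.
Qed.

Lemma Cis_series_iff (a : nat -> C) (l : C) :
  Cis_series a l <->
  is_lim_seq (fun n => Cmod (Csum_n a n - l)) 0.
Proof. exact: Cseq_lim_iff. Qed.

Lemma Cis_series_unique (a : nat -> C) (l l' : C) :
  Cis_series a l ->
  Cis_series a l' -> l = l'.
Proof.
  move=> h h'. exact: (filterlim_locally_unique (F := eventually) (V := C_R_NormedModule) _ _ _ h h').
Qed.

Lemma C_R_norm (z : C) : norm (V := C_R_NormedModule) z = Cmod z.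
Proof.
  rewrite /Cmod. apply: (f_equal sqrt). apply: (f_equal2 Rplus); exact: pow2_abs.
Qed.

Lemma Cis_series_abs (a : nat -> C) :
  ex_series (fun n => Cmod (a n)) -> exists l, Cis_series a l.
Proof.
  move=> h.
  apply: (ex_series_le (V := C_R_CompleteNormedModule) a _ _ h) => n.
  rewrite -C_R_norm. exact: Rle_refl.
Qed.

Lemma Cis_series_norm (a : nat -> C) (b : nat -> R) (l : C) :
  (forall n, Cmod (a n) <= b n) -> ex_series b ->
  Cis_series a l -> Cmod l <= Series b.
Proof.
  move=> hab hb ha.
  have hlim : is_lim_seq (sum_n b) (Series b) by exact: Series_correct.
  have h1 := is_lim_seq_plus' _ _ _ _ hlim (proj1 (Cis_series_iff a l) ha).
  rewrite Rplus_0_r in h1.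
  apply: (is_lim_seq_le (fun _ => Cmod l) _ _ _ _ (is_lim_seq_const _) h1) => n.
  have h2 : Cmod (Csum_n a n) <= sum_n b n.
    elim: n => [|n IH]; first by rewrite !sum_O.
    rewrite !sum_Sn. apply: Rle_trans; first exact: Cmod_triangle.
    exact: Rplus_le_compat.
  have h3 := Cmod_triangle (Csum_n a n) (- (Csum_n a n - l)).
  rewrite Cmod_opp in h3.
  replace (Csum_n a n + - (Csum_n a n - l))%C with l in h3 by ring.
  lra.
Qed.

Lemma nonneg_series_bounded (a : nat -> R) (M : R) :
  (forall n, 0 <= a n) -> (forall n, sum_n a n <= M) -> ex_series a /\ Series a <= M.
Proof.
  move=> h0 hM.
  have ex : ex_series a.
    have [l hl] : ex_finite_lim_seq (sum_n a).
      apply: (ex_finite_lim_seq_incr _ M) => // n. rewrite sum_Sn /plus /=.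
      have := h0 (S n). lra.
    by exists l.
  split=> //.
  have hl : is_lim_seq (sum_n a) (Series a) by exact: Series_correct.
  exact: (is_lim_seq_le _ (fun _ => M) _ _ hM hl (is_lim_seq_const _)).
Qed.

Lemma sum_n_le_Series (a : nat -> R) (n : nat) :
  (forall n, 0 <= a n) -> ex_series a -> sum_n a n <= Series a.
Proof.
  move=> h0 ex.
  apply: (is_lim_seq_incr_compare (sum_n a)); first exact: Series_correct.
  move=> k. rewrite sum_Sn /plus /=. have := h0 (S k). lra.
Qed.

Lemma term_le_Series (a : nat -> R) (n : nat) :
  (forall n, 0 <= a n) -> ex_series a -> a n <= Series a.
Proof.
  move=> h0 ex. apply: Rle_trans; last exact: (sum_n_le_Series a n h0 ex).
  case: n => [|n]; first by rewrite sum_O; lra.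
  rewrite sum_Sn /plus /=.
  suff : 0 <= sum_n a n by lra.
  elim: n => [|n IH]; first by rewrite sum_O.
  rewrite sum_Sn /plus /=. have := h0 (S n). lra.
Qed.

Lemma Series_nonneg (a : nat -> R) : (forall n, 0 <= a n) -> ex_series a -> 0 <= Series a.
Proof. move=> h0 ex. have := term_le_Series a 0 h0 ex. have := h0 0%nat. lra. Qed.

Lemma ex_series_le_nonneg (a b : nat -> R) :
  (forall n, 0 <= a n <= b n) -> ex_series b -> ex_series a.
Proof.
  move=> h. apply: (ex_series_le (V := R_CompleteNormedModule)) => n.
  rewrite /norm /= /abs /= Rabs_pos_eq; apply h.
Qed.

Lemma Series_tail_small (s : nat -> R) (eps : R) : ex_series s -> 0 < eps ->
  exists N, Series (fun k => s (S N + k)%nat) < eps.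
Proof.
  move=> ex he.
  have hl : is_lim_seq (sum_n s) (Series s) by exact: Series_correct.
  have [N hN] := proj2 (is_lim_seq_spec _ _) hl (mkposreal _ he).
  exists N. have := hN N (Nat.le_refl _). rewrite /=.
  rewrite (Series_incr_n s (S N)) //; last lia.
  rewrite /= -sum_n_Reals.
  move=> h. apply: Rle_lt_trans; last exact h.
  apply: Rle_trans; first exact: Rle_abs. rewrite -Rabs_Ropp.
  right. congr Rabs. rewrite sum_n_Reals. ring.
Qed.

(** Dominated convergence for series: the tail of [s] is below eps/2 for all [K] at once, and the
    head is a finite sum of null sequences. *)
Lemma tannery (y : nat -> nat -> R) (s : nat -> R) :
  (forall K n, 0 <= y K n <= s n) -> ex_series s ->
  (forall n, is_lim_seq (fun K => y K n) 0) ->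
  is_lim_seq (fun K => Series (y K)) 0.
Proof.
  move=> hy ex hlim. apply/is_lim_seq_spec => eps.
  have [N hN] := Series_tail_small s (eps / 2) ex (is_pos_div_2 eps).
  have h1 : is_lim_seq (fun K => sum_n (y K) N) 0.
    elim: N {hN} => [|N IH].
      apply: is_lim_seq_ext (hlim 0%nat) => K. by rewrite sum_O.
    rewrite -(Rplus_0_r 0).
    apply: is_lim_seq_ext (is_lim_seq_plus' _ _ _ _ IH (hlim (S N))) => K.
    by rewrite sum_Sn.
  have [K0 hK] := proj2 (is_lim_seq_spec _ _) h1 (pos_div_2 eps).
  exists K0 => K hKK. have := hK K hKK. rewrite /= !Rminus_0_r.
  have exK : ex_series (y K) by exact: ex_series_le_nonneg (hy K) ex.
  rewrite (Series_incr_n (y K) (S N)) //; last lia.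
  rewrite /= -sum_n_Reals => h2.
  apply: Rle_lt_trans; first exact: Rabs_triang.
  have h3 : 0 <= Series (fun k => y K (S (N + k))) <= Series (fun k => s (S N + k)%nat).
    have exs : ex_series (fun k => s (S N + k)%nat) by apply/(ex_series_incr_n s).
    split.
      apply: Series_nonneg; first by move=> n; apply hy.
      exact: (ex_series_le_nonneg _ (fun k => s (S N + k)%nat)).
    by apply: Series_le.
  rewrite (Rabs_pos_eq (Series _)); last by apply h3. lra.
Qed.

(** Zero vectors stay allowed, as in [orthonormal_basis], because a terminating deflation is padded
    with them; hence coefficient sequences are later required to vanish where [e] does. Totality is
    split off since it is the last property proved of the deflation sequence. *)
Definition orthonormal {H : HilbertSpace} (e : nat -> H) : Prop :=
  (forall n, e n = zero \/ norm (e n) = 1) /\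
  (forall m n, m <> n -> inner (e m) (e n) = RtoC 0).

Lemma basis_orthonormal {H : HilbertSpace} (e : nat -> H) :
  orthonormal_basis e -> orthonormal e.
Proof. by case=> h1 [h2 _]. Qed.

Definition lincomb {H : HilbertSpace} (e : nat -> H) (a : nat -> C) (n m : nat) : H :=
  sum_n_m (fun k => scal (a k) (e k)) n m.

Lemma sum_n_m_C0 (a : nat -> C) (n m : nat) :
  (forall k, (n <= k <= m)%nat -> a k = RtoC 0) ->
  sum_n_m (G := C_AbelianGroup) a n m = RtoC 0.
Proof.
  move=> h. rewrite (sum_n_m_ext_loc _ (fun _ => (zero : C_AbelianGroup))) //.
  exact: sum_n_m_const_zero.
Qed.

Lemma inner_lincomb_out {H : HilbertSpace} (e : nat -> H) (a : nat -> C) (k n m : nat) :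
  orthonormal e -> ~ (n <= k <= m)%nat -> inner (e k) (lincomb e a n m) = RtoC 0.
Proof.
  move=> [_ he] hk. rewrite inner_sum_r. apply: sum_n_m_C0 => j hj.
  rewrite inner_scal_r he; [ring | lia].
Qed.

Lemma inner_lincomb_in {H : HilbertSpace} (e : nat -> H) (a : nat -> C) (k n m : nat) :
  orthonormal e -> (forall j, e j = zero -> a j = RtoC 0) -> (n <= k <= m)%nat ->
  inner (e k) (lincomb e a n m) = a k.
Proof.
  move=> he ha hk. elim: m hk => [|m IH] hk.
    have -> : n = 0%nat by lia. have -> : k = 0%nat by lia.
    rewrite /lincomb sum_n_n inner_scal_r inner_norm.
    case: (proj1 he 0%nat) => e0; rewrite e0; first by rewrite ha //; ring.
    rewrite pow1. ring.
  rewrite /lincomb sum_n_Sm; last lia. rewrite inner_plus_r.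
  case: (Nat.eq_dec k (S m)) => [->|ne].
    rewrite -/(lincomb e a n m) inner_lincomb_out //; last lia.
    rewrite inner_scal_r inner_norm.
    case: (proj1 he (S m)) => e0; rewrite e0; first by rewrite ha //; ring.
    rewrite pow1. ring.
  rewrite IH; last lia. rewrite inner_scal_r (proj2 he) //. ring.
Qed.

Lemma norm_lincomb {H : HilbertSpace} (e : nat -> H) (a : nat -> C) (n m : nat) :
  orthonormal e -> (forall j, e j = zero -> a j = RtoC 0) ->
  norm (lincomb e a n m) ^ 2 = sum_n_m (fun k => Cmod (a k) ^ 2) n m.
Proof.
  move=> he ha.
  have one : forall k, norm (scal (a k) (e k)) ^ 2 = Cmod (a k) ^ 2.
    move=> k. rewrite norm_scal_C. case: (proj1 he k) => e0.
      by rewrite (ha _ e0) Cmod_0; ring.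
    rewrite e0. ring.
  case: (le_lt_dec n m) => [le|lt]; last first.
    rewrite /lincomb !sum_n_m_zero // norm_zero /zero /=. ring.
  elim: m le => [|m IH] le.
    have -> : n = 0%nat by lia. by rewrite /lincomb !sum_n_n one.
  case: (Nat.eq_dec n (S m)) => [->|ne]; first by rewrite /lincomb !sum_n_n one.
  rewrite /lincomb !sum_n_Sm; try lia.
  rewrite norm_plus_sqr one -/(lincomb e a n m) IH; last lia.
  rewrite inner_scal_r inner_conj inner_lincomb_out //; last lia.
  rewrite /plus /=. lra.
Qed.

Definition coef {H : HilbertSpace} (e : nat -> H) (x : H) (k : nat) : C := inner (e k) x.

Lemma coef_zero {H : HilbertSpace} (e : nat -> H) (x : H) (k : nat) :
  e k = zero -> coef e x k = RtoC 0.
Proof. by rewrite /coef => ->; rewrite inner_zero_l. Qed.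

Lemma sum_n_m_ge0 (a : nat -> R) (n m : nat) :
  (forall k, 0 <= a k) -> 0 <= sum_n_m a n m.
Proof.
  move=> h. have := sum_n_m_le (fun _ => 0) a n m h.
  by rewrite (sum_n_m_const_zero (G := R_AbelianGroup)).
Qed.

(** Bessel's inequality (the left side is nonnegative) and Parseval's identity (it tends to 0 for a
    basis) are both read off from this. *)
Lemma dist_lincomb {H : HilbertSpace} (e : nat -> H) (x : H) (n : nat) : orthonormal e ->
  norm (minus (lincomb e (coef e x) 0 n) x) ^ 2 =
  norm x ^ 2 - sum_n (fun k => Cmod (coef e x k) ^ 2) n.
Proof.
  move=> he. rewrite norm_minus_sqr norm_lincomb //; last by move=> j; exact: coef_zero.
  have -> : Re (inner (lincomb e (coef e x) 0 n) x) = sum_n (fun k => Cmod (coef e x k) ^ 2) n.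
    rewrite inner_conj re_conj inner_sum_r /sum_n.
    elim: n => [|n IH].
      rewrite !sum_n_n inner_scal_r (inner_conj _ (e 0%nat) x) -/(coef e x 0).
      rewrite Cmod_sqr. case: (coef e x 0) => a b; rewrite /Re /Im /=. ring.
    rewrite !sum_n_Sm; try lia. rewrite -IH inner_scal_r (inner_conj _ (e (S n)) x) -/(coef e x (S n)).
    rewrite Cmod_sqr /plus /=. case: (coef e x (S n)) => a b; rewrite /Re /Im /=. ring.
  rewrite /sum_n. ring.
Qed.

Lemma bessel {H : HilbertSpace} (e : nat -> H) (x : H) : orthonormal e ->
  ex_series (fun k => Cmod (coef e x k) ^ 2) /\
  Series (fun k => Cmod (coef e x k) ^ 2) <= norm x ^ 2.
Proof.
  move=> he. apply: nonneg_series_bounded => n; first exact: pow2_ge_0.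
  have := dist_lincomb e x n he.
  have := pow2_ge_0 (norm (minus (lincomb e (coef e x) 0 n) x)). lra.
Qed.

Lemma sqrt_lim_0 (u : nat -> R) : (forall n, 0 <= u n) ->
  is_lim_seq (fun n => u n ^ 2) 0 -> is_lim_seq u 0.
Proof.
  move=> h0 h. apply/is_lim_seq_spec => eps.
  have he : 0 < eps * eps by apply: Rmult_lt_0_compat; exact: cond_pos.
  have [N hN] := proj2 (is_lim_seq_spec _ _) h (mkposreal _ he).
  exists N => n hn. have := hN n hn. rewrite /= !Rminus_0_r => h1.
  rewrite Rabs_pos_eq //. have := Rle_abs (u n * (u n * 1)).
  have := cond_pos eps. have := h0 n. nra.
Qed.

Lemma inner_lim {H : HilbertSpace} (w : H) (u : nat -> H) (y : H) :
  is_lim_seq (fun n => norm (minus (u n) y)) 0 ->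
  is_lim_seq (fun n => Cmod (inner w (u n) - inner w y)) 0.
Proof.
  move=> h. have h2 := is_lim_seq_scal_l _ (norm w) _ h.
  rewrite /= Rmult_0_r in h2.
  apply: is_lim_seq_norm_squeeze h2 => n. split; first exact: Cmod_ge_0.
  rewrite -inner_minus_r. exact: Cauchy_Schwarz.
Qed.

Lemma Clim_unique (u : nat -> C) (l l' : C) :
  is_lim_seq (fun n => Cmod (u n - l)) 0 -> is_lim_seq (fun n => Cmod (u n - l')) 0 -> l = l'.
Proof.
  move=> /Cseq_lim_iff h /Cseq_lim_iff h'.
  exact: (filterlim_locally_unique (F := eventually) (V := C_R_NormedModule) _ _ _ h h').
Qed.

(** The squared distance of two partial sums is a block of the series of |a k|^2, so completeness
    gives the limit; its k-th coefficient is that of every partial sum past k. *)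
Lemma riesz_fischer {H : HilbertSpace} (e : nat -> H) (a : nat -> C) :
  orthonormal e -> (forall j, e j = zero -> a j = RtoC 0) ->
  ex_series (fun k => Cmod (a k) ^ 2) ->
  exists y : H, is_lim_seq (fun n => norm (minus (lincomb e a 0 n) y)) 0 /\
    forall k, inner (e k) y = a k.
Proof.
  move=> he ha ex.
  have diff : forall n m, (n <= m)%nat ->
     minus (lincomb e a 0 m) (lincomb e a 0 n) = lincomb e a (S n) m.
    move=> n m hnm. rewrite /lincomb (sum_n_m_Chasles _ 0 n m); try lia.
    vec.
  have [y hy] : exists y, is_lim_seq (fun n => norm (minus (lincomb e a 0 n) y)) 0.
    apply: cauchy_limit => eps heps.
    have he2 : 0 < eps ^ 2 by apply: pow_lt.
    have [N hN] := Series_tail_small _ (eps ^ 2) ex he2.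
    have key : forall n m, (N <= n)%nat -> (n <= m)%nat ->
        norm (minus (lincomb e a 0 m) (lincomb e a 0 n)) < eps.
      move=> n m hn hm. rewrite diff //.
      apply: Rsqr_incrst_0; [|exact: norm_ge_0|lra].
      rewrite !Rsqr_pow2 norm_lincomb //.
      apply: Rle_lt_trans hN.
      have exs : ex_series (fun k => Cmod (a (S N + k)%nat) ^ 2).
        by apply/(ex_series_incr_n (fun k => Cmod (a k) ^ 2) (S N)).
      have pos : forall k, 0 <= Cmod (a k) ^ 2 by move=> k; exact: pow2_ge_0.
      case: (Nat.eq_dec n m) => [->|ne].
        rewrite sum_n_m_zero; last lia. apply: Series_nonneg exs => k; exact: pos.
      have := sum_n_le_Series (fun k => Cmod (a (S N + k)%nat) ^ 2) (m - S N)%nat (fun k => pos _) exs.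
      apply: Rle_trans.
      have -> : sum_n (fun k => Cmod (a (S N + k)%nat) ^ 2) (m - S N) =
                sum_n_m (fun k => Cmod (a k) ^ 2) (S N) m.
        have e1 : m = (m - S N + S N)%nat by lia.
        rewrite {2}e1. elim: (m - S N)%nat => [|j IH]; first by rewrite sum_O sum_n_n Nat.add_0_r.
        rewrite sum_Sn IH -[(S j + S N)%nat]/(S (j + S N)) sum_n_Sm; last lia.
        congr plus. congr (Cmod (a _) ^ 2). lia.
      case: (Nat.eq_dec N n) => [->|nN]; first exact: Rle_refl.
      rewrite (sum_n_m_Chasles _ (S N) n m); try lia.
      have := sum_n_m_ge0 _ (S N) n pos. rewrite /plus /=. lra.
    exists N => n m hn hm. case: (le_lt_dec n m) => h.
      rewrite norm_minus_sym. exact: key. apply: key; lia.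
  exists y. split=> // k.
  apply: (Clim_unique (fun n => inner (e k) (lincomb e a 0 n))); first exact: inner_lim.
  apply: (is_lim_seq_ext_loc (fun _ => 0)); last exact: is_lim_seq_const.
  exists k => n hn. rewrite inner_lincomb_in //; last lia.
  have -> : (a k - a k)%C = RtoC 0 by ring. by rewrite Cmod_0.
Qed.

Lemma basis_ext {H : HilbertSpace} (e : nat -> H) (x y : H) : orthonormal_basis e ->
  (forall k, inner (e k) x = inner (e k) y) -> x = y.
Proof.
  move=> [_ [_ he]] h. apply: minus_eq_zero_eq. apply: he => n.
  rewrite inner_minus_r h. ring.
Qed.

(** Riesz-Fischer applied to the coefficients of x yields a limit with the same coefficients, and
    totality identifies it with x. *)
Lemma basis_expansion {H : HilbertSpace} (e : nat -> H) (x : H) : orthonormal_basis e ->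
  is_lim_seq (fun n => norm (minus (lincomb e (coef e x) 0 n) x)) 0.
Proof.
  move=> he.
  have ho := basis_orthonormal _ he.
  have [y [hy hc]] := riesz_fischer e (coef e x) ho (fun j => coef_zero e x j) (proj1 (bessel e x ho)).
  have yx : y = x by apply: (basis_ext e) => // k; rewrite hc.
  by move: hy; rewrite yx.
Qed.

Lemma parseval {H : HilbertSpace} (e : nat -> H) (x : H) : orthonormal_basis e ->
  is_series (fun k => Cmod (coef e x k) ^ 2) (norm x ^ 2).
Proof.
  move=> he. have ho := basis_orthonormal _ he.
  have h := basis_expansion e x he.
  have h2 := is_lim_seq_mult' _ _ _ _ h h. rewrite Rmult_0_r in h2.
  have h3 := is_lim_seq_minus' _ _ _ _ (is_lim_seq_const (norm x ^ 2)) h2.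
  rewrite Rminus_0_r in h3. apply: is_lim_seq_ext h3 => n.
  transitivity (sum_n (fun k => Cmod (coef e x k) ^ 2) n); last done.
  have := dist_lincomb e x n ho. lra.
Qed.

Lemma parseval_inner {H : HilbertSpace} (e : nat -> H) (x y : H) : orthonormal_basis e ->
  Cis_series (fun k => inner x (e k) * inner (e k) y)%C (inner x y).
Proof.
  move=> he. apply/Cis_series_iff.
  apply: is_lim_seq_ext (inner_lim x _ y (basis_expansion e y he)) => n.
  congr (Cmod (_ - _)%C). rewrite inner_sum_r /sum_n.
  apply: sum_n_m_ext => k. rewrite inner_scal_r /coef. exact: Cmult_comm.
Qed.

(** * Top eigenvector of a positive Hilbert-Schmidt operator *)

Lemma iter_sym {H : HilbertSpace} (A : H -> H) (k : nat) (x y : H) : pos_op A ->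
  inner x (Nat.iter k A y) = inner (Nat.iter k A x) y.
Proof.
  move=> hA. elim: k x y => [//|k IH] x y.
  rewrite Nat.iter_succ (po_sym _ hA) IH -Nat.iter_succ_r //.
Qed.

(** Cauchy-Schwarz for the form at A x and x gives |A x|^4 <= <A x, A A x> <x, A x>; the first
    factor is at most r |A x|^2, and |A x|^2 cancels. A bound on the form thus becomes a bound on
    the operator. *)
Lemma contraction_sqr {H : HilbertSpace} (A : H -> H) (r : R) (x : H) : pos_op A ->
  (forall x, Re (inner x (A x)) <= r * norm x ^ 2) ->
  norm (A x) ^ 2 <= r * Re (inner x (A x)).
Proof.
  move=> hA hr.
  have h := pos_op_CS A (A x) x hA.
  have h2 := hr (A x).
  have h3 := po_pos _ hA x.
  have e : Cmod (inner (A x) (A x)) ^ 2 = norm (A x) ^ 2 * norm (A x) ^ 2.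
    rewrite Cmod_sqr Im_inner_self -norm_sqr. ring.
  rewrite e in h.
  have h4 := pow2_ge_0 (norm (A x)).
  (* Nothing can be cancelled if A x = 0; a negative r then forces x = 0. *)
  case: (Req_dec (norm (A x) ^ 2) 0) => h0.
    rewrite h0. case: (Rle_dec 0 r) => hr0; first nra.
    have : norm x ^ 2 = 0.
      have := pow2_ge_0 (norm x). have := hr x. nra.
    move=> hx. have := hr x. rewrite hx. nra.
  have h5 : norm (A x) ^ 2 * norm (A x) ^ 2 <= (r * norm (A x) ^ 2) * Re (inner x (A x)) by nra.
  apply: (Rmult_le_reg_l (norm (A x) ^ 2)); nra.
Qed.

Lemma iter_split {H : HilbertSpace} (A : H -> H) (x : H) (i j : nat) : pos_op A ->
  inner x (Nat.iter (i + j) A x) = inner (Nat.iter i A x) (Nat.iter j A x).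
Proof.
  move=> hA. rewrite -iter_sym //. congr inner.
  elim: i => [//|i IH]. by rewrite /= IH.
Qed.

(* The moments <x, A^k x> decrease, since they are squared norms or values of the form of A at iterates of x. *)
Lemma moments_decr {H : HilbertSpace} (A : H -> H) (x : H) (k : nat) : pos_op A ->
  (forall x, Re (inner x (A x)) <= norm x ^ 2) ->
  Re (inner x (Nat.iter (S k) A x)) <= Re (inner x (Nat.iter k A x)).
Proof.
  move=> hA hr.
  have hr' : forall x, Re (inner x (A x)) <= 1 * norm x ^ 2 by move=> y; rewrite Rmult_1_l.
  have [j [->|->]] : exists j, k = (j + j)%nat \/ k = (j + S j)%nat.
    case: (Nat.Even_or_Odd k) => [[j hj]|[j hj]]; exists j; [left|right]; lia.
  - replace (S (j + j)) with (j + S j)%nat by lia.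
    rewrite !iter_split // -norm_sqr. exact: hr.
  - replace (S (j + S j)) with (S j + S j)%nat by lia.
    rewrite !iter_split // -norm_sqr.
    have := contraction_sqr A 1 (Nat.iter j A x) hA hr'. rewrite Rmult_1_l. done.
Qed.

(** By symmetry |A^a x - A^b x|^2 = m(2a) - 2 m(a + b) + m(2b), where the moments m(k) = <x, A^k x>
    decrease and are nonnegative, hence converge. *)
Lemma iter_converges {H : HilbertSpace} (A : H -> H) (x : H) : pos_op A ->
  (forall x, Re (inner x (A x)) <= norm x ^ 2) ->
  exists y, is_lim_seq (fun k => norm (minus (Nat.iter k A x) y)) 0.
Proof.
  move=> hA hr.
  set m := fun k => Re (inner x (Nat.iter k A x)).
  have [l hl] : ex_finite_lim_seq m.
    apply: (ex_finite_lim_seq_decr m 0) => k; first exact: moments_decr.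
    have [j [->|->]] : exists j, k = (j + j)%nat \/ k = (j + S j)%nat.
      case: (Nat.Even_or_Odd k) => [[j hj]|[j hj]]; exists j; [left|right]; lia.
    - rewrite /m iter_split // -norm_sqr. exact: pow2_ge_0.
    - rewrite /m iter_split //. exact: (po_pos _ hA).
  apply: cauchy_limit => eps he.
  (* The moments enter with weights 1, 2 and 1, so the total error is at most 4 eps^2 / 8. *)
  have he2 : 0 < eps ^ 2 / 8 by have := pow_lt eps 2 he; lra.
  have [N hN] := proj2 (is_lim_seq_spec _ _) hl (mkposreal _ he2).
  exists N => a b ha hb.
  apply: Rsqr_incrst_0; [|exact: norm_ge_0|lra]. rewrite !Rsqr_pow2.
  rewrite norm_minus_sqr !norm_sqr -!iter_split //.
  have h1 := hN (a + a)%nat ltac:(lia). have h2 := hN (a + b)%nat ltac:(lia). have h3 := hN (b + b)%nat ltac:(lia).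
  move: h1 h2 h3. rewrite -/(m (a + a)%nat) -/(m (a + b)%nat) -/(m (b + b)%nat) /=.
  move=> /Rabs_def2 ? /Rabs_def2 ? /Rabs_def2 ?.
  have := pow_lt eps 2 he. rewrite /=. lra.
Qed.

Lemma pos_op_minus {H : HilbertSpace} (A : H -> H) (x y : H) : pos_op A ->
  A (minus x y) = minus (A x) (A y).
Proof.
  move=> hA. rewrite /minus (po_plus _ hA) -scal_opp_one (po_scal _ hA) scal_opp_one //.
Qed.

(** Telescoping: each further application of the contraction A adds at most |x - A x| to the
    displacement. *)
Lemma iter_near {H : HilbertSpace} (A : H -> H) (x : H) (k : nat) : pos_op A ->
  (forall x, norm (A x) <= norm x) ->
  norm (minus x (Nat.iter k A x)) <= INR k * norm (minus x (A x)).
Proof.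
  move=> hA hc. elim: k => [|k IH].
    rewrite /= minus_eq_zero norm_zero. lra.
  apply: Rle_trans; first exact: (norm_minus_triangle _ (A x)).
  rewrite Nat.iter_succ -(pos_op_minus A) // S_INR.
  have := hc (minus x (Nat.iter k A x)). lra.
Qed.

(* Every A^k x converges to a fixed vector, because the moments <x, A^k x> do. If the limit vanished for
   all x = e n, dominated convergence would make the Hilbert-Schmidt norm of A^k tend to 0, although the
   operator norm of A^k stays 1. *)
Lemma fixed_vector {H : HilbertSpace} (A : H -> H) (e : nat -> H) : pos_op A ->
  (forall x, Re (inner x (A x)) <= norm x ^ 2) ->
  orthonormal_basis e -> ex_series (fun n => norm (A (e n)) ^ 2) ->
  (forall d, 0 < d -> exists x, norm x <= 1 /\ 1 - d < Re (inner x (A x))) ->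
  exists f, norm f = 1 /\ A f = f.
Proof.
  move=> hA hr he hs hmax.
  have hr' : forall x, Re (inner x (A x)) <= 1 * norm x ^ 2 by move=> y; rewrite Rmult_1_l.
  have hc : forall x, norm (A x) <= norm x.
    move=> x. have := contraction_sqr A 1 x hA hr'. rewrite Rmult_1_l => h1.
    apply: Rsqr_incr_0; rewrite ?Rsqr_pow2; try exact: norm_ge_0.
    have := hr x. lra.
  have hck : forall k x, norm (Nat.iter k A x) <= norm x.
    elim=> [|k IH] x; first exact: Rle_refl.
    rewrite Nat.iter_succ. apply: Rle_trans; first exact: hc. exact: IH.
  suff [n [y [hy yn0]]] : exists n y, is_lim_seq (fun k => norm (minus (Nat.iter k A (e n)) y)) 0
     /\ y <> zero.
    have Ay : A y = y.
      apply: (limit_seq_unique (fun k => Nat.iter (S k) A (e n))).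
      - apply: is_lim_seq_norm_squeeze hy => k. split; first exact: norm_ge_0.
        rewrite Nat.iter_succ -pos_op_minus //.
      - by apply/(is_lim_seq_incr_1 (fun k => norm (minus (Nat.iter k A (e n)) y))).
    have ny : norm y <> 0 by move=> h; apply: yn0; exact: norm_eq0.
    exists (scal (RtoC (/ norm y)) y). split.
      rewrite norm_scal_C Cmod_R Rabs_pos_eq; first by field.
      apply: Rlt_le. apply: Rinv_0_lt_compat. have := norm_ge_0 y. lra.
    by rewrite (po_scal _ hA) Ay.
  apply: NNPP => hno.
  have all0 : forall n, is_lim_seq (fun k => norm (Nat.iter k A (e n))) 0.
    move=> n. have [y hy] := iter_converges A (e n) hA hr.
    have y0 : y = zero by apply: NNPP => yn; apply: hno; exists n, y.
    apply: is_lim_seq_ext hy => k. by rewrite y0 minus_zero_r.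
  have T := tannery (fun k n => norm (Nat.iter (S k) A (e n)) ^ 2) (fun n => norm (A (e n)) ^ 2).
  have hlim : is_lim_seq (fun k => Series (fun n => norm (Nat.iter (S k) A (e n)) ^ 2)) 0.
    apply: T => //.
    - move=> K n. split; first exact: pow2_ge_0.
      apply: pow_incr. split; first exact: norm_ge_0.
      rewrite Nat.iter_succ_r. exact: hck.
    - move=> n.
      have h := proj1 (is_lim_seq_incr_1 _ _) (all0 n).
      have h2 := is_lim_seq_mult' _ _ _ _ h h. rewrite Rmult_0_r in h2.
      apply: is_lim_seq_ext h2 => k. ring.
  have [K hK] := proj2 (is_lim_seq_spec _ _) hlim (mkposreal (1/4) ltac:(lra)).
  have := hK K (Nat.le_refl _). rewrite /= Rminus_0_r.
  (* This d makes a near maximiser x nearly fixed: |x - A x|^2 <= 2 d, so [S K] steps move x by at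
     most 1/4. As |x| > 1 - 1/32, its image has norm above 1/2, whose square contradicts the
     Hilbert-Schmidt bound 1/4 by which [K] was chosen. *)
  set d := / (32 * (INR (S K)) ^ 2).
  have hS : 1 <= INR (S K) by rewrite S_INR; have := pos_INR K; lra.
  have hd : 0 < d by apply: Rinv_0_lt_compat; nra.
  have d32 : INR (S K) ^ 2 * d = / 32 by rewrite /d; field; lra.
  have [x [nx hx]] := hmax d hd.
  have near := iter_near A x (S K) hA hc.
  have dd : norm (minus x (A x)) ^ 2 <= 2 * d.
    rewrite norm_minus_sqr. have := contraction_sqr A 1 x hA hr'.
    have := norm_ge_0 x. nra.
  have near2 : norm (minus x (Nat.iter (S K) A x)) <= 1 / 4.
    apply: Rle_trans; first exact: near.
    apply: Rsqr_incr_0; try lra; last first.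
      apply: Rmult_le_pos; first lra. exact: norm_ge_0.
    rewrite !Rsqr_pow2 Rpow_mult_distr.
    apply: Rle_trans; first exact: (Rmult_le_compat_l _ _ _ (pow2_ge_0 (INR (S K))) dd).
    replace (INR (S K) ^ 2 * (2 * d)) with (2 * (INR (S K) ^ 2 * d)) by ring.
    rewrite d32. lra.
  have nx2 : 1 - / 32 < norm x.
    have := hr x. have := norm_ge_0 x.
    have : d <= / 32.
      rewrite -d32. have : 1 <= INR (S K) ^ 2 by nra. nra.
    nra.
  have big : 1 / 2 < norm (Nat.iter (S K) A x).
    have := norm_triangle (minus x (Nat.iter (S K) A x)) (Nat.iter (S K) A x).
    have -> : plus (minus x (Nat.iter (S K) A x)) (Nat.iter (S K) A x) = x by vec.
    lra.
  have par := parseval e (Nat.iter (S K) A x) he.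
  have ex2 : ex_series (fun n => norm (Nat.iter (S K) A (e n)) ^ 2).
    apply: ex_series_le_nonneg hs => n. split; first exact: pow2_ge_0.
    apply: pow_incr. split; first exact: norm_ge_0.
    rewrite Nat.iter_succ_r. exact: hck.
  (* The operator norm is at most the Hilbert-Schmidt norm: Parseval in [e], with the iterate moved
     onto e n by symmetry. *)
  have le : norm (Nat.iter (S K) A x) ^ 2 <= Series (fun n => norm (Nat.iter (S K) A (e n)) ^ 2).
    rewrite -(is_series_unique _ _ par). apply: Series_le => // n.
    split; first exact: pow2_ge_0.
    rewrite /coef iter_sym //. apply: pow_incr. split; first exact: Cmod_ge_0.
    apply: Rle_trans; first exact: Cauchy_Schwarz.
    have := norm_ge_0 (Nat.iter (S K) A (e n)). nra.
  move=> /Rabs_def2 [hlt _].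
  have : Series (fun n => norm (Nat.iter (S K) A (e n)) ^ 2) < 1 / 4 by exact: hlt.
  nra.
Qed.

(** Here r is the supremum of <x, A x> on the unit ball. If r > 0, then A / r has supremum 1, and
    its fixed vector is an eigenvector of A for r. *)
Lemma top_eigenvector {H : HilbertSpace} (A : H -> H) (e : nat -> H) (M : R) : pos_op A ->
  (forall x, norm (A x) <= M * norm x) ->
  orthonormal_basis e -> ex_series (fun n => norm (A (e n)) ^ 2) ->
  exists r, 0 <= r /\ (forall x, Re (inner x (A x)) <= r * norm x ^ 2) /\
    (r = 0 \/ exists f, norm f = 1 /\ A f = scal (RtoC r) f).
Proof.
  move=> hA hM he hs.
  set E := fun v => exists x, norm x <= 1 /\ v = Re (inner x (A x)).
  have E0 : E 0.
    exists zero. rewrite norm_zero inner_zero_l. split; [lra | done].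
  have bnd : bound E.
    exists (Rmax M 0). move=> v [x [nx ->]].
    apply: Rle_trans; first exact: Rle_abs.
    apply: Rle_trans; first exact: re_le_Cmod.
    apply: Rle_trans; first exact: Cauchy_Schwarz.
    have := hM x. have := norm_ge_0 x. have := norm_ge_0 (A x).
    have := Rmax_l M 0. have := Rmax_r M 0. nra.
  have [r [hub hlub]] := completeness E bnd (ex_intro _ 0 E0).
  have r0 : 0 <= r by exact: hub.
  have hr : forall x, Re (inner x (A x)) <= r * norm x ^ 2.
    move=> x. case: (Req_dec (norm x) 0) => nx.
      have -> : x = zero by exact: norm_eq0.
      rewrite inner_zero_l norm_zero /=. lra.
    have n0 := norm_ge_0 x.
    have hin : E (Re (inner (scal (RtoC (/ norm x)) x) (A (scal (RtoC (/ norm x)) x)))).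
      exists (scal (RtoC (/ norm x)) x). split=> //.
      rewrite norm_scal_C Cmod_R Rabs_pos_eq; first by right; field.
      apply: Rlt_le. apply: Rinv_0_lt_compat. lra.
    have := hub _ hin. rewrite (po_scal _ hA) inner_scal_l inner_scal_r.
    have -> : Re (Cconj (RtoC (/ norm x)) * (RtoC (/ norm x) * inner x (A x)))%C
              = (/ norm x) ^ 2 * Re (inner x (A x)).
      rewrite /Re /=. ring.
    move=> h. have h2 : norm x ^ 2 * ((/ norm x) ^ 2 * Re (inner x (A x))) <= norm x ^ 2 * r.
      apply: Rmult_le_compat_l => //. exact: pow2_ge_0.
    replace (norm x ^ 2 * ((/ norm x) ^ 2 * Re (inner x (A x)))) with (Re (inner x (A x))) in h2
      by (field; lra). lra.
  exists r. split=> //. split=> //.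
  case: (Req_dec r 0) => rn; first by left.
  right.
  have rp : 0 < r by lra.
  have rip : 0 < / r by exact: Rinv_0_lt_compat.
  pose A1 := fun x => scal (RtoC (/ r)) (A x).
  have reE : forall x, Re (inner x (A1 x)) = / r * Re (inner x (A x)).
    move=> x. rewrite /A1 inner_scal_r /Re /=. ring.
  have hA1 : pos_op A1.
    split.
    - move=> x y. by rewrite /A1 (po_plus _ hA) scal_distr_l.
    - move=> c x. rewrite /A1 (po_scal _ hA) !scal_assoc. congr scal. exact: Cmult_comm.
    - move=> x y. rewrite /A1 inner_scal_r inner_scal_l (po_sym _ hA). congr Cmult.
      apply: C_eq => /=; lra.
    - move=> x. rewrite reE. have := po_pos _ hA x. nra.
  have [|||f [nf hf]] := fixed_vector A1 e hA1 _ he.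
  - move=> x. rewrite reE. have := hr x => h.
    apply: (Rmult_le_reg_l r) => //. rewrite -Rmult_assoc Rinv_r // Rmult_1_l //.
  - apply: (ex_series_ext (fun n => (/ r) ^ 2 * norm (A (e n)) ^ 2)).
      move=> n. rewrite /A1 norm_scal_C Cmod_R Rabs_pos_eq; [by rewrite Rpow_mult_distr|lra].
    exact: (ex_series_scal_l ((/ r) ^ 2)).
  - move=> d hd. apply: NNPP => hno.
    have : r <= r - r * d.
      apply: hlub => v [x [nx ->]]. apply: Rnot_lt_le => lt. apply: hno.
      exists x. split=> //. rewrite reE.
      apply: (Rmult_lt_reg_l r) => //. rewrite -Rmult_assoc Rinv_r // Rmult_1_l. lra.
    nra.
  exists f. split=> //. rewrite -{2}hf /A1 scal_assoc.
  have -> : mult (RtoC r) (RtoC (/ r)) = one.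
    apply: C_eq => /=; field; done.
  by rewrite scal_one.
Qed.

(** * Spectral theorem by deflation *)

Lemma Series_sum_n (a : nat -> nat -> R) (N : nat) : (forall n, ex_series (a n)) ->
  ex_series (fun k => sum_n (fun n => a n k) N) /\
  sum_n (fun n => Series (a n)) N = Series (fun k => sum_n (fun n => a n k) N).
Proof.
  move=> ex. elim: N => [|N [IH1 IH2]].
    split.
      apply: ex_series_ext (ex 0%nat) => k. by rewrite sum_O.
    rewrite sum_O. apply: Series_ext => k. by rewrite sum_O.
  have e : forall k, sum_n (fun n => a n k) N + a (S N) k = sum_n (fun n => a n k) (S N).
    move=> k. by rewrite sum_Sn.
  split.
    apply: (ex_series_ext (fun k => sum_n (fun n => a n k) N + a (S N) k)) => //.
    exact: (ex_series_plus (V := R_NormedModule)).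
  rewrite sum_Sn IH2 -(Series_ext _ _ e) Series_plus //.
Qed.

(* B is A minus the rank one parts of the vectors in L, characterised by what it does on L and on its
   orthogonal complement. *)
Record deflated {H : HilbertSpace} (A : H -> H) (e : nat -> H) (M : R) (Q : H -> Prop)
    (B : H -> H) (L : list H) : Prop := {
  defl_pos : pos_op B;
  defl_bound : forall x, norm (B x) <= M * norm x;
  defl_HS : ex_series (fun n => norm (B (e n)) ^ 2);
  defl_list : forall h, In h L -> (h = zero \/ Q h) /\ B h = zero;
  defl_perp : forall x, (forall h, In h L -> inner h x = RtoC 0) -> B x = A x }.

(** For an eigenpair (r, g) of a symmetric B with |g| = 1 this is B followed by the projection onto
    the complement of g, so bounds on B survive. With g = 0 it is B itself, which covers the
    exhausted case. *)
Definition deflate {H : HilbertSpace} (B : H -> H) (r : R) (g x : H) : H :=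
  minus (B x) (scal (r * inner g x)%C g).

Lemma pos_op_0 {H : HilbertSpace} (A : H -> H) : pos_op A -> A zero = zero.
Proof.
  move=> hA. by rewrite -{1}(scal_zero_l (K := C_AbsRing) (zero : H)) (po_scal _ hA) (scal_zero_l (K := C_AbsRing)).
Qed.

Lemma norm_reject {H : HilbertSpace} (g x : H) : g = zero \/ norm g = 1 ->
  norm (minus x (scal (inner g x) g)) <= norm x.
Proof.
  case=> hg.
    rewrite hg. have -> : minus x (scal (inner zero x) zero) = x by vec. lra.
  apply: Rsqr_incr_0; try exact: norm_ge_0. rewrite !Rsqr_pow2 norm_minus_sqr norm_scal_C hg.
  rewrite inner_scal_r (inner_conj _ g x) Rmult_1_r Cmod_sqr.
  case: (inner g x) => a b; rewrite /Re /Im /=. nra.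
Qed.

(** The form of the deflated operator at x is that of B at x - <g, x> g. *)
Lemma deflate_pos {H : HilbertSpace} (B : H -> H) (r : R) (g : H) : pos_op B ->
  (g = zero \/ norm g = 1) -> B g = scal (RtoC r) g -> pos_op (deflate B r g).
Proof.
  move=> hB hg hgr. split.
  - move=> x y. rewrite /deflate (po_plus _ hB). vec.
  - move=> c x. rewrite /deflate (po_scal _ hB). vec.
  - move=> x y. rewrite /deflate. inner_simpl. rewrite (po_sym _ hB) !Cmult_conj (inner_conj _ x g).
    have -> : Cconj (RtoC r) = RtoC r by apply: C_eq => /=; lra.
    rewrite -(inner_conj _ x g) -(inner_conj _ g x). ring.
  - move=> x.
    have h := po_pos _ hB (minus x (scal (inner g x) g)).
    move: h. rewrite pos_op_minus // (po_scal _ hB) hgr /deflate. inner_simpl.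
    have -> : inner g (B x) = (r * inner g x)%C.
      rewrite (po_sym _ hB) hgr inner_scal_l. congr Cmult. apply: C_eq => /=; lra.
    rewrite (inner_conj _ g x).
    have : inner g g = RtoC 1 \/ g = zero.
      case: hg => hg; first by right. left. by rewrite inner_norm hg pow1.
    case=> [-> | ->]; last first.
      rewrite inner_zero_l. case: (inner x (B x)) => a b. rewrite /Re /=. lra.
    case: (inner x (B x)) => a b. case: (inner g x) => c d. rewrite /Re /=. lra.
Qed.

(** The top eigenvector of B for r > 0 is orthogonal to L, because B is symmetric and kills L; hence
    A agrees with B on it. It is then exchanged for a vector in Q with the same eigenvalue, which
    the hypothesis on Q keeps orthogonal to L. *)
Lemma deflation_step {H : HilbertSpace} (A : H -> H) (e : nat -> H) (M : R) (Q : H -> Prop)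
    (B : H -> H) (L : list H) :
  orthonormal_basis e ->
  (forall d f, 0 < d -> norm f = 1 -> A f = scal (RtoC d) f ->
     exists g, Q g /\ norm g = 1 /\ A g = scal (RtoC d) g /\
       forall h, Q h -> inner h f = RtoC 0 -> inner h g = RtoC 0) ->
  deflated A e M Q B L ->
  exists rf : R * H, let (r, f) := rf in
    0 <= r /\ (forall x, Re (inner x (B x)) <= r * norm x ^ 2) /\
    ((r = 0 /\ f = zero) \/ (0 < r /\ Q f /\ norm f = 1)) /\ A f = scal (RtoC r) f /\
    (forall h, In h L -> inner h f = RtoC 0) /\
    deflated A e M Q (deflate B r f) (f :: L).
Proof.
  move=> he hQ hB.
  have [r [r0 [hr hcase]]] := top_eigenvector B e M (defl_pos _ _ _ _ _ _ hB)
    (defl_bound _ _ _ _ _ _ hB) he (defl_HS _ _ _ _ _ _ hB).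
  have hBp := defl_pos _ _ _ _ _ _ hB.
  suff [f [h1 [h2 h3]]] : exists f, ((r = 0 /\ f = zero) \/ (0 < r /\ Q f /\ norm f = 1)) /\
       A f = scal (RtoC r) f /\ (forall h, In h L -> inner h f = RtoC 0).
    exists (r, f). do 5 (split=> //).
    have hBf : B f = scal (RtoC r) f by rewrite (defl_perp _ _ _ _ _ _ hB).
    have hf : f = zero \/ norm f = 1.
      case: h1 => [[_ ?]|[_ [_ ?]]]; [by left|by right].
    (* In this form deflation removes from B x its component along f, so neither the norm bound nor
       the Hilbert-Schmidt sum increases. *)
    have hd : forall x, deflate B r f x = minus (B x) (scal (inner f (B x)) f).
      move=> x. rewrite /deflate (po_sym _ hBp) hBf inner_scal_l.
      congr (minus _ (scal (_ * _)%C _)). apply: C_eq => /=; lra.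
    split.
    - exact: deflate_pos.
    - move=> x. rewrite hd. apply: Rle_trans; first exact: norm_reject.
      exact: (defl_bound _ _ _ _ _ _ hB).
    - apply: ex_series_le_nonneg (defl_HS _ _ _ _ _ _ hB) => n.
      split; first exact: pow2_ge_0. rewrite hd. apply: pow_incr. split; first exact: norm_ge_0.
      exact: norm_reject.
    - move=> h [<-|hin].
        split; first by case: h1 => [[_ ?]|[_ [? _]]]; [left|right].
        rewrite /deflate hBf inner_norm. case: hf => hf; rewrite hf; first vec.
        rewrite pow1. vec.
      have [q1 q2] := defl_list _ _ _ _ _ _ hB h hin. split=> //.
      rewrite /deflate q2 (inner_conj _ h f) h3 //.
      have -> : Cconj (RtoC 0) = RtoC 0 by apply: C_eq => /=; lra.
      vec.
    - move=> x hx.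
      rewrite /deflate (hx f); last by left.
      rewrite (defl_perp _ _ _ _ _ _ hB); last by move=> h hh; apply: hx; right.
      vec.
  (* If r = 0 the zero vector is recorded, so the construction yields an infinite sequence in every
     dimension. *)
  case: (Req_dec r 0) => rz.
    exists zero. split; first by left. split; last by move=> h _; rewrite inner_zero_r.
    rewrite -(defl_perp _ _ _ _ _ _ hB); last by move=> h _; rewrite inner_zero_r.
    rewrite pos_op_0 //. vec.
  case: hcase => // -[f [nf hf]].
  have rp : 0 < r by lra.
  have perp : forall h, In h L -> inner h f = RtoC 0.
    move=> h hh. have [_ q] := defl_list _ _ _ _ _ _ hB h hh.
    have e0 : (r * inner h f)%C = RtoC 0.
      by rewrite -inner_scal_r -hf (po_sym _ hBp) q inner_zero_l.
    have rne : RtoC r <> RtoC 0 by move=> /(f_equal fst) /=.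
    replace (inner h f) with (/ r * (r * inner h f))%C; last by field.
    rewrite e0. ring.
  have hAf : A f = scal (RtoC r) f by rewrite -(defl_perp _ _ _ _ _ _ hB).
  have [g [Qg [ng [hg hperp]]]] := hQ r f rp nf hAf.
  exists g. split; first by right. split=> // h hh.
  have [[->|q] _] := defl_list _ _ _ _ _ _ hB h hh; first by rewrite inner_zero_l.
  apply: hperp => //. exact: perp.
Qed.

(* Q singles out preferred eigenvectors: later A = T^* T for a resolvent T of S, and Q selects the
   eigenvectors of A that are eigenvectors of S. *)
Lemma spectral_theorem_HS {H : HilbertSpace} (A : H -> H) (e : nat -> H) (M : R) (Q : H -> Prop) :
  pos_op A -> (forall x, norm (A x) <= M * norm x) -> (forall x, A x = zero -> x = zero) ->
  orthonormal_basis e -> ex_series (fun n => norm (A (e n)) ^ 2) ->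
  (forall d f, 0 < d -> norm f = 1 -> A f = scal (RtoC d) f ->
     exists g, Q g /\ norm g = 1 /\ A g = scal (RtoC d) g /\
       forall h, Q h -> inner h f = RtoC 0 -> inner h g = RtoC 0) ->
  exists f : nat -> H, orthonormal_basis f /\ forall n, f n = zero \/ Q (f n).
Proof.
  move=> hA hM hinj he hs hQ.
  pose P := fun (BL : (H -> H) * list H) (rf : R * H) =>
    0 <= (fst rf) /\ (forall x, Re (inner x ((fst BL) x)) <= (fst rf) * norm x ^ 2) /\
    (((fst rf) = 0 /\ (snd rf) = zero) \/ (0 < (fst rf) /\ Q (snd rf) /\ norm (snd rf) = 1)) /\
    A (snd rf) = scal (RtoC (fst rf)) (snd rf) /\
    (forall h, In h (snd BL) -> inner h (snd rf) = RtoC 0) /\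
    deflated A e M Q (deflate (fst BL) (fst rf) (snd rf)) ((snd rf) :: (snd BL)).
  (* [ch] chooses one step, [st n] is the operator together with the list of vectors found after n
     steps, and [r n], [f n] is the eigenpair removed next. *)
  pose ch := fun BL => epsilon (inhabits (0, zero : H)) (P BL).
  have hch : forall BL, deflated A e M Q (fst BL) (snd BL) -> P BL (ch BL).
    move=> [B L] h. apply: epsilon_spec.
    have [[r f] hrf] := deflation_step A e M Q B L he hQ h. by exists (r, f).
  pose st := fun n => Nat.iter n (fun BL => (deflate (fst BL) (fst (ch BL)) (snd (ch BL)), (snd (ch BL)) :: (snd BL))) (A, nil).
  pose r := fun n => (fst (ch (st n))). pose f := fun n => (snd (ch (st n))).
  have hst : forall n, deflated A e M Q (fst (st n)) (snd (st n)).
    elim=> [|n IH]; first by split.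
    by have [_ [_ [_ [_ [_ ?]]]]] := hch _ IH.
  have hP : forall n, P (st n) (r n, f n) by move=> n; rewrite /r /f -surjective_pairing; exact: hch.
  have hin : forall n i, (i < n)%nat -> In (f i) (snd (st n)).
    elim=> [|n IH] i hi; first lia.
    case: (Nat.eq_dec i n) => [->|ne]; first by left.
    right. apply: IH. lia.
  have hin2 : forall n h, In h (snd (st n)) -> exists i, h = f i.
    elim=> [|n IH] h; first by [].
    case=> [<-|hh]; first by exists n. exact: IH hh.
  have hAf : forall n, A (f n) = scal (RtoC (r n)) (f n).
    move=> n. by have [_ [_ [_ [h _]]]] := hP n.
  have hor : orthonormal f.
    split.
      move=> n. have [_ [_ [h _]]] := hP n. case: h => [[_ ?]|[_ [_ ?]]]; [by left|by right].
    have lt : forall i n, (i < n)%nat -> inner (f i) (f n) = RtoC 0.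
      move=> i n hi. have [_ [_ [_ [_ [h _]]]]] := hP n. apply: h. exact: hin.
    move=> m n ne. case: (Nat.lt_trichotomy m n) => [h|[h|h]]; [exact: lt | by [] |].
    rewrite inner_conj lt //. apply: C_eq => /=; lra.
  have rE : forall n, r n ^ 2 = norm (A (f n)) ^ 2.
    move=> n. rewrite hAf norm_scal_C Cmod_R Rpow_mult_distr pow2_abs.
    have [_ [_ [h _]]] := hP n. case: h => [[/= -> ->]|[_ [_ /= ->]]]; ring_simplify; try ring.
  (* Each r n ^ 2 = |A (f n)|^2 is expanded by Parseval in [e]; exchanging the sums and applying
     Bessel for [f] bounds the total by the Hilbert-Schmidt sum of A. Hence r n tends to 0. *)
  have r2 : ex_series (fun n => r n ^ 2).
    apply: (proj1 (nonneg_series_bounded _ (Series (fun n => norm (A (e n)) ^ 2)) _ _)) => n.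
      exact: pow2_ge_0.
    have ex : forall n, is_series (fun k => Cmod (coef f (A (e k)) n) ^ 2) (r n ^ 2).
      move=> m. rewrite rE. apply: is_series_ext (parseval e (A (f m)) he) => k.
      rewrite /coef (po_sym _ hA) inner_conj Cmod_conj //.
    have [h1 h2] := Series_sum_n (fun n k => Cmod (coef f (A (e k)) n) ^ 2) n (fun m => ex_intro _ _ (ex m)).
    rewrite (sum_n_ext _ (fun n => Series (fun k => Cmod (coef f (A (e k)) n) ^ 2))); last first.
      move=> m. symmetry. exact: is_series_unique.
    rewrite h2. apply: Series_le => // k.
    have [b1 b2] := bessel f (A (e k)) hor.
    split.
      apply: sum_n_m_ge0 => j. exact: pow2_ge_0.
    apply: Rle_trans; last exact: b2.
    apply: sum_n_le_Series => // j. exact: pow2_ge_0.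
  have rlim : is_lim_seq r 0.
    apply: sqrt_lim_0; first by move=> n; have [? _] := hP n.
    exact: ex_series_lim_0.
  exists f. split; last first.
    move=> n. have [_ [_ [h _]]] := hP n. case: h => [[_ ?]|[_ [? _]]]; [by left|by right].
  split; first exact: (proj1 hor). split; first exact: (proj2 hor).
  move=> x hx. apply: hinj.
  (* On an x orthogonal to every f i all deflated operators act as A, so <x, A x> <= r n |x|^2 for
     all n. Letting n grow gives A x = 0. *)
  have hn : forall n, Re (inner x (A x)) <= r n * norm x ^ 2.
    move=> n. have [_ [h _]] := hP n. move: (h x).
    rewrite (defl_perp _ _ _ _ _ _ (hst n)) //.
    move=> g hg. have [i ->] := hin2 _ _ hg. exact: hx.
  have le0 : Re (inner x (A x)) <= 0.
    have := is_lim_seq_le (fun _ => Re (inner x (A x))) _ _ _ hn (is_lim_seq_const _)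
      (is_lim_seq_scal_r r (norm x ^ 2) 0 rlim).
    by rewrite /= Rmult_0_l.
  have ge0 := po_pos _ hA x.
  have h0 : Re (inner x (A x)) = 0 by lra.
  apply: norm_eq0.
  have [_ [hr0 _]] := hP 0%nat.
  have := contraction_sqr A (r 0%nat) x hA hr0. rewrite h0.
  have := norm_ge_0 (A x). nra.
Qed.

(** * Eigenbasis of an operator with trace class resolvent *)

Lemma op_zero {H : HilbertSpace} (S : operator H) : S zero = zero.
Proof.
  rewrite -{1}(scal_zero_l (K := C_AbsRing) (zero : H)) op_scal; last exact: dom_zero.
  exact: (scal_zero_l (K := C_AbsRing)).
Qed.

Lemma sa_symmetric {H : HilbertSpace} (S : operator H) (x y : H) : self_adjoint S ->
  dom S x -> dom S y -> inner (S x) y = inner x (S y).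
Proof. move=> [_ h] hx hy. exact: (proj2 (h y (S y)) (conj hy eq_refl) x hx). Qed.

Lemma resolvent_spec {H : HilbertSpace} (S : operator H) (z : C) :
  resolvent_set S z -> is_resolvent S z (resolvent S z).
Proof. move=> h. exact: epsilon_spec. Qed.

(** Polarisation: reality of the form at x + y and at x + i y gives the equality of the imaginary
    and of the real parts. *)
Lemma real_quadratic_sym {H : HilbertSpace} (B : H -> H) : is_linear B ->
  (forall x, Im (inner x (B x)) = 0) -> forall x y, inner x (B y) = inner (B x) y.
Proof.
  move=> hB him x y.
  rewrite (inner_conj _ y (B x)).
  have hp : forall u v, B (plus u v) = plus (B u) (B v) by exact: linear_plus.
  have hs : forall (c : C) u, B (scal c u) = scal c (B u) by exact: linear_scal.
  have h1 := him (plus x y). have h2 := him (plus x (scal Ci y)).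
  move: h1 h2. rewrite !hp !hs. inner_simpl.
  have := him x. have := him y.
  case: (inner x (B x)) => a1 a2; case: (inner y (B y)) => b1 b2.
  case: (inner x (B y)) => c1 c2; case: (inner y (B x)) => d1 d2.
  rewrite /Im /= => *. apply: C_eq => /=; lra.
Qed.

Lemma absolute_value_pos {H : HilbertSpace} (T B : H -> H) : is_absolute_value T B -> pos_op B.
Proof.
  move=> [hl [hp _]]. split.
  - exact: linear_plus.
  - exact: linear_scal.
  - apply: real_quadratic_sym => // x. apply hp.
  - move=> x. apply hp.
Qed.

Lemma pos_op_comp_self {H : HilbertSpace} (B : H -> H) : pos_op B -> pos_op (fun x => B (B x)).
Proof.
  move=> hB. split.
  - move=> x y. by rewrite !(po_plus _ hB).
  - move=> c x. by rewrite !(po_scal _ hB).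
  - move=> x y. by rewrite !(po_sym _ hB).
  - move=> x. rewrite (po_sym _ hB) -norm_sqr. exact: pow2_ge_0.
Qed.

(** Removing the parts b n <f n, .> f n one after another keeps the operator positive, and each
    removal lowers the form at x by one term of the sum. The induction also carries that the
    remaining f m are still eigenvectors. *)
Lemma deflated_diag_le {H : HilbertSpace} (B : H -> H) (f : nat -> H) (b : nat -> R) (x : H) (N : nat) :
  pos_op B -> orthonormal f -> (forall n, B (f n) = scal (RtoC (b n)) (f n)) ->
  sum_n (fun n => b n * Cmod (inner (f n) x) ^ 2) N <= Re (inner x (B x)).
Proof.
  move=> hB hf hb.
  suff [B' [h1 [h2 h3]]] : exists B', pos_op B' /\
      (forall m, (N < m)%nat -> B' (f m) = scal (RtoC (b m)) (f m)) /\
      Re (inner x (B' x)) = Re (inner x (B x)) - sum_n (fun n => b n * Cmod (inner (f n) x) ^ 2) N.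
    have := po_pos _ h1 x. lra.
  have re : forall B' r g, Re (inner x (deflate B' r g x)) = Re (inner x (B' x)) - r * Cmod (inner g x) ^ 2.
    move=> B' r g. rewrite /deflate inner_minus_r inner_scal_r (inner_conj _ g x) Cmod_sqr.
    case: (inner x (B' x)) => u v. case: (inner g x) => c d. rewrite /Re /Im /=. ring.
  have other : forall B' r k m, k <> m -> B' (f m) = scal (RtoC (b m)) (f m) ->
      deflate B' r (f k) (f m) = scal (RtoC (b m)) (f m).
    move=> B' r k m ne h. rewrite /deflate h (proj2 hf) //. vec.
  elim: N => [|N [B' [h1 [h2 h3]]]].
    exists (deflate B (b 0%nat) (f 0%nat)). split; first by apply: deflate_pos => //; apply (proj1 hf).
    split; last by rewrite re sum_O.
    move=> m hm. apply: other => //. lia.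
  exists (deflate B' (b (S N)) (f (S N))). split.
    apply: deflate_pos => //; first exact: (proj1 hf). apply: h2. lia.
  split; last by rewrite re h3 sum_Sn /plus /=; ring.
  move=> m hm. apply: other; first lia. apply: h2. lia.
Qed.

Definition real_eigenvector {H : HilbertSpace} (S : operator H) (g : H) : Prop :=
  dom S g /\ exists mu : R, S g = scal (RtoC mu) g.

Lemma Cinv_conj_mult (c : C) : c <> RtoC 0 -> (/ c * / Cconj c)%C = RtoC (/ Cmod c ^ 2).
Proof.
  move=> h. have hm : Cmod c <> 0 by move=> h0; apply: h; exact: Cmod_eq_0.
  have e := Cmod2_conj c.
  have hc : Cconj c <> RtoC 0.
    move=> h0. apply: hm. by rewrite -Cmod_conj h0 Cmod_0.
  have -> : RtoC (/ Cmod c ^ 2) = (/ RtoC (Cmod c ^ 2))%C by apply: RtoC_inv; exact: pow_nonzero.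
  rewrite e. field. by split.
Qed.

(** With D = T^* T: T g = g/(mu - z), and <T x, g> = <x, g>/conj (mu - z) because S is symmetric. *)
Lemma eigenvector_resolvent_square {H : HilbertSpace} (S : operator H) (z : C) (T D : H -> H)
    (g : H) (mu : R) :
  self_adjoint S -> is_resolvent S z T ->
  (forall x y, inner x (D y) = inner (T x) (T y)) ->
  dom S g -> S g = scal (RtoC mu) g -> RtoC mu <> z ->
  T g = scal (/ (mu - z))%C g /\ D g = scal (RtoC (/ Cmod (mu - z) ^ 2)) g.
Proof.
  move=> sa [Tl [Tr Tl2]] hD dg hg ne.
  have ne2 : (mu - z)%C <> RtoC 0.
    move=> h. apply: ne. replace z with (mu - (mu - z))%C by ring. rewrite h. ring.
  have Tg : T g = scal (/ (mu - z))%C g.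
    have := Tl2 g dg. rewrite hg => h.
    have e : minus (scal (RtoC mu) g) (scal z g) = scal (mu - z)%C g by vec.
    rewrite e (linear_scal _ Tl) in h. rewrite -{2}h scal_assoc.
    have -> : mult (/ (mu - z))%C (mu - z)%C = one by rewrite /mult /one /=; field.
    by rewrite scal_one.
  split=> //.
  apply: inner_ext => x. rewrite hD Tg inner_scal_r.
  have [dT eT] := Tr x.
  have h : (Cconj (mu - z) * inner (T x) g)%C = inner x g.
    rewrite -{2}eT inner_minus_l inner_scal_l (sa_symmetric S) // hg inner_scal_r.
    rewrite Cminus_conj. have -> : Cconj (RtoC mu) = RtoC mu by apply: C_eq => /=; lra.
    ring.
  have ne3 : Cconj (mu - z) <> RtoC 0.
    move=> h0. apply: ne2. apply: Cmod_eq_0. by rewrite -Cmod_conj h0 Cmod_0.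
  rewrite inner_scal_r -Cinv_conj_mult // -h. field. by split.
Qed.

Lemma resolvent_not_eigenvalue {H : HilbertSpace} (S : operator H) (z : C) (g : H) :
  resolvent_set S z -> dom S g -> S g = scal z g -> g = zero.
Proof.
  move=> [T [Tl [_ h]]] dg hg. rewrite -(h g dg) hg.
  have -> : minus (scal z g) (scal z g) = scal (RtoC 0) g by vec.
  rewrite (linear_scal _ Tl). vec.
Qed.

(* D is T^* T. With z = a + i b, an eigenvector D f = d f satisfies (S - a)^2 f = (1/d - b^2) f. Writing
   the factor as v^2, either f or (S - a + v) f is an eigenvector of S. *)
Lemma resolvent_square_eigenvector {H : HilbertSpace} (S : operator H) (z : C) (T D : H -> H)
    (d : R) (f : H) :
  self_adjoint S -> is_resolvent S z T ->
  (forall x y, inner x (D y) = inner (T x) (T y)) ->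
  0 < d -> norm f = 1 -> D f = scal (RtoC d) f ->
  exists g, real_eigenvector S g /\ norm g = 1 /\ D g = scal (RtoC d) g /\
    forall h, real_eigenvector S h -> inner h f = RtoC 0 -> inner h g = RtoC 0.
Proof.
  move=> sa hT hD dp nf Df.
  have [Tl [Tr Tl2]] := hT.
  have dne : RtoC d <> RtoC 0 by move=> /(f_equal fst) /=; lra.
  (* T^* inverts S - conj z: the adjoint criterion tested with u puts D f into the domain and gives
     (S - conj z) D f = T f. Since D f = d f, the vector f lies in the domain as well. *)
  have Dm : dom S (D f) /\ S (D f) = plus (T f) (scal (Cconj z) (D f)).
    apply/(proj2 sa) => u du.
    have := hD (minus (S u) (scal z u)) f. rewrite Tl2 // inner_minus_l inner_scal_l => h.
    rewrite inner_plus_r inner_scal_r -h. ring.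
  have fE : f = scal (/ d)%C (D f).
    rewrite Df scal_assoc.
    have -> : mult (/ d)%C (RtoC d) = one by rewrite /mult /one /=; field.
    by rewrite scal_one.
  have df : dom S f by rewrite fE; apply: dom_scal; exact: (proj1 Dm).
  have Sf : S f = plus (scal (/ d)%C (T f)) (scal (Cconj z) f).
    rewrite {1}fE op_scal; last exact: (proj1 Dm). rewrite (proj2 Dm) Df. apply: inner_ext => w. inner_simpl. field. done.
  have [dTf STf] := Tr f.
  have STf' : S (T f) = plus f (scal z (T f)).
    rewrite -{2}STf. vec.
  have dSf : dom S (S f).
    rewrite Sf. apply: dom_plus; apply: dom_scal => //.
  pose a := Re z. pose w := / d - Im z ^ 2.
  pose k : H := minus (S f) (scal (RtoC a) f).
  have dk : dom S k.
    rewrite /k /minus -scal_opp_one. apply: dom_plus => //. by do 2 apply: dom_scal.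
  have Sk : S k = plus (scal (RtoC a) k) (scal (RtoC w) f).
    have e : S k = minus (S (S f)) (scal (RtoC a) (S f)).
      rewrite /k /minus -scal_opp_one op_plus //; last by do 2 apply: dom_scal.
      rewrite op_scal; last exact: dom_scal. rewrite op_scal // scal_opp_one //.
    have SSf : S (S f) = plus (scal (/ d)%C (plus f (scal z (T f)))) (scal (Cconj z) (S f)).
      rewrite {1}Sf op_plus; [|exact: dom_scal|exact: dom_scal].
      rewrite op_scal // op_scal // STf' //.
    have Tf : scal (/ d)%C (T f) = minus (S f) (scal (Cconj z) f).
      rewrite Sf. vec.
    rewrite e SSf.
    have -> : scal (/ d)%C (plus f (scal z (T f))) = plus (scal (/ d)%C f) (scal z (minus (S f) (scal (Cconj z) f))).
      rewrite -Tf. vec.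
    rewrite /k. apply: inner_ext => v. inner_simpl.
    have -> : RtoC w = (/ d - RtoC (Im z) * RtoC (Im z))%C.
      have di : RtoC (/ d) = (/ d)%C by apply: RtoC_inv; lra.
      rewrite /w RtoC_minus di. congr Cminus. apply: C_eq => /=; ring.
    have zE : z = (RtoC a + Ci * RtoC (Im z))%C by apply: C_eq; rewrite /a /Re /Im /=; ring.
    have zcE : Cconj z = (RtoC a - Ci * RtoC (Im z))%C by apply: C_eq; rewrite /a /Re /Im /=; ring.
    have i2 : (Ci * Ci)%C = (- (1))%C by apply: C_eq => /=; ring.
    rewrite zcE.
    set p := inner v (S f). set q := inner v f. set m := RtoC (Im z). set A := RtoC a.
    have e3 : z = (A + Ci * m)%C by exact: zE.
    rewrite e3.
    transitivity ((/ d * q + (A + A) * p - (A * A) * q + (Ci * Ci) * (m * m) * q - A * p)%C); first by ring.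
    rewrite i2. ring.
  (* S f is orthogonal to every eigenvector of S that is orthogonal to f, so every combination of S
     f and f, the form taken by each candidate for g, is too. *)
  have kperp : forall c : R, forall h, real_eigenvector S h -> inner h f = RtoC 0 ->
      inner h (plus k (scal (RtoC c) f)) = RtoC 0.
    move=> c h [dh [nu hh]] h0. rewrite /k. inner_simpl. rewrite -(sa_symmetric S) // hh inner_scal_l h0. ring.
  (* Symmetry gives |(S - a) f|^2 = w |f|^2, so w has a real square root. *)
  have w0 : 0 <= w.
    have e : inner k k = (w * inner f f)%C.
      have e1 : inner f (S k) = (inner k k + a * inner f k)%C.
        rewrite -(sa_symmetric S) //. rewrite {2}/k. inner_simpl.
        have -> : Cconj (RtoC a) = RtoC a by apply: C_eq => /=; lra. ring.
      have e2 : inner f (S k) = (a * inner f k + w * inner f f)%C by rewrite Sk; inner_simpl.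
      rewrite e1 in e2.
      replace (inner k k) with (inner k k + a * inner f k - a * inner f k)%C by ring.
      rewrite e2. ring.
    move: e. rewrite !inner_norm nf => /(f_equal fst) /=. have := pow2_ge_0 (norm k). rewrite /=. lra.
  pose v := sqrt w.
  have vv : v * v = w by exact: sqrt_sqrt.
  (* A unit eigenvector of S for mu is one of D for 1/|mu - z|^2, which equals d when (mu - a)^2 =
     w; both a + v and a - v qualify. *)
  have nea : forall mu : R, forall g, real_eigenvector S g -> S g = scal (RtoC mu) g -> norm g = 1 ->
     (mu - a) ^ 2 = w -> D g = scal (RtoC d) g.
    move=> mu g [dg _] hg ng hmu.
    have ne : RtoC mu <> z.
      move=> h. have : g = zero.
        apply: (resolvent_not_eigenvalue S z) => //; [by exists T | by rewrite -h].
      move=> g0. move: ng. rewrite g0 norm_zero. lra.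
    have [_ ->] := eigenvector_resolvent_square S z T D g mu sa hT hD dg hg ne.
    congr (scal (RtoC _) g). rewrite Cmod_sqr.
    have -> : Re (mu - z)%C ^ 2 + Im (mu - z)%C ^ 2 = (mu - a) ^ 2 + Im z ^ 2 by rewrite /a /Re /Im /=; ring.
    rewrite hmu /w. replace (/ d - Im z ^ 2 + Im z ^ 2) with (/ d) by ring. by rewrite Rinv_inv.
  case: (classic (plus k (scal (RtoC v) f) = zero)) => hz.
    exists f. have Sfv : S f = scal (RtoC (a - v)) f.
      have -> : S f = minus (plus (plus k (scal (RtoC v) f)) (scal (RtoC a) f)) (scal (RtoC v) f) by rewrite /k; vec.
      rewrite hz RtoC_minus. vec.
    have re : real_eigenvector S f by split=> //; exists (a - v).
    split=> //.
  set g0 := plus k (scal (RtoC v) f).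
  have ng0 : norm g0 <> 0 by move=> h; apply: hz; exact: norm_eq0.
  have dg0 : dom S g0 by apply: dom_plus => //; exact: dom_scal.
  have Sg0 : S g0 = scal (RtoC (a + v)) g0.
    rewrite /g0 op_plus //; last exact: dom_scal. rewrite op_scal // Sk -vv RtoC_mult RtoC_plus.
    have -> : S f = plus k (scal (RtoC a) f) by rewrite /k; vec.
    vec.
  exists (scal (RtoC (/ norm g0)) g0).
  have dg : dom S (scal (RtoC (/ norm g0)) g0) by exact: dom_scal.
  have Sg : S (scal (RtoC (/ norm g0)) g0) = scal (RtoC (a + v)) (scal (RtoC (/ norm g0)) g0).
    rewrite op_scal // Sg0 !scal_assoc. congr scal. exact: Cmult_comm.
  have re : real_eigenvector S (scal (RtoC (/ norm g0)) g0) by split=> //; exists (a + v).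
  have n1 : norm (scal (RtoC (/ norm g0)) g0) = 1.
    rewrite norm_scal_C Cmod_R Rabs_pos_eq; first by field.
    apply: Rlt_le. apply: Rinv_0_lt_compat. have := norm_ge_0 g0. lra.
  split=> //. split=> //. split.
    apply: (nea (a + v)) => //. rewrite -vv. ring.
  move=> h hh h0. rewrite inner_scal_r kperp //. ring.
Qed.

(** The preferred eigenvectors of |T|^2 are also eigenvectors of |T|, with eigenvalue |mu n -
    z|^(-1); the trace of |T|, finite in the basis [e], bounds the sum of these eigenvalues. *)
Lemma eigenbasis {H : HilbertSpace} (S : operator H) (z : C) :
  self_adjoint S -> resolvent_set S z -> trace_class (resolvent S z) ->
  exists (f : nat -> H) (mu : nat -> R), orthonormal_basis f /\
    (forall n, dom S (f n)) /\ (forall n, S (f n) = scal (RtoC (mu n)) (f n)) /\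
    (forall n, f n <> zero -> RtoC (mu n) <> z) /\
    ex_series (fun n => norm (f n) / Cmod (mu n - z)).
Proof.
  move=> sa hz [Tl [B [e [hB [he hs]]]]].
  have hT := resolvent_spec S z hz.
  set T := resolvent S z in Tl hB hT.
  have hBp := absolute_value_pos T B hB.
  have [[Bp Bs [M [M0 hM]]] [_ BB]] := hB.
  have hDp := pos_op_comp_self B hBp.
  set D := fun x => B (B x) in hDp.
  have hD : forall x y, inner x (D y) = inner (T x) (T y) by exact: BB.
  have hBr : forall x, Re (inner x (B x)) <= M * norm x ^ 2.
    move=> x. apply: Rle_trans; first exact: Rle_abs.
    apply: Rle_trans; first exact: re_le_Cmod.
    apply: Rle_trans; first exact: Cauchy_Schwarz.
    have := hM x. have := norm_ge_0 x. nra.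
  have hDM : forall x, norm (D x) <= M * M * norm x.
    move=> x. apply: Rle_trans; first exact: hM. have := hM x. nra.
  (* |D (e n)|^2 <= M^2 |B (e n)|^2 <= M^3 <e n, B (e n)>, and the last terms sum to a multiple of
     the trace of B. *)
  have hDHS : ex_series (fun n => norm (D (e n)) ^ 2).
    apply: (ex_series_le_nonneg _ (fun n => M ^ 3 * Re (inner (e n) (B (e n))))); last exact: (ex_series_scal_l (M ^ 3)).
    move=> n. split; first exact: pow2_ge_0.
    have h1 := contraction_sqr B M (e n) hBp hBr.
    have h2 : norm (D (e n)) ^ 2 <= (M * norm (B (e n))) ^ 2.
      apply: pow_incr. split; [exact: norm_ge_0 | exact: hM].
    rewrite Rpow_mult_distr in h2.
    apply: Rle_trans; first exact: h2.
    have := Rmult_le_compat_l (M ^ 2) _ _ (pow2_ge_0 M) h1. rewrite /=. lra.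
  have hinj : forall x, D x = zero -> x = zero.
    move=> x hx. have := hD x x. rewrite hx inner_zero_r => h.
    have Tx : T x = zero by apply: inner_self_eq0.
    have [_ [h2 _]] := hT. have [_ <-] := h2 x. rewrite Tx op_zero. vec.
  have [f [hf hQ]] := spectral_theorem_HS D e (M * M) (real_eigenvector S) hDp hDM hinj he hDHS
    (fun d f h1 h2 h3 => resolvent_square_eigenvector S z T D d f sa hT hD h1 h2 h3).
  have hmu : forall n, exists mu : R, dom S (f n) /\ S (f n) = scal (RtoC mu) (f n).
    move=> n. case: (hQ n) => [->|[h1 [mu h2]]]; last by exists mu.
    (* For a padding vector every mu is an eigenvalue; 0 is taken as default. *)
    exists 0. split; first exact: dom_zero. rewrite op_zero. vec.
  have [mu hmu'] := choice _ hmu. exists f, mu.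
  split=> //. split; first by move=> n; exact: (proj1 (hmu' n)).
  split; first by move=> n; exact: (proj2 (hmu' n)).
  have hne : forall n, f n <> zero -> RtoC (mu n) <> z.
    move=> n hn h. apply: hn. have [h1 h2] := hmu' n.
    apply: (resolvent_not_eigenvalue S z) => //. by rewrite -h.
  split=> //.
  pose b := fun n => norm (f n) / Cmod (mu n - z).
  have hfo := basis_orthonormal _ hf.
  have Bf : forall n, B (f n) = scal (RtoC (b n)) (f n).
    move=> n. case: (proj1 hfo n) => fn; first by rewrite fn (pos_op_0 B hBp); vec.
    have fnz : f n <> zero by move=> h; move: fn; rewrite h norm_zero; lra.
    have [h1 h2] := hmu' n.
    have [_ Df] := eigenvector_resolvent_square S z T D (f n) (mu n) sa hT hD h1 h2 (hne n fnz).
    have pp : 0 < Cmod (mu n - z).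
      apply/Cmod_gt_0 => h. apply: (hne n fnz). replace z with (mu n - (mu n - z))%C by ring. rewrite h. ring.
    rewrite /b fn. set p := Cmod (mu n - z) in Df pp *.
    (* Uniqueness of the positive root: since D (f n) = f n / p^2, the vector g = (B - 1/p) f n
       satisfies (B + 1/p) g = 0, and B >= 0 forces g = 0. *)
    apply: minus_eq_zero_eq. set g := minus _ _.
    have eg : plus (B g) (scal (RtoC (1 / p)) g) = zero.
      rewrite /g pos_op_minus // (po_scal _ hBp) -/(D (f n)) Df.
      have -> : / p ^ 2 = (1 / p) * (1 / p) by field; lra.
      rewrite RtoC_mult. vec.
    have := po_pos _ hBp g. have h3 : Re (inner g (plus (B g) (scal (RtoC (1 / p)) g))) = 0 by rewrite eg inner_zero_r.
    move: h3. rewrite inner_plus_r inner_scal_r inner_norm.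
    have ip : 0 < 1 / p by apply: Rdiv_lt_0_compat; lra.
    case: (inner g (B g)) => u v. rewrite /Re /= => h3 h4. apply: norm_eq0. have := norm_ge_0 g => ng.
    have : (1 / p) * (norm g * norm g) = 0 by nra. move=> /Rmult_integral [|/Rmult_integral [|]]; lra.
  have b0 : forall n, 0 <= b n.
    move=> n. apply: Rmult_le_pos; first exact: norm_ge_0.
    case: (Req_dec (Cmod (mu n - z)) 0) => [->|h]; first by rewrite Rinv_0; lra.
    apply: Rlt_le. apply: Rinv_0_lt_compat. have := Cmod_ge_0 (mu n - z). lra.
  (* Each b n is expanded by Parseval in [e]; after exchanging the sums, the inner sum over n is at
     most <e k, B (e k)>. *)
  apply: (proj1 (nonneg_series_bounded _ (Series (fun n => Re (inner (e n) (B (e n))))) b0 _)) => N.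
  have ex : forall n, is_series (fun k => b n * Cmod (inner (f n) (e k)) ^ 2) (b n).
    move=> n. have := is_series_scal_l (b n) _ _ (parseval e (f n) he).
    have -> : scal (b n) (norm (f n) ^ 2) = b n.
      rewrite /scal /= /mult /= /b. case: (proj1 hfo n) => ->; rewrite ?norm_zero /Rdiv; ring.
    apply: is_series_ext => k. by rewrite /coef inner_conj Cmod_conj.
  have [h1 h2] := Series_sum_n (fun n k => b n * Cmod (inner (f n) (e k)) ^ 2) N (fun m => ex_intro _ _ (ex m)).
  rewrite (sum_n_ext _ (fun n => Series (fun k => b n * Cmod (inner (f n) (e k)) ^ 2))); last first.
    move=> m. symmetry. exact: is_series_unique.
  rewrite h2. apply: Series_le => // k. split.
    apply: sum_n_m_ge0 => j. apply: Rmult_le_pos => //. exact: pow2_ge_0.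
  exact: deflated_diag_le.
Qed.

(** * Spectrum, resolvent and trace in an eigenbasis *)

Ltac cring := match goal with |- @eq _ ?a ?b => change (@eq C a b) end; ring.
Record is_eigenbasis {H : HilbertSpace} (S : operator H) (f : nat -> H) (mu : nat -> R) : Prop := {
  eb_basis : orthonormal_basis f;
  eb_dom : forall n, dom S (f n);
  eb_eig : forall n, S (f n) = scal (RtoC (mu n)) (f n) }.

(** The factor |f n| is 0 or 1 for the bases in use and only switches off the padding vectors, whose
    [mu n] carries no meaning. *)
Definition resolvent_summable {H : HilbertSpace} (f : nat -> H) (mu : nat -> R) (z : C) : Prop :=
  (forall n, f n <> zero -> RtoC (mu n) <> z) /\
  ex_series (fun n => norm (f n) / Cmod (mu n - z)).

Lemma eb_norm {H : HilbertSpace} (S : operator H) f mu n : is_eigenbasis S f mu ->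
  f n <> zero -> norm (f n) = 1.
Proof. move=> h hn. by case: (proj1 (basis_orthonormal _ (eb_basis _ _ _ h)) n). Qed.

Lemma Cminus_neq0 (a b : C) : a <> b -> (a - b)%C <> RtoC 0.
Proof. move=> h e. apply: h. replace a with (a - b + b)%C by ring. rewrite e. ring. Qed.

(** The terms of a convergent series tend to 0, so |mu n - z0| tends to infinity along the nonzero
    vectors. *)
Lemma eigenvalues_escape {H : HilbertSpace} (S : operator H) f mu z0 (r : R) :
  is_eigenbasis S f mu -> resolvent_summable f mu z0 ->
  exists N, forall n, (N <= n)%nat -> f n <> zero -> r <= Cmod (mu n - z0).
Proof.
  move=> hf [hne hs].
  have hr : 0 < / (Rabs r + 1) by apply: Rinv_0_lt_compat; have := Rabs_pos r; lra.
  have hl : is_lim_seq (fun n => norm (f n) / Cmod (mu n - z0)) 0 by exact: ex_series_lim_0.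
  have [N hN] := proj2 (is_lim_seq_spec _ _) hl (mkposreal _ hr).
  exists N => n hn fn. have := hN n hn. rewrite /= Rminus_0_r.
  rewrite (eb_norm S f mu) // /Rdiv Rmult_1_l.
  have p : 0 < Cmod (mu n - z0) by apply/Cmod_gt_0; apply: Cminus_neq0; exact: hne.
  rewrite Rabs_pos_eq; last by apply: Rlt_le; exact: Rinv_0_lt_compat.
  move=> h. have := Rabs_pos r. have := Rle_abs r => h1 h2.
  have h3 : Rabs r + 1 < Cmod (mu n - z0).
    rewrite -(Rinv_inv (Rabs r + 1)) -(Rinv_inv (Cmod _)). apply: Rinv_lt_contravar => //.
    apply: Rmult_lt_0_compat => //. exact: Rinv_0_lt_compat.
  lra.
Qed.

Lemma finite_min_pos (P : nat -> Prop) (g : nat -> R) (N : nat) :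
  (forall n, P n -> 0 < g n) -> exists d, 0 < d /\ forall n, (n < N)%nat -> P n -> d <= g n.
Proof.
  move=> h. elim: N => [|N [d [dp hd]]]; first by exists 1; split; [lra | move=> n; lia].
  case: (classic (P N)) => hN.
    exists (Rmin d (g N)). split; first by apply: Rmin_pos => //; exact: h.
    move=> n hn hp. case: (Nat.eq_dec n N) => [->|ne]; first exact: Rmin_r.
    apply: Rle_trans; first exact: Rmin_l. apply: hd => //. lia.
  exists d. split=> // n hn hp. case: (Nat.eq_dec n N) => [e|ne]; first by rewrite e in hp.
  apply: hd => //. lia.
Qed.

Lemma eigenvalues_dist {H : HilbertSpace} (S : operator H) f mu z0 z :
  is_eigenbasis S f mu -> resolvent_summable f mu z0 ->
  (forall n, f n <> zero -> RtoC (mu n) <> z) ->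
  exists d, 0 < d /\ forall n, f n <> zero -> d <= Cmod (mu n - z).
Proof.
  move=> hf hs hz.
  have [N hN] := eigenvalues_escape S f mu z0 (1 + Cmod (z - z0)) hf hs.
  have [|d [dp hd]] := finite_min_pos (fun n => f n <> zero) (fun n => Cmod (mu n - z)) N.
    move=> n fn. apply/Cmod_gt_0. apply: Cminus_neq0. exact: hz.
  exists (Rmin d 1). split; first by apply: Rmin_pos => //; lra.
  move=> n fn. case: (le_lt_dec N n) => hn; last first.
    apply: Rle_trans; first exact: Rmin_l. exact: hd.
  apply: Rle_trans; first exact: Rmin_r.
  have := hN n hn fn. have := Cmod_triangle (mu n - z) (z - z0).
  have -> : (mu n - z + (z - z0))%C = (mu n - z0)%C by ring. lra.
Qed.

(** From |mu - z0| <= |mu - z| + |z - z0| and |mu - z| >= d. The factor is kept explicit because it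
    grows linearly in z, which costs one power of |z| under the contour integral. *)
Lemma resolvent_term_le {H : HilbertSpace} (S : operator H) f mu z0 z d n :
  is_eigenbasis S f mu -> resolvent_summable f mu z0 -> 0 < d ->
  (f n <> zero -> d <= Cmod (mu n - z)) ->
  0 <= norm (f n) / Cmod (mu n - z) <= (1 + Cmod (z - z0) / d) * (norm (f n) / Cmod (mu n - z0)).
Proof.
  move=> hf [hne hs] dp hd.
  case: (classic (f n = zero)) => fn.
    rewrite fn norm_zero /Rdiv !Rmult_0_l Rmult_0_r. lra.
  have h1 := hd fn.
  have p : 0 < Cmod (mu n - z0) by apply/Cmod_gt_0; apply: Cminus_neq0; exact: hne.
  rewrite (eb_norm S f mu) // /Rdiv !Rmult_1_l.
  have q : 0 < Cmod (mu n - z) by lra.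
  split; first by apply: Rlt_le; exact: Rinv_0_lt_compat.
  apply: (Rmult_le_reg_r (Cmod (mu n - z0) * Cmod (mu n - z))); first exact: Rmult_lt_0_compat.
  replace (/ Cmod (mu n - z) * (Cmod (mu n - z0) * Cmod (mu n - z))) with (Cmod (mu n - z0)) by (field; lra).
  replace ((1 + Cmod (z - z0) * / d) * / Cmod (mu n - z0) * (Cmod (mu n - z0) * Cmod (mu n - z)))
    with (Cmod (mu n - z) + Cmod (z - z0) * (Cmod (mu n - z) / d)) by (field; lra).
  have := Cmod_triangle (mu n - z) (z - z0).
  have -> : (mu n - z + (z - z0))%C = (mu n - z0)%C by ring.
  have h2 : 1 <= Cmod (mu n - z) / d.
    apply: (Rmult_le_reg_r d) => //. rewrite /Rdiv Rmult_assoc Rinv_l; lra.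
  have := Cmod_ge_0 (z - z0). nra.
Qed.

Lemma resolvent_summable_all {H : HilbertSpace} (S : operator H) f mu z0 z :
  is_eigenbasis S f mu -> resolvent_summable f mu z0 ->
  (forall n, f n <> zero -> RtoC (mu n) <> z) -> resolvent_summable f mu z.
Proof.
  move=> hf hs hz. split=> //.
  have [d [dp hd]] := eigenvalues_dist S f mu z0 z hf hs hz.
  apply: (ex_series_le_nonneg _ (fun n => (1 + Cmod (z - z0) / d) * (norm (f n) / Cmod (mu n - z0)))).
    move=> n. apply: (resolvent_term_le S) => //. exact: hd.
  apply: (ex_series_scal_l (1 + Cmod (z - z0) / d)). exact: (proj2 hs).
Qed.

(** Riesz-Fischer builds B x from the coefficients c n <f n, x>; linearity and the bound are then
    checked on coefficients. *)
Lemma diag_op {H : HilbertSpace} (f : nat -> H) (c : nat -> C) (M : R) : orthonormal_basis f ->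
  (forall n, f n <> zero -> Cmod (c n) <= M) ->
  exists B : H -> H, is_linear B /\ forall x n, inner (f n) (B x) = (c n * inner (f n) x)%C.
Proof.
  move=> hf hM. have ho := basis_orthonormal _ hf.
  have le : forall x n, 0 <= Cmod (c n * coef f x n) ^ 2 <= M ^ 2 * Cmod (coef f x n) ^ 2.
    move=> x n. split; first exact: pow2_ge_0.
    case: (classic (f n = zero)) => fn.
      rewrite coef_zero // Cmult_0_r Cmod_0. lra.
    rewrite Cmod_mult Rpow_mult_distr. apply: Rmult_le_compat_r; first exact: pow2_ge_0.
    apply: pow_incr. split; [exact: Cmod_ge_0|exact: hM].
  have exb : forall x, ex_series (fun n => M ^ 2 * Cmod (coef f x n) ^ 2).
    move=> x. apply: (ex_series_scal_l (M ^ 2)). exact: (proj1 (bessel f x ho)).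
  have ex : forall x, exists y, forall n, inner (f n) y = (c n * inner (f n) x)%C.
    move=> x.
    have [||y [_ hy]] := riesz_fischer f (fun n => (c n * coef f x n)%C) ho; last by exists y.
      move=> j fj. rewrite coef_zero //. ring.
    exact: ex_series_le_nonneg (le x) (exb x).
  have [B hB] := choice _ ex. exists B. split=> //. split.
  - move=> x y. apply: (basis_ext f) => // k. rewrite inner_plus_r !hB inner_plus_r. ring.
  - move=> k x. apply: (basis_ext f) => // n. rewrite inner_scal_r !hB inner_scal_r. ring.
  - exists (Rabs M + 1). split; first by have := Rabs_pos M; lra.
    move=> x. apply: Rsqr_incr_0; [|exact: norm_ge_0|]; last first.
      apply: Rmult_le_pos; last exact: norm_ge_0. have := Rabs_pos M. lra.
    rewrite !Rsqr_pow2 Rpow_mult_distr.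
    have p1 := is_series_unique _ _ (parseval f (B x) hf).
    have p2 := is_series_unique _ _ (parseval f x hf).
    rewrite -p1. apply: Rle_trans (_ : M ^ 2 * norm x ^ 2 <= _).
      rewrite -p2 -Series_scal_l. apply: Series_le => // n.
      rewrite {1 2}/coef hB. exact: le.
    apply: Rmult_le_compat_r; first exact: pow2_ge_0.
    rewrite -(pow2_abs M). apply: pow_incr. have := Rabs_pos M. lra.
Qed.

(** The diagonal operator with entries 1/(mu n - z) is the resolvent. It maps into the domain by the
    adjoint criterion, both sides of which are expanded by Parseval and compared term by term. *)
Lemma eigenbasis_resolvent {H : HilbertSpace} (S : operator H) f mu z0 z :
  self_adjoint S -> is_eigenbasis S f mu -> resolvent_summable f mu z0 ->
  (forall n, f n <> zero -> RtoC (mu n) <> z) -> resolvent_set S z.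
Proof.
  move=> sa hf hs hz.
  have [d [dp hd]] := eigenvalues_dist S f mu z0 z hf hs hz.
  have hb := eb_basis _ _ _ hf.
  have [|B [Bl hB]] := diag_op f (fun n => / (mu n - z))%C (/ d) hb.
    move=> n fn. rewrite Cmod_inv; last by apply: Cminus_neq0; exact: hz.
    apply: Rinv_le_contravar => //. exact: hd.
  exists B. split=> //.
  have ne : forall n, f n <> zero -> (mu n - z)%C <> RtoC 0 by move=> n fn; apply: Cminus_neq0; exact: hz.
  have one : forall x, dom S (B x) /\ S (B x) = plus x (scal z (B x)).
    move=> x. apply/(proj2 sa) => u du.
    apply: (Cis_series_unique (fun n => inner (S u) (f n) * inner (f n) (B x))%C).
      exact: parseval_inner.
    apply: is_series_ext (parseval_inner f u (plus x (scal z (B x))) hb) => n.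
    rewrite (sa_symmetric S) //; last exact: (eb_dom _ _ _ hf).
    rewrite (eb_eig _ _ _ hf).
    case: (classic (f n = zero)) => fn.
      rewrite fn; inner_simpl; cring.
    rewrite inner_plus_r !inner_scal_r hB.
    apply: (eq_trans (y := (inner u (f n) * (mu n * / (mu n - z)) * inner (f n) x)%C)).
      field. exact: ne. ring.
  split.
  - move=> x. have [h1 h2] := one x. split=> //. rewrite h2. vec.
  - move=> x dx. apply: (basis_ext f) => // n.
    case: (classic (f n = zero)) => fn; first by rewrite fn !inner_zero_l.
    rewrite hB inner_minus_r -(sa_symmetric S) //; last exact: (eb_dom _ _ _ hf).
    rewrite (eb_eig _ _ _ hf) inner_scal_l inner_scal_r.
    have -> : Cconj (RtoC (mu n)) = RtoC (mu n) by apply: C_eq => /=; lra.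
    field. exact: ne.
Qed.

Lemma eigenbasis_spectrum {H : HilbertSpace} (S : operator H) f mu z0 z :
  self_adjoint S -> is_eigenbasis S f mu -> resolvent_summable f mu z0 ->
  spectrum S z <-> exists n, f n <> zero /\ RtoC (mu n) = z.
Proof.
  move=> sa hf hs. split.
  - move=> h. apply: NNPP => hn. apply: h. apply: (eigenbasis_resolvent S f mu z0) => // n fn e.
    apply: hn. by exists n.
  - move=> [n [fn e]] hr. apply: fn. apply: (resolvent_not_eigenvalue S z) => //.
      exact: (eb_dom _ _ _ hf). by rewrite (eb_eig _ _ _ hf) e.
Qed.

Lemma Cis_series_sum_n (a : nat -> nat -> C) (A : nat -> C) (N : nat) :
  (forall n, Cis_series (a n) (A n)) ->
  Cis_series (fun k => Csum_n (fun n => a n k) N)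
    (Csum_n A N).
Proof.
  move=> h. elim: N => [|N IH].
    rewrite sum_O. apply: is_series_ext (h 0%nat) => k. by rewrite sum_O.
  rewrite sum_Sn.
  apply: is_series_ext (is_series_plus _ _ _ _ IH (h (S N))) => k. by rewrite sum_Sn.
Qed.

(** The row remainders after K terms are bounded by 2 s n and tend to 0 for each n, so the sum of
    their moduli over n tends to 0 by [tannery]; it bounds the distance from l of the K-th partial
    sum of the column sums. *)
Lemma Cseries_fubini (a : nat -> nat -> C) (d : nat -> nat -> R) (s : nat -> R) (A B : nat -> C) (l : C) :
  (forall n k, Cmod (a n k) <= d n k) -> (forall n, is_series (d n) (s n)) -> ex_series s ->
  (forall n, Cis_series (a n) (A n)) ->
  (forall k, Cis_series (fun n => a n k) (B k)) ->
  Cis_series A l -> Cis_series B l.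
Proof.
  move=> had hd hs hA hB hl.
  have d0 : forall n k, 0 <= d n k by move=> n k; apply: Rle_trans (had n k); exact: Cmod_ge_0.
  pose r := fun K n => (A n - Csum_n (a n) K)%C.
  have partial : forall n K, Cmod (Csum_n (a n) K) <= s n.
    move=> n K. apply: Rle_trans (_ : sum_n (d n) K <= _).
      elim: K => [|K IH]; first by rewrite !sum_O.
      rewrite !sum_Sn. apply: Rle_trans; first exact: Cmod_triangle. exact: Rplus_le_compat.
    rewrite -(is_series_unique _ _ (hd n)). apply: sum_n_le_Series => //. by exists (s n).
  have As : forall n, Cmod (A n) <= s n.
    move=> n. rewrite -(is_series_unique _ _ (hd n)).
    apply: (Cis_series_norm (a n)) => //. by exists (s n).
  have rs : forall K n, 0 <= Cmod (r K n) <= 2 * s n.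
    move=> K n. split; first exact: Cmod_ge_0. rewrite /r.
    apply: Rle_trans; first exact: Cmod_triangle. rewrite Cmod_opp.
    have := partial n K. have := As n. lra.
  have s2 : ex_series (fun n => 2 * s n) by exact: (ex_series_scal_l 2).
  have hr : forall n, is_lim_seq (fun K => Cmod (r K n)) 0.
    move=> n. apply: is_lim_seq_ext (proj1 (Cis_series_iff _ _) (hA n)) => K.
    rewrite /r -Cmod_opp. congr Cmod. ring.
  have T := tannery (fun K n => Cmod (r K n)) _ rs s2 hr.
  apply/Cis_series_iff. apply: is_lim_seq_norm_squeeze T => K. split; first exact: Cmod_ge_0.
  have hK : Cis_series (fun n => Csum_n (a n) K)
      (Csum_n B K).
    exact: (Cis_series_sum_n (fun k n => a n k)).
  have hm := is_series_minus _ _ _ _ hl hK.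
  rewrite -Cmod_opp.
  replace (- (Csum_n B K - l))%C with (l - Csum_n B K)%C by ring.
  apply: (Cis_series_norm (r K)) => //; first by move=> n; right.
  apply: ex_series_le_nonneg (fun n => rs K n) s2.
Qed.

Lemma resolvent_coef {H : HilbertSpace} (S : operator H) f mu z T n x :
  self_adjoint S -> is_eigenbasis S f mu -> is_resolvent S z T -> RtoC (mu n) <> z ->
  inner (f n) (T x) = (/ (mu n - z) * inner (f n) x)%C.
Proof.
  move=> sa hf [_ [h _]] ne. have [dT e] := h x.
  rewrite -{2}e inner_minus_r -(sa_symmetric S) //; last exact: (eb_dom _ _ _ hf).
  rewrite (eb_eig _ _ _ hf) inner_scal_l inner_scal_r.
  have -> : Cconj (RtoC (mu n)) = RtoC (mu n) by apply: C_eq => /=; lra.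
  field. exact: Cminus_neq0.
Qed.

Lemma trace_unique {H : HilbertSpace} (f : nat -> H) (T : H -> H) (l : C) :
  orthonormal_basis f -> is_trace T l -> trace T = l.
Proof.
  move=> hf hl. apply: (iota_unique (V := C_R_CompleteNormedModule)) => // y hy.
  exact: Cis_series_unique (hy f hf) (hl f hf).
Qed.

(** In any basis [e], <e k, T (e k)> is the sum over n of |<f n, e k>|^2/(mu n - z). By Fubini the
    sum over k may be done first, and the sum of |<f n, e k>|^2 over k is 1 for each nonzero f n. *)
Lemma resolvent_trace {H : HilbertSpace} (S : operator H) f mu z :
  self_adjoint S -> is_eigenbasis S f mu -> resolvent_summable f mu z -> resolvent_set S z ->
  Cis_series (fun n => RtoC (norm (f n)) / (mu n - z))%C (trace (resolvent S z)).
Proof.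
  move=> sa hf [hz hs] hr.
  have hT := resolvent_spec S z hr. have hb := eb_basis _ _ _ hf.
  have cm : forall n, Cmod (RtoC (norm (f n)) / (mu n - z))%C = norm (f n) / Cmod (mu n - z).
    move=> n. case: (classic (f n = zero)) => fn.
      by rewrite fn norm_zero /Cdiv Cmult_0_l Cmod_0 /Rdiv Rmult_0_l.
    rewrite Cmod_div; last by apply: Cminus_neq0; exact: hz.
    rewrite Cmod_R Rabs_pos_eq //. exact: norm_ge_0.
  have [l hl] := Cis_series_abs _ (ex_series_ext _ _ (fun n => eq_sym (cm n)) hs).
  rewrite (trace_unique f _ l) // => e he.
  apply: (Cseries_fubini (fun n k => RtoC (norm (f n)) / (mu n - z) * (Cmod (inner (f n) (e k)) ^ 2)%R)%C
    (fun n k => norm (f n) / Cmod (mu n - z) * Cmod (inner (f n) (e k)) ^ 2)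
    (fun n => norm (f n) / Cmod (mu n - z))) hl => //.
  - move=> n k. rewrite Cmod_mult cm Cmod_R Rabs_pos_eq; last exact: pow2_ge_0. exact: Rle_refl.
  - move=> n. have h := is_series_scal_l (norm (f n) / Cmod (mu n - z)) _ _ (parseval e (f n) he).
    have e2 : scal (norm (f n) / Cmod (mu n - z)) (norm (f n) ^ 2) = norm (f n) / Cmod (mu n - z).
      rewrite /scal /= /mult /=. case: (proj1 (basis_orthonormal _ hb) n) => ->; rewrite ?norm_zero /Rdiv; ring.
    rewrite e2 in h. apply: is_series_ext h => k. by rewrite /coef inner_conj Cmod_conj.
  - move=> n.
    apply/Cis_series_iff.
    have h : is_lim_seq (sum_n (fun k => Cmod (inner (f n) (e k)) ^ 2)) (norm (f n) ^ 2).
      have hp : is_lim_seq (sum_n (fun k => Cmod (coef e (f n) k) ^ 2)) (norm (f n) ^ 2) by exact: parseval.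
      apply: is_lim_seq_ext hp => k. apply: sum_n_ext => j. by rewrite /coef inner_conj Cmod_conj.
    have h2 := is_lim_seq_minus' _ _ _ _ h (is_lim_seq_const (norm (f n) ^ 2)).
    rewrite Rminus_diag in h2. have h3 := is_lim_seq_abs _ _ h2.
    have a0 : Rbar_abs 0 = 0 by rewrite /= Rabs_R0.
    rewrite a0 in h3.
    have h4 := is_lim_seq_scal_l _ (norm (f n) / Cmod (mu n - z)) _ h3.
    have m0 : Rbar_mult (norm (f n) / Cmod (mu n - z)) 0 = 0 by rewrite /= Rmult_0_r.
    rewrite m0 in h4.
    apply: is_lim_seq_ext h4 => k. rewrite -cm -Cmod_R -Cmod_mult. congr Cmod.
    have -> : forall c : C, Csum_n (fun j => c * (Cmod (inner (f n) (e j)) ^ 2)%R)%C k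
        = (c * RtoC (sum_n (fun j => Cmod (inner (f n) (e j)) ^ 2)%R k))%C.
      move=> c. elim: k => [|k IH]; first by rewrite !sum_O.
      rewrite !sum_Sn IH /plus /= RtoC_plus. ring.
    have e0 : (RtoC (norm (f n)) / (mu n - z) * RtoC (norm (f n) ^ 2))%C = (RtoC (norm (f n)) / (mu n - z))%C.
      case: (proj1 (basis_orthonormal _ hb) n) => ->; rewrite ?norm_zero ?pow1 /Cdiv; ring.
    rewrite RtoC_minus -[X in _ = (_ - X)%C]e0. ring.
  - move=> k. apply: is_series_ext (parseval_inner f (e k) (resolvent S z (e k)) hb) => n.
    case: (classic (f n = zero)) => fn.
      rewrite fn norm_zero !inner_zero_l Cmod_0 /Cdiv. rewrite pow_ne_zero //. cring.
    rewrite (resolvent_coef S f mu z) //; last exact: hz.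
    rewrite (eb_norm S f mu) // (inner_conj _ (f n) (e k)).
    have := Cmod2_conj (inner (f n) (e k)) => e2. rewrite e2. rewrite /Cdiv. cring.
Qed.

(** * Multiplicities and the zeta function *)

Fixpoint lsum {I : Type} (a : I -> C) (l : list I) : C :=
  match l with nil => RtoC 0 | i :: l' => (a i + lsum a l')%C end.

Lemma lsum_app {I : Type} (a : I -> C) (l l' : list I) :
  lsum a (l ++ l') = (lsum a l + lsum a l')%C.
Proof. elim: l => [|i l IH] /=; [ring | rewrite IH; ring]. Qed.

Lemma lsum_ext {I : Type} (a b : I -> C) (l : list I) :
  (forall i, In i l -> a i = b i) -> lsum a l = lsum b l.
Proof.
  elim: l => [//|i l IH] h /=. rewrite h; last by left.
  rewrite IH // => j hj. apply: h. by right.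
Qed.

Lemma lsum_map {I J : Type} (phi : I -> J) (a : J -> C) (l : list I) :
  lsum a (map phi l) = lsum (fun i => a (phi i)) l.
Proof. by elim: l => [//|i l IH] /=; rewrite IH. Qed.

Lemma lsum_zero {I : Type} (a : I -> C) (l : list I) :
  (forall i, In i l -> a i = RtoC 0) -> lsum a l = RtoC 0.
Proof.
  elim: l => [//|i l IH] h /=. rewrite h; last by left. rewrite IH; first by ring.
  move=> j hj. apply: h. by right.
Qed.

Lemma lsum_plus {I : Type} (a b : I -> C) (l : list I) :
  lsum (fun i => a i + b i)%C l = (lsum a l + lsum b l)%C.
Proof. elim: l => [|i l IH] /=; [ring | rewrite IH; ring]. Qed.

Lemma lsum_scal {I : Type} (c : C) (a : I -> C) (l : list I) :
  lsum (fun i => c * a i)%C l = (c * lsum a l)%C.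
Proof. elim: l => [|i l IH] /=; [ring | rewrite IH; ring]. Qed.

Lemma lsum_exchange {I J : Type} (a : I -> J -> C) (l : list I) (m : list J) :
  lsum (fun i => lsum (a i) m) l = lsum (fun j => lsum (fun i => a i j) l) m.
Proof.
  elim: l => [|i l IH] /=; first by rewrite lsum_zero.
  by rewrite IH lsum_plus.
Qed.

Lemma lsum_perm {I : Type} (a : I -> C) (l l' : list I) : Permutation l l' -> lsum a l = lsum a l'.
Proof.
  elim=> [//|x k k' _ /= -> //|x y k /=|k1 k2 k3 _ -> _ -> //]. ring.
Qed.

Lemma lsum_single {I : Type} (a : I -> C) (l : list I) (i : I) :
  NoDup l -> In i l -> (forall j, In j l -> j <> i -> a j = RtoC 0) -> lsum a l = a i.
Proof.
  move=> nd hi h. have [l1 [l2 e]] := in_split i l hi.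
  move: nd h. rewrite e => nd h. have hn := NoDup_remove_2 _ _ _ nd.
  rewrite lsum_app /= (lsum_zero a l1) ?(lsum_zero a l2); first by ring.
  - move=> j hj. apply: h; first by apply: in_or_app; right; right.
    move=> ej. apply: hn. rewrite -ej. by apply: in_or_app; right.
  - move=> j hj. apply: h; first by apply: in_or_app; left.
    move=> ej. apply: hn. rewrite -ej. by apply: in_or_app; left.
Qed.

Lemma lsum_flat_map {I J : Type} (a : J -> C) (g : I -> list J) (l : list I) :
  lsum a (flat_map g l) = lsum (fun i => lsum a (g i)) l.
Proof. elim: l => [//|i l IH] /=. by rewrite lsum_app IH. Qed.

Lemma lsum_const {I : Type} (a : I -> C) (c : C) (l : list I) :
  (forall i, In i l -> a i = c) -> lsum a l = (RtoC (INR (length l)) * c)%C.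
Proof.
  elim: l => [|i l IH] h; first by rewrite /=; ring.
  rewrite [lsum _ _]/= h; last by left.
  rewrite IH; last by move=> j hj; apply: h; right.
  change (length (i :: l)) with (S (length l)). rewrite S_INR RtoC_plus. ring.
Qed.

(** Gaussian elimination, with M j i the coefficient of the unknown j in equation i. If equation n
    has a pivot p, it eliminates p from the others; otherwise it holds trivially and is dropped. *)
Lemma underdetermined {I : Type} (n : nat) : forall (l : list I) (M : I -> nat -> C),
  NoDup l -> (n < length l)%nat ->
  exists c : I -> C, (exists j, In j l /\ c j <> RtoC 0) /\
    forall i, (i < n)%nat -> lsum (fun j => c j * M j i)%C l = RtoC 0.
Proof.
  elim: n => [|n IH] l M nd hl.
    exists (fun _ => RtoC 1). split; last by move=> i; lia.
    case: l {nd} hl => [|j l] hl; first by rewrite /= in hl; lia.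
    exists j. split; first by left. move=> /(f_equal fst) /=. lra.
  case: (classic (exists p, In p l /\ M p n <> RtoC 0)) => [[p [hp hM]]|hno]; last first.
    have [|c [hc hs]] := IH l M nd; first by lia.
    exists c. split=> // i hi. case: (Nat.eq_dec i n) => [->|ne]; last by apply: hs; lia.
    apply: lsum_zero => j hj.
    have -> : M j n = RtoC 0 by apply: NNPP => h; apply: hno; exists j.
    ring.
  have [l1 [l2 e]] := in_split p l hp.
  have nd' : NoDup (l1 ++ l2) by apply: (NoDup_remove_1 l1 l2 p); rewrite -e.
  have hn : ~ In p (l1 ++ l2) by apply: (NoDup_remove_2 l1 l2 p); rewrite -e.
  have [|c [[j [hj cj]] hs]] := IH (l1 ++ l2) (fun j i => M j i - M j n / M p n * M p i)%C nd'.
    move: hl. rewrite e !length_app /=. lia.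
  (* The pivot unknown is recovered from equation n. *)
  pose c2 := fun j => if excluded_middle_informative (j = p)
    then (- lsum (fun j => c j * M j n)%C (l1 ++ l2) / M p n)%C else c j.
  have c2p : c2 p = (- lsum (fun j => c j * M j n)%C (l1 ++ l2) / M p n)%C.
    rewrite /c2. by case: (excluded_middle_informative _).
  have c2n : forall j, In j (l1 ++ l2) -> c2 j = c j.
    move=> k hk. rewrite /c2. case: (excluded_middle_informative _) => // ek. by rewrite ek in hk.
  exists c2. split.
    exists j. rewrite c2n //. split=> //. rewrite e. apply: in_or_app.
    by case: (in_app_or _ _ _ hj); [left | right; right].
  move=> i hi.
  have -> : lsum (fun j => c2 j * M j i)%C l = (c2 p * M p i + lsum (fun j => c j * M j i)%C (l1 ++ l2))%C.
    rewrite e lsum_app /=.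
    rewrite -(lsum_ext (fun j => c2 j * M j i)%C (fun j => c j * M j i)%C (l1 ++ l2)); last first.
      by move=> k hk; rewrite c2n.
    rewrite lsum_app. ring.
  rewrite c2p.
  case: (Nat.eq_dec i n) => [->|ne]; first by field.
  have := hs i ltac:(lia).
  rewrite (lsum_ext _ (fun j => c j * M j i + (- M p i / M p n) * (c j * M j n))%C); last first.
    move=> k _. field. done.
  rewrite lsum_plus lsum_scal => h.
  rewrite -h. field. done.
Qed.

Lemma sum_n_m_lsum (a : nat -> C) (n : nat) :
  sum_n_m (G := C_AbelianGroup) a 1 n = lsum a (List.seq 1 n).
Proof.
  elim: n => [|n IH]; first by rewrite sum_n_m_zero //; lia.
  rewrite sum_n_Sm; last lia. rewrite IH seq_S lsum_app /= /plus /=.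
  change (lsum a (List.seq 1 n) + a (S n) = lsum a (List.seq 1 n) + (a (S n) + RtoC 0))%C. ring.
Qed.

Lemma inner_sum_lsum {H : HilbertSpace} (w : H) (c : nat -> C) (b : nat -> H) (n : nat) :
  inner w (sum_n_m (fun i => scal (c i) (b i)) 1 n) = lsum (fun i => c i * inner w (b i))%C (List.seq 1 n).
Proof.
  rewrite inner_sum_r -sum_n_m_lsum. apply: sum_n_m_ext => k. by rewrite inner_scal_r.
Qed.

(** If n > m, expressing the n independent vectors through the m spanning ones gives m equations in
    n unknowns, and a nontrivial solution is a linear relation. *)
Lemma has_dim_le {H : HilbertSpace} (W : H -> Prop) (n m : nat) :
  has_dim W n -> has_dim W m -> (n <= m)%nat.
Proof.
  move=> [b [hb [ind _]]] [b' [_ [_ span]]].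
  apply/Nat.nlt_ge => lt.
  have ex : forall j, exists c : nat -> C, (1 <= j <= n)%nat ->
     b j = sum_n_m (fun i => scal (c i) (b' i)) 1 m.
    move=> j. case: (classic (1 <= j <= n)%nat) => hj; last by exists (fun _ => RtoC 0).
    have [c hc] := span _ (hb j hj). by exists c.
  have [M hM] := choice _ ex.
  (* The vectors are indexed from 1 and the equations from 0, whence [S i]. *)
  have [||c [[j [hj cj]] hs]] := underdetermined m (List.seq 1 n) (fun j i => M j (S i)).
    exact: seq_NoDup. by rewrite length_seq.
  apply: cj. apply: (ind c); last by apply in_seq in hj; lia.
  apply: inner_ext => w. rewrite inner_zero_r inner_sum_lsum.
  rewrite (lsum_ext _ (fun j => lsum (fun i => c j * (M j i * inner w (b' i)))%C (List.seq 1 m))); last first.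
    move=> k hk. rewrite lsum_scal -inner_sum_lsum -hM //. apply in_seq in hk. lia.
  rewrite lsum_exchange. apply: lsum_zero => i hi. apply in_seq in hi.
  have := hs (i - 1)%nat ltac:(lia). replace (S (i - 1)) with i by lia.
  move=> h. rewrite (lsum_ext _ (fun j => inner w (b' i) * (c j * M j i))%C); last by move=> k _; ring.
  rewrite lsum_scal h. ring.
Qed.

Lemma has_dim_unique {H : HilbertSpace} (W : H -> Prop) (n m : nat) :
  has_dim W n -> has_dim W m -> n = m.
Proof. move=> h1 h2. apply: Nat.le_antisymm; exact: (has_dim_le W). Qed.

Lemma map_nth_seq1 {I : Type} (l : list I) (d : I) :
  map (fun i => nth (i - 1) l d) (List.seq 1 (length l)) = l.
Proof.
  rewrite -seq_shift map_map.
  rewrite (map_ext _ (fun i => nth i l d)); last by move=> i; congr nth; lia.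
  elim: l => [//|x l IH] /=. congr cons. by rewrite -seq_shift map_map.
Qed.

Lemma finite_level {H : HilbertSpace} (S : operator H) f mu z0 (z : C) :
  is_eigenbasis S f mu -> resolvent_summable f mu z0 ->
  exists l : list nat, NoDup l /\ forall n, In n l <-> f n <> zero /\ RtoC (mu n) = z.
Proof.
  move=> hf hs.
  have [N hN] := eigenvalues_escape S f mu z0 (Cmod (z - z0) + 1) hf hs.
  exists (filter (fun n => if excluded_middle_informative (f n <> zero /\ RtoC (mu n) = z) then true else false) (List.seq 0 N)).
  split; first by apply: NoDup_filter; exact: seq_NoDup.
  move=> n. rewrite filter_In in_seq.
  case: (excluded_middle_informative _) => h; last by split => // -[].
  split=> // _. split=> //. split; first lia.
  apply/Nat.nle_gt => hn. have [h1 h2] := h.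
  have := hN n hn h1. rewrite h2. lra.
Qed.

(** A vector x of the eigenspace has no component along an f n with mu n different from z, since (mu
    n - z) <f n, x> = 0; so the f n with n in l span. *)
Lemma eigenspace_dim {H : HilbertSpace} (S : operator H) f mu (z : C) (l : list nat) :
  self_adjoint S -> is_eigenbasis S f mu -> NoDup l ->
  (forall n, In n l <-> f n <> zero /\ RtoC (mu n) = z) ->
  has_dim (eigenspace S z) (length l).
Proof.
  move=> sa hf nd hl.
  have ho := basis_orthonormal _ (eb_basis _ _ _ hf).
  have f1 : forall n, In n l -> inner (f n) (f n) = RtoC 1.
    move=> n /hl [h _]. by rewrite inner_norm (eb_norm S f mu) // pow1.
  pose phi := fun i => nth (i - 1) l 0%nat.
  have hphi : forall i, (1 <= i <= length l)%nat -> In (phi i) l by move=> i hi; apply: nth_In; lia.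
  exists (fun i => f (phi i)). split; last split.
  - move=> i /hphi /hl [_ h]. split; first exact: (eb_dom _ _ _ hf).
    by rewrite (eb_eig _ _ _ hf) h.
  - move=> c h0 i hi.
    have : inner (f (phi i)) (sum_n_m (fun i => scal (c i) (f (phi i))) 1 (length l)) = RtoC 0 by rewrite h0 inner_zero_r.
    rewrite inner_sum_lsum (lsum_single _ _ i).
    + rewrite f1; last exact: hphi. by rewrite Cmult_1_r.
    + exact: seq_NoDup.
    + apply in_seq. lia.
    + move=> j hj ne. apply in_seq in hj. rewrite (proj2 ho); first by ring.
      move=> e. apply: ne. rewrite /phi in e.
      have := proj1 (NoDup_nth l 0%nat) nd (i - 1)%nat (j - 1)%nat ltac:(lia) ltac:(lia) e. lia.
  - move=> x [dx hx]. exists (fun i => inner (f (phi i)) x).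
    apply: (basis_ext f); first exact: (eb_basis _ _ _ hf).
    move=> n. rewrite inner_sum_lsum.
    have -> : lsum (fun i => inner (f (phi i)) x * inner (f n) (f (phi i)))%C (List.seq 1 (length l))
       = lsum (fun k => inner (f k) x * inner (f n) (f k))%C l.
      by rewrite -{2}(map_nth_seq1 l 0%nat) lsum_map.
    case: (classic (In n l)) => hn.
      rewrite (lsum_single _ _ n) //; first by rewrite f1 // Cmult_1_r.
      move=> j _ ne. rewrite (proj2 ho); first by ring. by apply: not_eq_sym.
    rewrite lsum_zero; last first.
      move=> j hj. rewrite (proj2 ho); first by ring. by move=> e; rewrite e in hn.
    case: (classic (f n = zero)) => fn; first by rewrite fn inner_zero_l.
    have ne : RtoC (mu n) <> z by move=> e; apply: hn; apply/hl.
    have := sa_symmetric S (f n) x sa (eb_dom _ _ _ hf n) dx.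
    rewrite (eb_eig _ _ _ hf) hx inner_scal_l inner_scal_r.
    have -> : Cconj (RtoC (mu n)) = RtoC (mu n) by apply: C_eq => /=; lra.
    move=> e. have d := Cminus_neq0 _ _ ne.
    replace (inner (f n) x) with (/ (mu n - z) * (mu n * inner (f n) x - z * inner (f n) x))%C by (field; done).
    rewrite e. ring.
Qed.

Lemma multiplicity_eq {H : HilbertSpace} (S : operator H) (z : C) (n : nat) :
  has_dim (eigenspace S z) n -> multiplicity S z = n.
Proof.
  move=> h. apply: (has_dim_unique (eigenspace S z)) => //.
  apply: epsilon_spec. by exists n.
Qed.

(** * Absolutely convergent sums over the integers *)

Fixpoint rsum {I : Type} (a : I -> R) (l : list I) : R :=
  match l with nil => 0 | i :: l' => a i + rsum a l' end.

Lemma rsum_app {I : Type} (a : I -> R) (l l' : list I) : rsum a (l ++ l') = rsum a l + rsum a l'.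
Proof. elim: l => [|i l IH] /=; [ring | rewrite IH; ring]. Qed.

Lemma Cmod_lsum_filter {I : Type} (a : I -> C) (w : I -> R) (p : I -> bool) (l : list I) :
  (forall i, 0 <= w i) -> (forall i, p i = true -> Cmod (a i) <= w i) ->
  Cmod (lsum a (filter p l)) <= rsum w l.
Proof.
  move=> h0 h. elim: l => [|i l IH] /=; first by rewrite Cmod_0; lra.
  case e : (p i) => /=; last by have := h0 i; lra.
  apply: Rle_trans; first exact: Cmod_triangle. have := h i e. lra.
Qed.

Lemma rsum_map_seq {I : Type} (w : I -> R) (phi : nat -> I) (M : nat) :
  rsum w (map phi (List.seq 0 (S M))) = sum_n (fun n => w (phi n)) M.
Proof.
  elim: M => [|M IH]; first by rewrite sum_O /=; ring.
  rewrite seq_S map_app rsum_app IH sum_Sn /plus /=. ring.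
Qed.

Lemma lsum_map_seq {I : Type} (a : I -> C) (phi : nat -> I) (M : nat) :
  lsum a (map phi (List.seq 0 (S M))) = Csum_n (fun n => a (phi n)) M.
Proof.
  elim: M => [|M IH]; first by rewrite sum_O /=; ring.
  rewrite seq_S map_app lsum_app IH sum_Sn /plus /=. ring.
Qed.

(** An absolutely convergent sum is a limit over all finite index sets, not just over initial
    segments. Only the nonzero terms of the core [l0] have to be covered, since the index sets used
    for the zeta function omit the eigenvalue 0. *)
Lemma Zsum_finite_approx (a : Z -> C) (L : C) (eps : R) : is_Zsum a L -> 0 < eps ->
  exists l0 : list Z, forall l, NoDup l -> (forall j, In j l0 -> a j <> RtoC 0 -> In j l) ->
    Cmod (lsum a l - L) < eps.
Proof.
  move=> [ex1 [ex2 [l1 [l2 [h1 [h2 ->]]]]]] he.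
  pose ng := fun n : nat => (- Z.of_nat n - 1)%Z.
  have [N1 hN1] := Series_tail_small _ (eps / 4) ex1 ltac:(lra).
  have [N2 hN2] := Series_tail_small _ (eps / 4) ex2 ltac:(lra).
  pose l0 := map Z.of_nat (List.seq 0 (S N1)) ++ map ng (List.seq 0 (S N2)).
  exists l0 => l nd hl.
  (* A symmetric range of integers that, for large M, contains l and has both partial sums close to
     their limits; what it has beyond l has no nonzero term in the core and contributes little. *)
  pose rng := fun M => map Z.of_nat (List.seq 0 (S M)) ++ map ng (List.seq 0 (S M)).
  have inrng : forall j M, (Z.abs_nat j <= M)%nat -> In j (rng M).
    move=> j M hj. apply: in_or_app. case: (Z_lt_le_dec j 0) => hj0.
      right. apply in_map_iff. exists (Z.to_nat (- j - 1)). split; first by rewrite /ng; lia.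
      apply in_seq. lia.
    left. apply in_map_iff. exists (Z.to_nat j). split; first lia. apply in_seq. lia.
  have ndr : forall M, NoDup (rng M).
    move=> M. apply: NoDup_app.
    - apply: FinFun.Injective_map_NoDup; last exact: seq_NoDup. move=> x y; lia.
    - apply: FinFun.Injective_map_NoDup; last exact: seq_NoDup. move=> x y; rewrite /ng; lia.
    - move=> x /in_map_iff [n [<- _]] /in_map_iff [m [hm _]]. rewrite /ng in hm. lia.
  have [M0 hM0] : exists M0, forall j, In j l -> (Z.abs_nat j <= M0)%nat.
    elim: (l) => [|j k [M0 IH]]; first by exists 0%nat.
    exists (Nat.max M0 (Z.abs_nat j)) => i [<-|hi]; first lia. have := IH i hi. lia.
  have hlim := is_lim_seq_plus' _ _ _ _ (proj1 (Cis_series_iff _ _) h1) (proj1 (Cis_series_iff _ _) h2).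
  rewrite Rplus_0_r in hlim.
  have [M1 hM1] := proj2 (is_lim_seq_spec _ _) hlim (mkposreal (eps / 4) ltac:(lra)).
  pose M := Nat.max M0 M1.
  have := hM1 M ltac:(rewrite /M; lia). rewrite [pos _]/= Rminus_0_r.
  set P := Csum_n (fun n => a (Z.of_nat n)) M.
  set Q := Csum_n (fun n => a (- Z.of_nat n - 1)%Z) M.
  rewrite Rabs_pos_eq; last by apply: Rplus_le_le_0_compat; exact: Cmod_ge_0.
  move=> hPQ.
  pose inl := fun j : Z => if in_dec Z.eq_dec j l then false else true.
  have perm : Permutation (rng M) (l ++ filter inl (rng M)).
    apply: NoDup_Permutation => //.
      apply: NoDup_app => //; first by apply: NoDup_filter.
      move=> x hx /filter_In [_]. rewrite /inl. by case: in_dec.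
    move=> x. rewrite in_app_iff filter_In /inl. case: in_dec => hx.
      split=> [|_]; first by left. apply: inrng. have := hM0 x hx. rewrite /M. lia.
    split=> [|[|[]]] //. by right.
  have e1 : lsum a (rng M) = (lsum a l + lsum a (filter inl (rng M)))%C.
    by rewrite (lsum_perm a _ _ perm) lsum_app.
  have e2 : lsum a (rng M) = (P + Q)%C by rewrite /rng lsum_app !lsum_map_seq.
  (* A majorant of the leftover terms that vanishes on the core, so that its sums over each half of
     the integers are bounded by tails of convergent series. *)
  pose w := fun j : Z => if in_dec Z.eq_dec j l0 then 0 else Cmod (a j).
  have w0 : forall j, 0 <= w j by move=> j; rewrite /w; case: in_dec => _; [lra | exact: Cmod_ge_0].
  have hb : Cmod (lsum a (filter inl (rng M))) <= rsum w (rng M).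
    apply: Cmod_lsum_filter => // j. rewrite /inl /w. case: in_dec => // hj _.
    case: in_dec => hj0; last lra.
    have -> : a j = RtoC 0 by apply: NNPP => h; apply: hj; exact: hl.
    rewrite Cmod_0. lra.
  have tail : forall (phi : nat -> Z) N, ex_series (fun n => Cmod (a (phi n))) ->
     (forall n, (n <= N)%nat -> In (phi n) l0) ->
     Series (fun k => Cmod (a (phi (S N + k)%nat))) < eps / 4 ->
     sum_n (fun n => w (phi n)) M < eps / 4.
    move=> phi N ex hin hlt.
    have le : forall n, 0 <= w (phi n) <= Cmod (a (phi n)).
      move=> n. split=> //. rewrite /w. case: in_dec => _; [exact: Cmod_ge_0 | lra].
    have exw : ex_series (fun n => w (phi n)) by exact: ex_series_le_nonneg le ex.
    apply: Rle_lt_trans; first exact: (sum_n_le_Series (fun n => w (phi n)) M).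
    rewrite (Series_incr_n _ (S N)) //; last lia.
    rewrite -sum_n_Reals.
    have -> : sum_n (fun n => w (phi n)) (Init.Nat.pred (S N)) = 0.
      rewrite /sum_n (sum_n_m_ext_loc _ (fun _ => (zero : R_AbelianGroup))).
        exact: (sum_n_m_const_zero (G := R_AbelianGroup)).
      move=> k hk. rewrite /w. case: in_dec => // h. case: h. apply: hin. rewrite /= in hk. lia.
    rewrite Rplus_0_l. apply: Rle_lt_trans hlt.
    apply: Series_le => //.
    by apply/(ex_series_incr_n (fun n => Cmod (a (phi n))) (S N)).
  have t1 := tail Z.of_nat N1 ex1 _ hN1. have t2 := tail ng N2 ex2 _ hN2.
  have : rsum w (rng M) < eps / 4 + eps / 4.
    rewrite /rng rsum_app !rsum_map_seq. apply: Rplus_lt_compat.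
      apply: t1 => n hn. apply: in_or_app. left. apply: in_map. apply in_seq. lia.
    apply: t2 => n hn. apply: in_or_app. right. apply: in_map. apply in_seq. lia.
  move=> hr.
  have -> : (lsum a l - (l1 + l2))%C = ((P - l1) + (Q - l2) + - lsum a (filter inl (rng M)))%C.
    have -> : lsum a l = (P + Q - lsum a (filter inl (rng M)))%C by rewrite -e2 e1; ring.
    ring.
  apply: Rle_lt_trans; first exact: Cmod_triangle.
  rewrite Cmod_opp. have := Cmod_triangle (P - l1) (Q - l2).
  move: hPQ. rewrite -/P -/Q. move=> hPQ.
  have : Cmod (P - l1) + Cmod (Q - l2) < eps / 4 by exact: hPQ.
  lra.
Qed.

(* Two enumerations of the spectrum are compared along finite sets V of values: the indices with value in V
   contribute the same to both sums, since both count multiplicities. *)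
Lemma zeta_unique (theta : R) {H : HilbertSpace} (S : operator H) (s l l' : C) :
  is_zeta theta S s l -> is_zeta theta S s l' -> l = l'.
Proof.
  move=> [J [lam [he hs]]] [J' [lam' [he' hs']]].
  suff h : forall eps, 0 < eps -> Cmod (l - l') < 2 * eps.
    replace l with (l - l' + l')%C by ring.
    have -> : (l - l')%C = RtoC 0.
      apply: Cmod_eq_0. have := Cmod_ge_0 (l - l') => h0.
      apply: Rle_antisym => //. apply: Rnot_lt_le => hlt. have := h (Cmod (l - l') / 2) ltac:(lra). lra.
    ring.
  move=> eps hp.
  move: hs hs'. set t := fun j => _. set t' := fun j => _. move=> hs hs'.
  have [l0 hl0] := Zsum_finite_approx t l eps hs hp.
  have [l0' hl0'] := Zsum_finite_approx t' l' eps hs' hp.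
  have lists : forall z : C, exists ll : list Z * list Z,
     NoDup (fst ll) /\ NoDup (snd ll) /\ length (fst ll) = length (snd ll) /\
     (forall j, In j (fst ll) <-> J j /\ lam j = z) /\ (forall j, In j (snd ll) <-> J' j /\ lam' j = z).
    move=> z. have [n [d1 [k [k1 [k2 k3]]]]] := proj2 he z. have [n' [d1' [k' [k1' [k2' k3']]]]] := proj2 he' z.
    exists (k, k'). do 3 (split=> //=). by rewrite k2 k2' (has_dim_unique _ _ _ d1 d1').
  have [ll hll] := choice _ lists.
  pose nz := fun (P : Z -> Prop) (v : Z -> C) (j : Z) =>
    if excluded_middle_informative (P j /\ v j <> RtoC 0) then true else false.
  (* All nonzero values met by either core, so that the indices with value in V cover both cores up
     to vanishing terms. *)
  pose V := nodup (fun x y : C => excluded_middle_informative (x = y))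
    (map lam (filter (nz J lam) l0) ++ map lam' (filter (nz J' lam') l0')).
  have V0 : forall z, In z V -> z <> RtoC 0.
    have aux : forall (P : Z -> Prop) v k z, In z (map v (filter (nz P v) k)) -> z <> RtoC 0.
      move=> P v k z /in_map_iff [j [<- /filter_In [_]]]. rewrite /nz.
      by case: excluded_middle_informative => // -[].
    move=> z hz. rewrite /V nodup_In in hz. by case: (in_app_or _ _ _ hz); exact: aux.
  have ndV : NoDup V by exact: NoDup_nodup.
  have ndf : forall (g : C -> list Z) (v : Z -> C), (forall z, NoDup (g z)) ->
      (forall z j, In j (g z) -> v j = z) -> forall U, NoDup U -> NoDup (flat_map g U).
    move=> g v h1 h2. elim=> [|z U IH] nd /=; first by constructor.
    apply NoDup_cons_iff in nd. case: nd => nd1 nd2.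
    apply: NoDup_app => //; first exact: IH.
    move=> j hj /in_flat_map [z' [hz' hj']]. apply: nd1.
    by rewrite -(h2 z j hj) (h2 z' j hj').
  have E : lsum t (flat_map (fun z => fst (ll z)) V) = lsum t' (flat_map (fun z => snd (ll z)) V).
    rewrite !lsum_flat_map. apply: lsum_ext => z hz.
    have [_ [_ [hlen [h1 h2]]]] := hll z. have nz0 := V0 z hz.
    rewrite (lsum_const t (cpow theta z (- s))) ?(lsum_const t' (cpow theta z (- s))) ?hlen //.
    - move=> j /h2 [hj e]. rewrite /t' e. by case: excluded_middle_informative => // -[].
    - move=> j /h1 [hj e]. rewrite /t e. by case: excluded_middle_informative => // -[].
  have A1 : Cmod (lsum t (flat_map (fun z => fst (ll z)) V) - l) < eps.
    apply: hl0.
      apply: (ndf _ lam) => // z; first by apply hll. move=> j. have [_ [_ [_ [h _]]]] := hll z. by move=> /h [].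
    move=> j hj tj. apply in_flat_map.
    have hJ : J j /\ lam j <> RtoC 0.
      apply: NNPP => h. apply: tj. rewrite /t. by case: excluded_middle_informative.
    exists (lam j). split; last by apply hll; split=> //; exact (proj1 hJ).
    apply nodup_In. apply: in_or_app. left. apply: in_map. apply filter_In. split=> //.
    rewrite /nz. by case: excluded_middle_informative.
  have A2 : Cmod (lsum t' (flat_map (fun z => snd (ll z)) V) - l') < eps.
    apply: hl0'.
      apply: (ndf _ lam') => // z; first by apply hll. move=> j. have [_ [_ [_ [_ h]]]] := hll z. by move=> /h [].
    move=> j hj tj. apply in_flat_map.
    have hJ : J' j /\ lam' j <> RtoC 0.
      apply: NNPP => h. apply: tj. rewrite /t'. by case: excluded_middle_informative.
    exists (lam' j). split; last by apply hll; split=> //; exact (proj1 hJ).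
    apply nodup_In. apply: in_or_app. right. apply: in_map. apply filter_In. split=> //.
    rewrite /nz. by case: excluded_middle_informative.
  move: A1 A2. rewrite E. set m := lsum t' _. move=> A1 A2.
  replace (l - l')%C with (- (m - l) + (m - l'))%C by ring.
  apply: Rle_lt_trans; first exact: Cmod_triangle. rewrite Cmod_opp. lra.
Qed.

(** The nonnegative integers enumerate the nonzero f n, and negative indices lie outside J and add
    0. The terms t are a parameter so that multiples of the contour integrals can be inserted
    directly. *)
Lemma eigenbasis_zeta (theta : R) {H : HilbertSpace} (S : operator H) f mu z0 (s l : C) (t : nat -> C) :
  self_adjoint S -> is_eigenbasis S f mu -> resolvent_summable f mu z0 ->
  (forall n, f n <> zero -> mu n <> 0 -> t n = cpow theta (RtoC (mu n)) (- s)%C) ->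
  (forall n, f n = zero \/ mu n = 0 -> t n = RtoC 0) ->
  ex_series (fun n => Cmod (t n)) -> Cis_series t l ->
  is_zeta theta S s l.
Proof.
  move=> sa hf hs ht1 ht2 ex hl.
  pose J := fun j : Z => exists n, j = Z.of_nat n /\ f n <> zero.
  pose lam := fun j : Z => RtoC (mu (Z.to_nat j)).
  have hJ : forall n, J (Z.of_nat n) <-> f n <> zero.
    move=> n. split; last by exists n. move=> [m [e h]]. by have -> : n = m by lia.
  have hn : forall n, J (- Z.of_nat n - 1)%Z -> False by move=> n [m [e _]]; lia.
  exists J, lam. split.
    split.
      move=> z. rewrite (eigenbasis_spectrum S f mu z0) //. split.
        move=> [n [fn e]]. exists (Z.of_nat n). rewrite hJ /lam Nat2Z.id. by split.
      move=> [j [[n [-> fn]] e]]. exists n. split=> //. by rewrite -e /lam Nat2Z.id.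
    move=> z. have [k [nd hk]] := finite_level S f mu z0 z hf hs.
    exists (length k). split; first exact: (eigenspace_dim S f mu).
    exists (map Z.of_nat k). split.
      apply: FinFun.Injective_map_NoDup => //. move=> x y; lia.
    split; first exact: length_map.
    move=> j. rewrite in_map_iff. split.
      move=> [n [<- /hk [h1 h2]]]. by rewrite hJ /lam Nat2Z.id.
    move=> [[n [-> fn]] e]. exists n. split=> //. apply/hk. split=> //. by rewrite -e /lam Nat2Z.id.
  have e1 : forall n, t n = (if excluded_middle_informative (J (Z.of_nat n) /\ lam (Z.of_nat n) <> RtoC 0)
      then cpow theta (lam (Z.of_nat n)) (- s) else RtoC 0).
    move=> n. case: excluded_middle_informative.
      move=> [/hJ fn hne]. rewrite /lam Nat2Z.id. apply: ht1 => // e. apply: hne. by rewrite /lam Nat2Z.id e.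
    move=> h. apply: ht2. case: (classic (f n = zero)) => fn; first by left. right.
    apply: NNPP => hm. apply: h. rewrite hJ /lam Nat2Z.id. split=> // /(f_equal fst) /=. done.
  have e2 : forall n, RtoC 0 = (if excluded_middle_informative (J (- Z.of_nat n - 1)%Z /\ lam (- Z.of_nat n - 1)%Z <> RtoC 0)
      then cpow theta (lam (- Z.of_nat n - 1)%Z) (- s) else RtoC 0).
    move=> n. case: excluded_middle_informative => // -[h _]. by case: (hn n h).
  have z1 : Cis_series (fun _ => RtoC 0) (RtoC 0).
    apply/Cis_series_iff. apply: (is_lim_seq_ext (fun _ => 0)); last exact: is_lim_seq_const.
    move=> n. have -> : Csum_n (fun _ => RtoC 0) n = RtoC 0.
      exact: (sum_n_m_const_zero (G := C_AbelianGroup)).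
    have -> : (RtoC 0 - RtoC 0)%C = RtoC 0 by ring. by rewrite Cmod_0.
  split; first by apply: ex_series_ext ex => n; rewrite -e1.
  split.
    apply: (ex_series_ext (fun _ => 0)); first by move=> n; rewrite -e2 Cmod_0.
    exists 0. apply: (filterlim_ext (fun _ => 0)); last exact: filterlim_const.
    move=> n. symmetry. exact: (sum_n_m_const_zero (G := R_AbelianGroup)).
  exists l, (RtoC 0). split; first exact: is_series_ext e1 hl.
  split; first exact: is_series_ext e2 z1. ring.
Qed.

Lemma zeta_eq (theta : R) {H : HilbertSpace} (S : operator H) (s l : C) :
  is_zeta theta S s l -> zeta theta S s = l.
Proof.
  move=> h. apply: (iota_unique (V := C_R_CompleteNormedModule)) => // y hy.
  exact: zeta_unique hy h.
Qed.

(** * Curves and complex derivatives *)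

(** Connectedness of the line, by a supremum argument. It carries the integral formula across
    breakpoints, bounds from neighbourhoods to intervals, and logarithmic integrals along a path of
    poles. *)
Lemma local_to_global (E : R -> R -> Prop) :
  (forall x y, E x y -> E y x) -> (forall x y z, E x y -> E y z -> E x z) ->
  (forall x, exists d, 0 < d /\ forall y, Rabs (y - x) < d -> E x y) ->
  forall x y, E x y.
Proof.
  move=> sym tr loc.
  have refl : forall x, E x x.
    move=> x. have [d [dp h]] := loc x. apply: h. by rewrite Rminus_diag Rabs_R0.
  have fw : forall x y, x <= y -> E x y.
    move=> x y hxy.
    pose P := fun u => x <= u <= y /\ E x u.
    have [m [ub lub]] : { m | is_lub P m }.
      apply: completeness; first by exists y => u [[_ ?] _].
      exists x. split; [lra | exact: refl].
    have hm : x <= m <= y.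
      split; first by apply: ub; split; [lra | exact: refl].
      by apply: lub => u [[_ ?] _].
    have [d [dp hd]] := loc m.
    have [u [[hu Eu] mu]] : exists u, P u /\ m - d < u.
      apply: NNPP => h. have : m <= m - d; last lra.
      apply: lub => u hu. apply: Rnot_lt_le => hlt. apply: h. by exists u.
    have um : u <= m by apply: ub.
    have Em : E x m.
      apply: (tr _ u) => //. apply: sym. apply: hd. apply: Rabs_def1; lra.
    case: (Req_dec m y) => [<- //|ne].
    pose v := Rmin y (m + d / 2).
    have hv : m < v <= y /\ v < m + d.
      rewrite /v. split; first split; [apply: Rmin_glb_lt; lra | exact: Rmin_l |].
      have := Rmin_r y (m + d / 2). lra.
    have : v <= m; last lra.
    apply: ub. split; first lra. apply: (tr _ m) => //. apply: hd. apply: Rabs_def1; lra.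
  move=> x y. case: (Rle_dec x y) => h; first exact: fw. apply: sym. apply: fw. lra.
Qed.

(** * Regulated functions and the fundamental theorem of calculus *)

Definition haslim (f : R -> R) (F : (R -> Prop) -> Prop) : Prop :=
  exists d : R, filterlim f F (locally d).

(** Piecewise continuity stated point by point: unlike a finite list of breakpoints it is local and
    passes directly to sums and products. *)
Definition regulated (f : R -> R) : Prop :=
  forall t, locally' t (continuous f) /\ haslim f (at_left t) /\ haslim f (at_right t).

Lemma haslim_plus (f g : R -> R) (F : (R -> Prop) -> Prop) {FF : Filter F} :
  haslim f F -> haslim g F -> haslim (fun t => f t + g t) F.
Proof.
  move=> [a ha] [b hb]. exists (a + b).
  exact: (filterlim_comp_2 (G := locally a) (H := locally b) f g (fun x y => x + y) ha hb (filterlim_plus (V := R_NormedModule) a b)).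
Qed.

Lemma haslim_mult (f g : R -> R) (F : (R -> Prop) -> Prop) {FF : Filter F} :
  haslim f F -> haslim g F -> haslim (fun t => f t * g t) F.
Proof.
  move=> [a ha] [b hb]. exists (a * b).
  exact: (filterlim_comp_2 (G := locally a) (H := locally b) f g (fun x y => x * y) ha hb (filterlim_mult (K := R_AbsRing) a b)).
Qed.

Lemma regulated_plus (f g : R -> R) : regulated f -> regulated g -> regulated (fun t => f t + g t).
Proof.
  move=> hf hg t. have [f1 [f2 f3]] := hf t. have [g1 [g2 g3]] := hg t.
  split; last by split; exact: haslim_plus.
  apply: filter_imp (filter_and _ _ f1 g1) => u [h1 h2].
  exact: (continuous_plus (V := R_NormedModule)).
Qed.

Lemma regulated_mult (f g : R -> R) : regulated f -> regulated g -> regulated (fun t => f t * g t).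
Proof.
  move=> hf hg t. have [f1 [f2 f3]] := hf t. have [g1 [g2 g3]] := hg t.
  split; last by split; exact: haslim_mult.
  apply: filter_imp (filter_and _ _ f1 g1) => u [h1 h2].
  exact: (continuous_mult (K := R_AbsRing)).
Qed.

Lemma regulated_continuous (f : R -> R) : (forall t, continuous f t) -> regulated f.
Proof.
  move=> h t. split; first by apply: filter_forall.
  split; exists (f t).
  - apply: filterlim_filter_le_1 (h t). exact: filter_le_within.
  - apply: filterlim_filter_le_1 (h t). exact: filter_le_within.
Qed.

Lemma locally'_not_in (l : list R) (t : R) : locally' t (fun u => ~ In u l).
Proof.
  elim: l => [|x l IH]; first by apply: filter_forall => u [].
  have hx : locally' t (fun u => u <> x).
    case: (Req_dec x t) => [->|ne].
      exists (mkposreal 1 Rlt_0_1) => u _ //.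
    have hp : 0 < Rabs (t - x) by apply: Rabs_pos_lt; lra.
    exists (mkposreal _ hp) => u. rewrite /ball /= /AbsRing_ball /= /abs /minus /plus /opp /= => hu _ e.
    rewrite e in hu. rewrite -Rabs_Ropp in hu.
    replace (- (x + - t)) with (t - x) in hu by ring. lra.
  apply: filter_imp (filter_and _ _ hx IH) => u [h1 h2] [h|h]; [exact: h1 | exact: h2].
Qed.

Lemma piecewise_regulated (g : R -> R) : piecewise_C1 g ->
  regulated (Derive g) /\ forall t, locally' t (fun u => ex_derive g u).
Proof.
  move=> [l [h1 h2]]. split; last first.
    move=> t. apply: filter_imp (locally'_not_in l t) => u hu. exact: (proj1 (h1 u hu)).
  move=> t. split.
    apply: filter_imp (locally'_not_in l t) => u hu. exact: (proj2 (h1 u hu)).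
  case: (classic (In t l)) => ht; first exact: h2.
  have hc := proj2 (h1 t ht).
  split; exists (Derive g t); apply: filterlim_filter_le_1 hc; exact: filter_le_within.
Qed.

Lemma MVT_const (F : R -> R) (a b : R) : a < b ->
  (forall x, a < x < b -> is_derive F x 0) -> (forall x, a <= x <= b -> continuous F x) -> F b = F a.
Proof.
  move=> ab hd hc.
  have [||c [_ e]] := MVT_gen F a b (fun _ => 0).
  - move=> x. rewrite Rmin_left ?Rmax_right; try lra. exact: hd.
  - move=> x. rewrite Rmin_left ?Rmax_right; try lra. move=> hx.
    apply/continuity_pt_filterlim. exact: hc.
  lra.
Qed.

(** The one-sided limits extend f continuously past the end points; F minus the integral of the
    extension has derivative 0 inside, so it is constant. *)
Lemma FTC_interval (F f : R -> R) (a b : R) : a < b ->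
  (forall x, continuous F x) ->
  (forall x, a < x < b -> is_derive F x (f x) /\ continuous f x) ->
  haslim f (at_right a) -> haslim f (at_left b) ->
  is_RInt f a b (F b - F a).
Proof.
  move=> ab hF hf [la ha] [lb hb].
  have [g [g1 [g2 [g3 g4]]]] := C0_extension_lt f la lb a b ab (fun c hc => proj2 (hf c hc)) ha hb.
  have ig : forall x y, ex_RInt g x y.
    move=> x y. apply: (ex_RInt_continuous (V := R_CompleteNormedModule)) => z _. exact: g1.
  pose G := fun x => RInt g a x.
  have dG : forall x, is_derive G x (g x).
    move=> x. apply: (is_derive_RInt g G a x); last exact: g1.
    apply: filter_forall => y. exact: (RInt_correct (V := R_CompleteNormedModule)).
  have e : F b - G b = F a - G a.
    apply: (MVT_const (fun x => F x - G x)) => // x hx.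
    - have := is_derive_minus _ _ _ _ _ (proj1 (hf x hx)) (dG x).
      rewrite g2 // /minus /plus /opp /= Rplus_opp_r. done.
    - apply: (continuous_minus (V := R_NormedModule)) => //.
      apply: ex_derive_continuous. by exists (g x).
  have -> : F b - F a = G b.
    have : G a = 0 by exact: RInt_point. lra.
  apply: (is_RInt_ext g).
    move=> x. rewrite Rmin_left ?Rmax_right; try lra. exact: g2.
  exact: (RInt_correct (V := R_CompleteNormedModule)).
Qed.

(** The formula is additive in the interval, and on either side of a point x the integrand is
    continuous up to limits at the ends, so [FTC_interval] applies near x. *)
Lemma FTC_regulated (F f : R -> R) :
  (forall x, continuous F x) -> regulated f ->
  (forall t, locally' t (fun u => is_derive F u (f u))) ->
  forall a b, is_RInt f a b (F b - F a).
Proof.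
  move=> hF hf hd.
  have tel : forall u v w : R, w - u = (v - u) + (w - v) by move=> *; ring.
  apply: (local_to_global (fun a b => is_RInt f a b (F b - F a))).
  - move=> x y h. rewrite -(Ropp_minus_distr (F y) (F x)).
    exact: (is_RInt_swap (V := R_NormedModule)).
  - move=> x y z h1 h2.
    rewrite (tel (F x) (F y) (F z)).
    exact: (is_RInt_Chasles (V := R_NormedModule) f x y z).
  - move=> x. have [hl [_ _]] := hf x.
    have [d hloc] := filter_and _ _ hl (hd x).
    exists d. split; first exact: cond_pos.
    have pt : forall u, Rabs (u - x) < d -> u <> x -> is_derive F u (f u) /\ continuous f u.
      move=> u hu ne. by have [h1 h2] := hloc u hu ne.
    move=> y hy. have [h1 h2] := Rabs_def2 _ _ hy.
    case: (Rtotal_order x y) => [lt|[->|gt]].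
    + apply: FTC_interval => //; try by apply (hf _).
      move=> u hu. apply: pt; last lra. apply: Rabs_def1; lra.
    + rewrite Rminus_diag. exact: is_RInt_point.
    + rewrite -(Ropp_minus_distr (F x) (F y)).
      apply: (is_RInt_swap (V := R_NormedModule)).
      apply: FTC_interval => //; try by apply (hf _).
      move=> u hu. apply: pt; last lra. apply: Rabs_def1; lra.
Qed.

Lemma regulated_bounded (f : R -> R) : regulated f ->
  forall a b, exists M, forall t, a <= t <= b -> Rabs (f t) <= M.
Proof.
  move=> hf.
  suff h : forall a b, exists M, forall t, Rmin a b <= t <= Rmax a b -> Rabs (f t) <= M.
    move=> a b. have [M hM] := h a b. exists M => t ht. apply: hM.
    rewrite Rmin_left ?Rmax_right; lra.
  apply: local_to_global.
  - move=> x y [M hM]. exists M. by rewrite Rmin_comm Rmax_comm.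
  - move=> x y z [M hM] [M' hM']. exists (Rmax M M') => t ht.
    have [h|h] : Rmin x y <= t <= Rmax x y \/ Rmin y z <= t <= Rmax y z.
      move: ht. rewrite /Rmin /Rmax. repeat case: Rle_dec; lra.
    + apply: Rle_trans; [exact: hM | exact: Rmax_l].
    + apply: Rle_trans; [exact: hM' | exact: Rmax_r].
  - move=> x. have [_ [[l hl] [r hr]]] := hf x.
    have b1 : forall v : R, locally v (fun y => Rabs y <= Rabs v + 1).
      move=> v. exists (mkposreal 1 Rlt_0_1) => y.
      rewrite /ball /= /AbsRing_ball /= /abs /minus /plus /opp /= => h.
      have := Rabs_triang (y + - v) v. rewrite Rplus_assoc Rplus_opp_l Rplus_0_r. lra.
    have [d1 h1] := hl _ (b1 l). have [d2 h2] := hr _ (b1 r).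
    exists (Rmin d1 d2). split; first by apply: Rmin_pos; exact: cond_pos.
    move=> y hy. exists (Rmax (Rabs (f x)) (Rmax (Rabs l + 1) (Rabs r + 1))) => t ht.
    have ht2 : Rabs (t - x) < Rmin d1 d2.
      apply: Rle_lt_trans hy. move: ht. rewrite /Rmin /Rmax /Rabs.
      repeat case: Rle_dec; repeat case: Rcase_abs; lra.
    case: (Rtotal_order t x) => [lt|[->|gt]]; last first.
    + apply: Rle_trans; last exact: Rmax_r. apply: Rle_trans; last exact: Rmax_r.
      apply: h2 => //. apply: Rlt_le_trans ht2 _. exact: Rmin_r.
    + exact: Rmax_l.
    + apply: Rle_trans; last exact: Rmax_r. apply: Rle_trans; last exact: Rmax_l.
      apply: h1 => //. apply: Rlt_le_trans ht2 _. exact: Rmin_l.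
Qed.

(** * Derivatives of curves and of functions of a complex variable *)

Definition rderiv (g : R -> C) (t : R) (l : C) : Prop :=
  forall eps, 0 < eps -> exists d, 0 < d /\ forall u, Rabs (u - t) < d ->
    Cmod (g u - g t - RtoC (u - t) * l) <= eps * Rabs (u - t).

(** The complex derivative in an epsilon form with [Cmod], so that it composes with [rderiv] along a
    curve. *)
Definition cderiv (f : C -> C) (z l : C) : Prop :=
  forall eps, 0 < eps -> exists d, 0 < d /\ forall w, Cmod (w - z) < d ->
    Cmod (f w - f z - l * (w - z)) <= eps * Cmod (w - z).

Lemma is_derive_eps (f : R -> R) (x l : R) : is_derive f x l <->
  forall eps, 0 < eps -> exists d, 0 < d /\ forall u, Rabs (u - x) < d ->
    Rabs (f u - f x - (u - x) * l) <= eps * Rabs (u - x).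
Proof.
  split.
  - move=> [_ h] eps he.
    have [d hd] := h x (fun P hP => hP) (mkposreal _ he).
    exists d. split; first exact: cond_pos. move=> u hu. exact: (hd u hu).
  - move=> h. split; first exact: is_linear_scal_l.
    move=> y hy eps.
    have -> : y = x by symmetry; exact: is_filter_lim_locally_unique.
    have [d [dp hd]] := h eps (cond_pos eps).
    exists (mkposreal _ dp) => u hu. exact: (hd u hu).
Qed.

Lemma im_le_Cmod (c : C) : Rabs (Im c) <= Cmod c.
Proof. apply: Rle_trans; last exact: Rmax_Cmod. exact: Rmax_r. Qed.

Lemma Cmod_le_sum (c : C) : Cmod c <= Rabs (Re c) + Rabs (Im c).
Proof.
  apply: Rsqr_incr_0_var; last by apply: Rplus_le_le_0_compat; exact: Rabs_pos.
  rewrite !Rsqr_pow2 Cmod_sqr -(pow2_abs (Re c)) -(pow2_abs (Im c)).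
  have := Rabs_pos (Re c). have := Rabs_pos (Im c). nra.
Qed.

Lemma rderiv_components (g : R -> C) (t : R) (l : C) : rderiv g t l <->
  is_derive (fun u => Re (g u)) t (Re l) /\ is_derive (fun u => Im (g u)) t (Im l).
Proof.
  rewrite !is_derive_eps. split.
  - move=> h. split=> eps he; have [d [dp hd]] := h eps he; exists d; split=> // u hu;
    apply: Rle_trans (hd u hu).
    + apply: Rle_trans (re_le_Cmod _). right. congr Rabs. rewrite /Re /=. ring.
    + apply: Rle_trans (im_le_Cmod _). right. congr Rabs. rewrite /Im /=. ring.
  - move=> [h1 h2] eps he.
    have [d1 [p1 hd1]] := h1 (eps / 2) ltac:(lra). have [d2 [p2 hd2]] := h2 (eps / 2) ltac:(lra).
    exists (Rmin d1 d2). split; first exact: Rmin_pos. move=> u hu.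
    apply: Rle_trans; first exact: Cmod_le_sum.
    have := hd1 u (Rlt_le_trans _ _ _ hu (Rmin_l _ _)). have := hd2 u (Rlt_le_trans _ _ _ hu (Rmin_r _ _)).
    have -> : Re (g u - g t - RtoC (u - t) * l)%C = Re (g u) - Re (g t) - (u - t) * Re l by rewrite /Re /=; ring.
    have -> : Im (g u - g t - RtoC (u - t) * l)%C = Im (g u) - Im (g t) - (u - t) * Im l by rewrite /Im /=; ring.
    lra.
Qed.

Lemma rderiv_continuous (g : R -> C) (t : R) (l : C) : rderiv g t l ->
  continuous (fun u => Re (g u)) t /\ continuous (fun u => Im (g u)) t.
Proof.
  move=> /rderiv_components [h1 h2]. split; apply: ex_derive_continuous.
  by exists (Re l). by exists (Im l).
Qed.

Lemma cderiv_rderiv (f : C -> C) (g : R -> C) (t : R) (l m : C) :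
  cderiv f (g t) l -> rderiv g t m -> rderiv (fun u => f (g u)) t (l * m)%C.
Proof.
  move=> hf hg eps he.
  have hl := Cmod_ge_0 l. have hm := Cmod_ge_0 m.
  pose e1 := eps / (2 * (Cmod m + 1)).
  have he1 : 0 < e1 by apply: Rdiv_lt_0_compat; lra.
  have [d1 [p1 h1]] := hf e1 he1.
  pose e2 := Rmin 1 (eps / (2 * (Cmod l + 1))).
  have he2 : 0 < e2 by apply: Rmin_pos; [lra | apply: Rdiv_lt_0_compat; lra].
  have [d2 [p2 h2]] := hg e2 he2.
  exists (Rmin d2 (d1 / (Cmod m + 2))). split.
    apply: Rmin_pos => //. apply: Rdiv_lt_0_compat; lra.
  move=> u hu.
  have hu2 := Rlt_le_trans _ _ _ hu (Rmin_l _ _). have hu1 := Rlt_le_trans _ _ _ hu (Rmin_r _ _).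
  have k2 := h2 u hu2. have hp := Rabs_pos (u - t).
  have inc : Cmod (g u - g t) <= (Cmod m + 1) * Rabs (u - t).
    have := Cmod_triangle (g u - g t - RtoC (u - t) * m) (RtoC (u - t) * m).
    rewrite Cmod_mult Cmod_R.
    have -> : (g u - g t - RtoC (u - t) * m + RtoC (u - t) * m)%C = (g u - g t)%C by ring.
    have := Rmin_l 1 (eps / (2 * (Cmod l + 1))). rewrite -/e2. nra.
  have small : Cmod (g u - g t) < d1.
    have h : Rabs (u - t) * (Cmod m + 2) < d1.
      have := Rmult_lt_compat_r (Cmod m + 2) _ _ ltac:(lra) hu1.
      by replace (d1 / (Cmod m + 2) * (Cmod m + 2)) with d1 by (field; lra).
    nra.
  have k1 := h1 (g u) small.
  replace (f (g u) - f (g t) - RtoC (u - t) * (l * m))%C with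
    ((f (g u) - f (g t) - l * (g u - g t)) + l * (g u - g t - RtoC (u - t) * m))%C by ring.
  apply: Rle_trans; first exact: Cmod_triangle.
  rewrite Cmod_mult.
  have a1 : e1 * Cmod (g u - g t) <= eps / 2 * Rabs (u - t).
    apply: Rle_trans; first exact: (Rmult_le_compat_l _ _ _ (Rlt_le _ _ he1) inc).
    right. rewrite /e1. field. lra.
  have a2 : Cmod l * Cmod (g u - g t - RtoC (u - t) * m) <= eps / 2 * Rabs (u - t).
    have e2l : e2 * (Cmod l + 1) <= eps / 2.
      have := Rmult_le_compat_r (Cmod l + 1) _ _ ltac:(lra) (Rmin_r 1 (eps / (2 * (Cmod l + 1)))).
      rewrite -/e2. by replace (eps / (2 * (Cmod l + 1)) * (Cmod l + 1)) with (eps / 2) by (field; lra).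
    have := Cmod_ge_0 (g u - g t - RtoC (u - t) * m).
    have : Cmod l * Cmod (g u - g t - RtoC (u - t) * m) <= Cmod l * (e2 * Rabs (u - t)) by apply: Rmult_le_compat_l.
    nra.
  lra.
Qed.

Lemma cderiv_Lipschitz (f : C -> C) (z l : C) : cderiv f z l ->
  exists d, 0 < d /\ forall w, Cmod (w - z) < d -> Cmod (f w - f z) <= (Cmod l + 1) * Cmod (w - z).
Proof.
  move=> h. have [d [dp hd]] := h 1 Rlt_0_1. exists d. split=> // w hw.
  have := hd w hw. have := Cmod_triangle (f w - f z - l * (w - z)) (l * (w - z)).
  rewrite Cmod_mult.
  have -> : (f w - f z - l * (w - z) + l * (w - z))%C = (f w - f z)%C by ring. lra.
Qed.

Lemma cderiv_quadratic (f : C -> C) (z l : C) (B d0 : R) : 0 < d0 -> 0 <= B ->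
  (forall w, Cmod (w - z) < d0 -> Cmod (f w - f z - l * (w - z)) <= B * Cmod (w - z) ^ 2) ->
  cderiv f z l.
Proof.
  move=> d0p B0 h eps he.
  exists (Rmin d0 (eps / (B + 1))). split.
    apply: Rmin_pos => //. apply: Rdiv_lt_0_compat; lra.
  move=> w hw. have h1 := h w (Rlt_le_trans _ _ _ hw (Rmin_l _ _)).
  have h2 := Rlt_le_trans _ _ _ hw (Rmin_r _ _).
  apply: Rle_trans; first exact: h1.
  have hp := Cmod_ge_0 (w - z).
  have : (B + 1) * Cmod (w - z) <= eps.
    have := Rmult_le_compat_l (B + 1) _ _ ltac:(lra) (Rlt_le _ _ h2).
    by replace ((B + 1) * (eps / (B + 1))) with eps by (field; lra).
  nra.
Qed.

Lemma cderiv_comp (f g : C -> C) (z l m : C) :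
  cderiv f (g z) l -> cderiv g z m -> cderiv (fun w => f (g w)) z (l * m)%C.
Proof.
  move=> hf hg eps he.
  have hl := Cmod_ge_0 l. have hm := Cmod_ge_0 m.
  pose e1 := eps / (2 * (Cmod m + 1)).
  have he1 : 0 < e1 by apply: Rdiv_lt_0_compat; lra.
  have [d1 [p1 h1]] := hf e1 he1.
  pose e2 := eps / (2 * (Cmod l + 1)).
  have he2 : 0 < e2 by apply: Rdiv_lt_0_compat; lra.
  have [d2 [p2 h2]] := hg e2 he2.
  have [d3 [p3 h3]] := cderiv_Lipschitz g z m hg.
  exists (Rmin d3 (Rmin d2 (d1 / (Cmod m + 1)))). split.
    apply: Rmin_pos => //. apply: Rmin_pos => //. apply: Rdiv_lt_0_compat; lra.
  move=> u hu.
  have hu3 := Rlt_le_trans _ _ _ hu (Rmin_l _ _). have hu' := Rlt_le_trans _ _ _ hu (Rmin_r _ _).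
  have hu2 := Rlt_le_trans _ _ _ hu' (Rmin_l _ _). have hu1 := Rlt_le_trans _ _ _ hu' (Rmin_r _ _).
  have k2 := h2 u hu2. have hp := Cmod_ge_0 (u - z). have inc := h3 u hu3.
  have small : Cmod (g u - g z) < d1.
    have h : Cmod (u - z) * (Cmod m + 1) < d1.
      have := Rmult_lt_compat_r (Cmod m + 1) _ _ ltac:(lra) hu1.
      by replace (d1 / (Cmod m + 1) * (Cmod m + 1)) with d1 by (field; lra).
    nra.
  have k1 := h1 (g u) small.
  replace (f (g u) - f (g z) - l * m * (u - z))%C with
    ((f (g u) - f (g z) - l * (g u - g z)) + l * (g u - g z - m * (u - z)))%C by ring.
  apply: Rle_trans; first exact: Cmod_triangle.
  rewrite Cmod_mult.
  have a1 : e1 * Cmod (g u - g z) <= eps / 2 * Cmod (u - z).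
    apply: Rle_trans; first exact: (Rmult_le_compat_l _ _ _ (Rlt_le _ _ he1) inc).
    right. rewrite /e1. field. lra.
  have a2 : Cmod l * Cmod (g u - g z - m * (u - z)) <= eps / 2 * Cmod (u - z).
    have e2l : e2 * (Cmod l + 1) = eps / 2 by rewrite /e2; field; lra.
    have : Cmod l * Cmod (g u - g z - m * (u - z)) <= Cmod l * (e2 * Cmod (u - z)) by apply: Rmult_le_compat_l.
    nra.
  lra.
Qed.

(** The increment w of g is tested against its own direction: Re (conj w g) - |w| psi has
    nonpositive derivative, hence |w|^2 <= |w| (psi b - psi a). *)
Lemma mean_value_ineq (g dg : R -> C) (psi dpsi : R -> R) (a b : R) : a <= b ->
  (forall t, a <= t <= b -> rderiv g t (dg t)) ->
  (forall t, a <= t <= b -> is_derive psi t (dpsi t)) ->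
  (forall t, a <= t <= b -> Cmod (dg t) <= dpsi t) ->
  Cmod (g b - g a) <= psi b - psi a.
Proof.
  move=> ab hg hp hle.
  set w := (g b - g a)%C.
  case: (Req_dec (Cmod w) 0) => w0.
    have [||c [hc e]] := MVT_gen psi a b dpsi.
    - move=> x. rewrite Rmin_left ?Rmax_right // => hx. apply: hp. lra.
    - move=> x. rewrite Rmin_left ?Rmax_right // => hx. apply/continuity_pt_filterlim.
      apply: (ex_derive_continuous psi). exists (dpsi x). exact: hp.
    rewrite Rmin_left ?Rmax_right // in hc.
    rewrite w0 e. have := hle c hc. have := Cmod_ge_0 (dg c). nra.
  have wp : 0 < Cmod w by have := Cmod_ge_0 w; lra.
  pose phi := fun t => Re w * Re (g t) + Im w * Im (g t) - Cmod w * psi t.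
  pose dphi := fun t => Re w * Re (dg t) + Im w * Im (dg t) - Cmod w * dpsi t.
  have dd : forall x, a <= x <= b -> is_derive phi x (dphi x).
    move=> x hx. have [h1 h2] := proj1 (rderiv_components _ _ _) (hg x hx).
    apply: (is_derive_minus (V := R_NormedModule)).
      apply: (is_derive_plus (V := R_NormedModule)); exact: is_derive_scal.
    apply: is_derive_scal. exact: hp.
  have [||c [hc e]] := MVT_gen phi a b dphi.
  - move=> x. rewrite Rmin_left ?Rmax_right // => hx. apply: dd. lra.
  - move=> x. rewrite Rmin_left ?Rmax_right // => hx. apply/continuity_pt_filterlim.
    apply: (ex_derive_continuous phi). exists (dphi x). exact: dd.
  rewrite Rmin_left ?Rmax_right // in hc.
  have d0 : dphi c <= 0.
    have : Re w * Re (dg c) + Im w * Im (dg c) <= Cmod w * Cmod (dg c).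
      rewrite -(Cmod_conj w) -Cmod_mult. apply: Rle_trans (Rle_trans _ _ _ (Rle_abs _) (re_le_Cmod _)).
      right. rewrite /Re /Im /=. ring.
    have := hle c hc. rewrite /dphi. nra.
  have e2 : phi b - phi a = Cmod w ^ 2 - Cmod w * (psi b - psi a).
    rewrite Cmod_sqr /phi. have -> : Re w = Re (g b) - Re (g a) by []. have -> : Im w = Im (g b) - Im (g a) by []. ring.
  rewrite e2 in e.
  have : Cmod w ^ 2 <= Cmod w * (psi b - psi a) by nra.
  move=> h. apply: (Rmult_le_reg_l (Cmod w)) => //. lra.
Qed.

(** * Exponential and logarithm *)

Ltac rring := match goal with |- @eq _ ?a ?b => change (@eq R a b) end; ring.

Lemma cexp_plus (a b : C) : cexp (a + b) = (cexp a * cexp b)%C.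
Proof.
  rewrite /cexp. have -> : Re (a + b)%C = Re a + Re b by []. have -> : Im (a + b)%C = Im a + Im b by [].
  rewrite exp_plus cos_plus sin_plus. apply: C_eq => /=; ring.
Qed.

Lemma cexp_0 : cexp (RtoC 0) = RtoC 1.
Proof. rewrite /cexp /= exp_0 cos_0 sin_0. apply: C_eq => /=; ring. Qed.

Lemma Cmod_unit (a : R) : Cmod (cos a, sin a) = 1.
Proof.
  rewrite /Cmod /=. have := sin2_cos2 a. rewrite /Rsqr => h.
  replace (cos a * (cos a * 1) + sin a * (sin a * 1)) with 1 by lra. exact: sqrt_1.
Qed.

Lemma Cmod_cexp (z : C) : Cmod (cexp z) = exp (Re z).
Proof.
  rewrite /cexp Cmod_mult Cmod_unit Cmod_R Rabs_pos_eq; first ring.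
  apply: Rlt_le. exact: exp_pos.
Qed.

Lemma cexp_neq0 (z : C) : cexp z <> RtoC 0.
Proof.
  move=> h. have := Cmod_cexp z. rewrite h Cmod_0. have := exp_pos (Re z). lra.
Qed.

Lemma cexp_opp (z : C) : cexp (- z) = (/ cexp z)%C.
Proof.
  have h : (cexp (- z) * cexp z)%C = RtoC 1.
    rewrite -cexp_plus. have -> : (- z + z)%C = RtoC 0 by ring. exact: cexp_0.
  have n := cexp_neq0 z.
  replace (cexp (- z)) with (cexp (- z) * cexp z * / cexp z)%C by (field; done). rewrite h. ring.
Qed.

Lemma rderiv_cexp_line (v : C) (t : R) : rderiv (fun u => cexp (RtoC u * v)) t (v * cexp (RtoC t * v))%C.
Proof.
  apply/rderiv_components. case: v => a b. rewrite /cexp /Re /Im /=.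
  have e1 : forall u, u * a - 0 * b = u * a by move=> u; ring.
  have e2 : forall u, u * b + 0 * a = u * b by move=> u; ring.
  rewrite e1 e2. split.
  - apply: (is_derive_ext (fun u => exp (u * a) * cos (u * b))).
      move=> u. rewrite e1 e2. rring.
    auto_derive; first done. ring.
  - apply: (is_derive_ext (fun u => exp (u * a) * sin (u * b))).
      move=> u. rewrite e1 e2. rring.
    auto_derive; first done. ring.
Qed.

(** The derivative v e^(tv) along the segment from 0 to v is at most 3 |v|, because e <= 3. *)
Lemma cexp_lip (v : C) : Cmod v <= 1 -> Cmod (cexp v - 1) <= 3 * Cmod v.
Proof.
  move=> hv.
  have := mean_value_ineq (fun u => cexp (RtoC u * v)) (fun t => v * cexp (RtoC t * v))%C
    (fun t => t * (3 * Cmod v)) (fun _ => 3 * Cmod v) 0 1 ltac:(lra).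
  have -> : (RtoC 1 * v)%C = v by ring. have -> : (RtoC 0 * v)%C = RtoC 0 by ring.
  rewrite cexp_0 => h.
  apply: Rle_trans (h _ _ _) _; last lra.
  - move=> t _. exact: rderiv_cexp_line.
  - move=> t _. auto_derive; [done|ring].
  - move=> t ht. rewrite Cmod_mult Cmod_cexp.
    have : exp (Re (RtoC t * v)) <= 3.
      apply: Rle_trans exp_le_3. have [hlt|->] : Re (RtoC t * v) < 1 \/ Re (RtoC t * v) = 1.
        have := Rle_abs (Re v). have := re_le_Cmod v.
        have -> : Re (RtoC t * v) = t * Re v by rewrite /Re /=; ring.
        have := Rabs_pos (Re v). nra.
      + apply: Rlt_le. exact: exp_increasing. + exact: Rle_refl.
    have := Cmod_ge_0 v. nra.
Qed.

(** The curve e^(tv) - t v has derivative v (e^(tv) - 1), which [cexp_lip] controls. *)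
Lemma cexp_quad (v : C) : Cmod v <= 1 -> Cmod (cexp v - 1 - v) <= 3 * Cmod v ^ 2.
Proof.
  move=> hv.
  have := mean_value_ineq (fun u => cexp (RtoC u * v) - RtoC u * v)%C (fun t => v * cexp (RtoC t * v) - v)%C
    (fun t => t * (3 * Cmod v ^ 2)) (fun _ => 3 * Cmod v ^ 2) 0 1 ltac:(lra).
  have -> : (RtoC 1 * v)%C = v by ring. have -> : (RtoC 0 * v)%C = RtoC 0 by ring.
  rewrite cexp_0 => h.
  have -> : (cexp v - 1 - v = cexp v - v - (RtoC 1 - RtoC 0))%C by ring.
  apply: Rle_trans (h _ _ _) _; last lra.
  - move=> t _ eps he. have [d [dp hd]] := rderiv_cexp_line v t eps he.
    exists d. split=> // u hu. have := hd u hu. apply: Rle_trans. right. congr Cmod.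
    rewrite RtoC_minus. ring.
  - move=> t _. auto_derive; [done|ring].
  - move=> t ht.
    have -> : (v * cexp (RtoC t * v) - v = v * (cexp (RtoC t * v) - 1))%C by ring.
    have e : Cmod (RtoC t * v) = t * Cmod v by rewrite Cmod_mult Cmod_R Rabs_pos_eq //; lra.
    have := cexp_lip (RtoC t * v). rewrite e Cmod_mult. have := Cmod_ge_0 v => hv0 hl.
    have := hl ltac:(nra). have := Cmod_ge_0 (cexp (RtoC t * v) - 1). nra.
Qed.

(** Equal cosines and sines give sin ((a - b)/2) = 0, while |(a - b)/2| < pi. *)
Lemma cos_sin_inj (a b : R) : Rabs (a - b) < 2 * PI -> cos a = cos b -> sin a = sin b -> a = b.
Proof.
  move=> h hc hs.
  have h1 : cos (a - b) = 1.
    rewrite cos_minus hc hs. have := sin2_cos2 b. rewrite /Rsqr. lra.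
  have h2 : sin ((a - b) / 2) = 0.
    have := cos_2a_sin ((a - b) / 2). replace (2 * ((a - b) / 2)) with (a - b) by field.
    rewrite h1. nra.
  have [h3 h4] := Rabs_def2 _ _ h.
  case: (Rtotal_order a b) => [lt|[//|gt]].
  - have := sin_gt_0 (- ((a - b) / 2)) ltac:(lra) ltac:(lra). rewrite sin_neg. lra.
  - have := sin_gt_0 ((a - b) / 2) ltac:(lra) ltac:(lra). lra.
Qed.

(** * Argument and logarithm with a cut *)

Definition is_arg (theta : R) (z : C) (a : R) : Prop :=
  theta - 2 * PI < a < theta /\ z = (RtoC (Cmod z) * (cos a, sin a))%C.

Lemma polar_inj (m a b : R) : m <> 0 -> Rabs (a - b) < 2 * PI ->
  (RtoC m * (cos a, sin a))%C = (RtoC m * (cos b, sin b))%C -> a = b.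
Proof.
  move=> hm hab e. have := f_equal fst e. have := f_equal snd e. rewrite /= => e2 e1.
  apply: cos_sin_inj => //; apply: (Rmult_eq_reg_l m) => //; lra.
Qed.

Lemma carg_unique (theta : R) (z : C) (a : R) : z <> RtoC 0 -> is_arg theta z a -> carg theta z = a.
Proof.
  move=> hz ha.
  have [h1 h2] : is_arg theta z (carg theta z) by apply: epsilon_spec; exists a.
  have [h3 h4] := ha.
  apply: (polar_inj (Cmod z)).
  - move=> h; apply: hz; exact: Cmod_eq_0.
  - apply: Rabs_def1; lra.
  - by rewrite -h2.
Qed.

Lemma polar_exists (z : C) : z <> RtoC 0 ->
  exists a, - PI <= a <= PI /\ z = (RtoC (Cmod z) * (cos a, sin a))%C.
Proof.
  move=> hz. have hm : 0 < Cmod z by apply/Cmod_gt_0.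
  set m := Cmod z in hm *. pose x := Re z / m. pose y := Im z / m.
  have hxy : x ^ 2 + y ^ 2 = 1.
    have := Cmod_sqr z. rewrite -/m => h. rewrite /x /y.
    replace ((Re z / m) ^ 2 + (Im z / m) ^ 2) with ((Re z ^ 2 + Im z ^ 2) / m ^ 2) by (field; lra).
    rewrite -h. field. lra.
  have hx : -1 <= x <= 1 by split; nra.
  have [b1 b2] := acos_bound x.
  have hs : sin (acos x) = Rabs y.
    rewrite sin_acos // -(sqrt_Rsqr_abs y) /Rsqr. congr sqrt. lra.
  have zE : forall c s, c = x -> s = y -> z = (RtoC m * (c, s))%C.
    move=> c s -> ->. rewrite /x /y. apply: C_eq => /=; rewrite /Re /Im; field; lra.
  case: (Rle_dec 0 y) => hy.
    exists (acos x). split; first lra. apply: zE; first exact: cos_acos. by rewrite hs Rabs_pos_eq.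
  exists (- acos x). split; first lra. apply: zE; first by rewrite cos_neg cos_acos.
  rewrite sin_neg hs Rabs_left; lra.
Qed.

Lemma on_cut_0 (theta : R) : on_cut theta (RtoC 0).
Proof. exists 0. split; first lra. ring. Qed.

(** An angle in [-pi, pi] is shifted by 2 pi where needed; the two boundary angles theta and theta -
    2 pi would put z on the cut. *)
Lemma carg_spec (theta : R) (z : C) : 0 < theta <= 2 * PI -> ~ on_cut theta z ->
  is_arg theta z (carg theta z).
Proof.
  move=> ht hz.
  have z0 : z <> RtoC 0 by move=> e; apply: hz; rewrite e; exact: on_cut_0.
  have [a [ha e]] := polar_exists z z0.
  have hp := PI_RGT_0.
  have hm := Cmod_ge_0 z.
  have ne1 : a <> theta by move=> h; apply: hz; exists (Cmod z); rewrite -h.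
  have ne2 : a <> theta - 2 * PI.
    move=> h. apply: hz. exists (Cmod z). split=> //. rewrite {1}e h.
    have -> : cos (theta - 2 * PI) = cos theta by rewrite cos_minus cos_2PI sin_2PI; ring.
    have -> : sin (theta - 2 * PI) = sin theta by rewrite sin_minus cos_2PI sin_2PI; ring.
    done.
  apply: epsilon_spec.
  case: (Rlt_dec theta a) => h1.
    exists (a - 2 * PI). split; first lra. rewrite {1}e cos_minus sin_minus cos_2PI sin_2PI.
    congr Cmult. apply: C_eq => /=; ring.
  case: (Rlt_dec a (theta - 2 * PI)) => h2.
    exists (a + 2 * PI). split; first lra. rewrite {1}e cos_plus sin_plus cos_2PI sin_2PI.
    congr Cmult. apply: C_eq => /=; ring.
  exists a. split=> //. lra.
Qed.

(** The cut angle stays a parameter: besides the theta of the theorem, the angles pi and 2 pi serve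
    as auxiliary branches, for moving a pole and for a pole far to the right. *)
Definition clog (theta : R) (z : C) : C := (ln (Cmod z), carg theta z).

Lemma cexp_clog (theta : R) (z : C) : 0 < theta <= 2 * PI -> ~ on_cut theta z ->
  cexp (clog theta z) = z.
Proof.
  move=> ht hz. have [_ e] := carg_spec theta z ht hz.
  have z0 : z <> RtoC 0 by move=> e0; apply: hz; rewrite e0; exact: on_cut_0.
  have hm : 0 < Cmod z by apply/Cmod_gt_0.
  by rewrite /cexp /clog /= exp_ln.
Qed.

Lemma polar_right (z : C) : 0 < Re z ->
  z = (RtoC (Cmod z) * (cos (atan (Im z / Re z)), sin (atan (Im z / Re z))))%C.
Proof.
  case: z => x y. rewrite /Re /Im /= => hx.
  have e : Cmod (x, y) = x * sqrt (1 + (y / x)²).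
    rewrite /Cmod -[X in _ = X * _](sqrt_Rsqr x); last lra. rewrite -sqrt_mult.
    - congr sqrt. rewrite /Rsqr /=. field. lra.
    - exact: Rle_0_sqr.
    - have := Rle_0_sqr (y / x). lra.
  have sp : 0 < sqrt (1 + (y / x)²) by apply: sqrt_lt_R0; have := Rle_0_sqr (y / x); lra.
  rewrite cos_atan sin_atan e. apply: C_eq => /=; rewrite /Re /Im /=; field; lra.
Qed.

Lemma atan_abs_le (v : R) : Rabs (atan v) <= Rabs v.
Proof.
  have [||c [_ e]] := MVT_gen atan 0 v (fun x => / (1 + x²)).
  - move=> x _. exact: is_derive_atan.
  - move=> x _. apply/continuity_pt_filterlim. apply: (ex_derive_continuous atan).
    exists (/ (1 + x²)). exact: is_derive_atan.
  rewrite atan_0 !Rminus_0_r in e. rewrite e Rabs_mult.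
  have h := Rle_0_sqr c.
  have : Rabs (/ (1 + c²)) <= 1.
    rewrite Rabs_pos_eq; last by apply: Rlt_le; apply: Rinv_0_lt_compat; lra.
    rewrite -[X in _ <= X]Rinv_1. apply: Rinv_le_contravar; lra.
  have := Rabs_pos v. nra.
Qed.

Lemma ln_le_minus1 (x : R) : 0 < x -> ln x <= x - 1.
Proof.
  move=> hx. have := exp_ineq1_le (ln x). rewrite exp_ln //. lra.
Qed.

Lemma log_near_1 (h : C) : Cmod h <= 1 / 2 ->
  Rabs (ln (Cmod (1 + h))) <= 2 * Cmod h /\ Rabs (atan (Im (1 + h)%C / Re (1 + h)%C)) <= 2 * Cmod h /\ 0 < Re (1 + h)%C.
Proof.
  move=> hh. have h0 := Cmod_ge_0 h.
  have re : Rabs (Re h) <= Cmod h := re_le_Cmod h.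
  have [r1 r2] : - Cmod h <= Re h <= Cmod h by move: re; rewrite /Rabs; case: Rcase_abs; lra.
  have im := im_le_Cmod h.
  have eR : Re (1 + h)%C = 1 + Re h by [].
  have eI : Im (1 + h)%C = Im h by rewrite /Im /=; ring.
  have up : Cmod (1 + h) <= 1 + Cmod h by have := Cmod_triangle 1 h; rewrite Cmod_1.
  have lo : 1 - Cmod h <= Cmod (1 + h).
    have := Cmod_triangle (1 + h) (- h). rewrite Cmod_opp.
    have -> : (1 + h + - h)%C = RtoC 1 by ring. rewrite Cmod_1. lra.
  split; last split.
  - have l1 := ln_le_minus1 (Cmod (1 + h)) ltac:(lra).
    have ip : 0 < / Cmod (1 + h) by apply: Rinv_0_lt_compat; lra.
    have l2 := ln_le_minus1 (/ Cmod (1 + h)) ip.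
    rewrite ln_Rinv in l2; last lra.
    have : / Cmod (1 + h) - 1 <= 2 * Cmod h.
      apply: (Rmult_le_reg_l (Cmod (1 + h))); first lra.
      rewrite Rmult_minus_distr_l Rinv_r; last lra. nra.
    move=> l3. rewrite /Rabs. case: Rcase_abs; lra.
  - apply: Rle_trans; first exact: atan_abs_le.
    rewrite eR eI /Rdiv Rabs_mult.
    have : Rabs (/ (1 + Re h)) <= 2.
      rewrite Rabs_pos_eq; last by apply: Rlt_le; apply: Rinv_0_lt_compat; lra.
      rewrite -[X in _ <= X](Rinv_inv 2). apply: Rinv_le_contravar; lra.
    move=> h2. rewrite (Rmult_comm 2). apply: Rmult_le_compat => //; exact: Rabs_pos.
  - rewrite eR. lra.
Qed.

(** With w = z (1 + h) the logarithm changes by L = log (1 + h), so the error of the linear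
    approximation is - (e^L - 1 - L), which is quadratically small. *)
Lemma cderiv_clog (theta : R) (z : C) : 0 < theta <= 2 * PI -> ~ on_cut theta z ->
  cderiv (clog theta) z (/ z)%C.
Proof.
  move=> ht hz.
  have z0 : z <> RtoC 0 by move=> e0; apply: hz; rewrite e0; exact: on_cut_0.
  have zp : 0 < Cmod z by apply/Cmod_gt_0.
  have [[a1 a2] ez] := carg_spec theta z ht hz.
  set a := carg theta z in a1 a2 ez.
  (* |h| < d keeps the new argument a + b, where |b| <= 2 |h|, inside the open range, and makes |h|
     <= 1/2 and |L| <= 1. *)
  pose d := Rmin (1 / 4) (Rmin ((theta - a) / 4) ((a - (theta - 2 * PI)) / 4)).
  have dp : 0 < d by rewrite /d; repeat apply: Rmin_pos; lra.
  have d1 : d <= 1 / 4 by exact: Rmin_l.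
  have d2 : d <= (theta - a) / 4 by apply: Rle_trans; [exact: Rmin_r | exact: Rmin_l].
  have d3 : d <= (a - (theta - 2 * PI)) / 4 by apply: Rle_trans; [exact: Rmin_r | exact: Rmin_r].
  (* 48 is 3 times 4^2: the constant 3 of [cexp_quad] and |L| <= 4 |h|, where |h| = |w - z|/|z|. *)
  apply: (cderiv_quadratic _ _ _ (48 / Cmod z ^ 2) (Cmod z * d)).
  - exact: Rmult_lt_0_compat.
  - apply: Rlt_le. apply: Rdiv_lt_0_compat; first lra. exact: pow_lt.
  move=> w hw. pose h := ((w - z) / z)%C.
  have eh : Cmod h = Cmod (w - z) / Cmod z by rewrite /h Cmod_div.
  have hd : Cmod h < d.
    rewrite eh. apply: (Rmult_lt_reg_l (Cmod z)) => //.
    by replace (Cmod z * (Cmod (w - z) / Cmod z)) with (Cmod (w - z)) by (field; lra).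
  have h0 := Cmod_ge_0 h.
  have [l1 [l2 l3]] := log_near_1 h ltac:(lra).
  set b := atan _ in l2.
  have [b1 b2] : - (2 * Cmod h) <= b <= 2 * Cmod h by move: l2; rewrite /Rabs; case: Rcase_abs; lra.
  have pr := polar_right (1 + h) l3. rewrite -/b in pr.
  have ew : w = (z * (1 + h))%C by rewrite /h; field.
  have up : 0 < Cmod (1 + h) by apply/Cmod_gt_0 => e; move: l3; rewrite e /=; lra.
  have mw : Cmod w = Cmod z * Cmod (1 + h) by rewrite ew Cmod_mult.
  have aw : carg theta w = a + b.
    apply: carg_unique; first by apply/Cmod_gt_0; rewrite mw; exact: Rmult_lt_0_compat.
    split; first lra.
    rewrite mw {1}ew {1}ez {1}pr cos_plus sin_plus. apply: C_eq => /=; ring.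
  pose L : C := (ln (Cmod (1 + h)), b).
  have eL : cexp L = (1 + h)%C by rewrite /cexp /L /= exp_ln.
  have mL : Cmod L <= 4 * Cmod h.
    apply: Rle_trans; first exact: Cmod_le_sum. rewrite /L /=. lra.
  have -> : (clog theta w - clog theta z - / z * (w - z) = - (cexp L - 1 - L))%C.
    have e1 : clog theta w = (clog theta z + L)%C.
      rewrite /clog aw mw ln_mult //.
    rewrite e1 eL /h. field. done.
  rewrite Cmod_opp. apply: Rle_trans; first by apply: cexp_quad; lra.
  have := Cmod_ge_0 L => hL.
  have : Cmod L ^ 2 <= 16 * Cmod h ^ 2 by nra.
  have -> : 48 / Cmod z ^ 2 * Cmod (w - z) ^ 2 = 48 * Cmod h ^ 2 by rewrite eh; field; lra.
  lra.
Qed.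

Lemma cderiv_ext_val (f : C -> C) (z l l' : C) : cderiv f z l -> l = l' -> cderiv f z l'.
Proof. by move=> h <-. Qed.

Lemma cderiv_id (z : C) : cderiv (fun w => w) z (RtoC 1).
Proof.
  move=> eps he. exists 1. split; first lra. move=> w _.
  have -> : (w - z - 1 * (w - z))%C = RtoC 0 by ring. rewrite Cmod_0. have := Cmod_ge_0 (w - z). nra.
Qed.

Lemma cderiv_const (c z : C) : cderiv (fun _ => c) z (RtoC 0).
Proof.
  move=> eps he. exists 1. split; first lra. move=> w _.
  have -> : (c - c - 0 * (w - z))%C = RtoC 0 by ring. rewrite Cmod_0. have := Cmod_ge_0 (w - z). nra.
Qed.

Lemma cderiv_plus (f g : C -> C) (z l m : C) : cderiv f z l -> cderiv g z m ->
  cderiv (fun w => f w + g w)%C z (l + m)%C.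
Proof.
  move=> hf hg eps he.
  have [d1 [p1 h1]] := hf (eps / 2) ltac:(lra). have [d2 [p2 h2]] := hg (eps / 2) ltac:(lra).
  exists (Rmin d1 d2). split; first exact: Rmin_pos. move=> w hw.
  have k1 := h1 w (Rlt_le_trans _ _ _ hw (Rmin_l _ _)). have k2 := h2 w (Rlt_le_trans _ _ _ hw (Rmin_r _ _)).
  have -> : (f w + g w - (f z + g z) - (l + m) * (w - z) = (f w - f z - l * (w - z)) + (g w - g z - m * (w - z)))%C by ring.
  have := Cmod_triangle (f w - f z - l * (w - z)) (g w - g z - m * (w - z)). lra.
Qed.

Lemma cderiv_scal (c : C) (f : C -> C) (z l : C) : cderiv f z l -> cderiv (fun w => c * f w)%C z (c * l)%C.
Proof.
  move=> hf eps he. have hc := Cmod_ge_0 c.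
  have [d [dp hd]] := hf (eps / (Cmod c + 1)) ltac:(apply: Rdiv_lt_0_compat; lra).
  exists d. split=> // w hw. have := hd w hw => h.
  have -> : (c * f w - c * f z - c * l * (w - z) = c * (f w - f z - l * (w - z)))%C by ring.
  rewrite Cmod_mult. have hp := Cmod_ge_0 (w - z).
  apply: Rle_trans; first exact: (Rmult_le_compat_l _ _ _ hc h).
  have e : eps = eps / (Cmod c + 1) * (Cmod c + 1) by field; lra.
  have q : 0 < eps / (Cmod c + 1) by apply: Rdiv_lt_0_compat; lra.
  rewrite {2}e. nra.
Qed.

Lemma cderiv_inv (z : C) : z <> RtoC 0 -> cderiv (fun w => / w)%C z (- / (z * z))%C.
Proof.
  move=> z0. have zp : 0 < Cmod z by apply/Cmod_gt_0.
  apply: (cderiv_quadratic _ _ _ (2 / Cmod z ^ 3) (Cmod z / 2)); first lra.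
    apply: Rlt_le. apply: Rdiv_lt_0_compat; first lra. exact: pow_lt.
  move=> w hw.
  have hw2 : Cmod z / 2 <= Cmod w.
    have := Cmod_triangle w (- (w - z)). rewrite Cmod_opp.
    have -> : (w + - (w - z))%C = z by ring. lra.
  have w0 : w <> RtoC 0 by apply/Cmod_gt_0; lra.
  have -> : (/ w - / z - - / (z * z) * (w - z) = (w - z) * (w - z) / (z * z * w))%C by field.
  rewrite Cmod_div; last by apply: Cmult_neq_0 => //; exact: Cmult_neq_0.
  rewrite !Cmod_mult.
  replace (2 / Cmod z ^ 3 * Cmod (w - z) ^ 2) with (Cmod (w - z) * Cmod (w - z) * (/ (Cmod z * Cmod z * (Cmod z / 2)))) by (field; lra).
  apply: Rmult_le_compat_l; first by have := Cmod_ge_0 (w - z); nra.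
  apply: Rinv_le_contravar; first by repeat apply: Rmult_lt_0_compat; lra.
  apply: Rmult_le_compat_l => //. nra.
Qed.

(** * A primitive of (e^(az) - 1)/(e^z - 1) *)

Definition Ccont (g : R -> C) (t : R) : Prop :=
  continuous (fun u => Re (g u)) t /\ continuous (fun u => Im (g u)) t.

Lemma continuous_eps (f : R -> R) (t : R) : continuous f t <->
  forall eps, 0 < eps -> exists d, 0 < d /\ forall u, Rabs (u - t) < d -> Rabs (f u - f t) < eps.
Proof.
  split.
  - move=> h eps he. have [d hd] := proj1 (filterlim_locally f (f t)) h (mkposreal _ he).
    exists d. split; first exact: cond_pos. move=> u hu. exact: (hd u hu).
  - move=> h. apply/filterlim_locally => eps. have [d [dp hd]] := h eps (cond_pos eps).
    exists (mkposreal _ dp) => u hu. exact: (hd u hu).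
Qed.

Lemma Ccont_eps (g : R -> C) (t : R) : Ccont g t <->
  forall eps, 0 < eps -> exists d, 0 < d /\ forall u, Rabs (u - t) < d -> Cmod (g u - g t) < eps.
Proof.
  rewrite /Ccont !continuous_eps. split.
  - move=> [h1 h2] eps he.
    have [d1 [p1 k1]] := h1 (eps / 2) ltac:(lra). have [d2 [p2 k2]] := h2 (eps / 2) ltac:(lra).
    exists (Rmin d1 d2). split; first exact: Rmin_pos. move=> u hu.
    apply: Rle_lt_trans; first exact: Cmod_le_sum.
    have := k1 u (Rlt_le_trans _ _ _ hu (Rmin_l _ _)). have := k2 u (Rlt_le_trans _ _ _ hu (Rmin_r _ _)).
    have -> : Re (g u - g t)%C = Re (g u) - Re (g t) by []. have -> : Im (g u - g t)%C = Im (g u) - Im (g t) by [].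
    lra.
  - move=> h. split=> eps he; have [d [dp hd]] := h eps he; exists d; split=> // u hu;
    apply: Rle_lt_trans (hd u hu); [exact: (re_le_Cmod (g u - g t)) | exact: (im_le_Cmod (g u - g t))].
Qed.

Lemma rderiv_Ccont (g : R -> C) (t : R) (l : C) : rderiv g t l -> Ccont g t.
Proof. exact: rderiv_continuous. Qed.

Lemma Ccont_Cmod (g : R -> C) (t : R) : Ccont g t -> continuous (fun u => Cmod (g u)) t.
Proof.
  move=> /Ccont_eps h. apply/continuous_eps => eps he. have [d [dp hd]] := h eps he.
  exists d. split=> // u hu. apply: Rle_lt_trans (hd u hu).
  have h1 := Cmod_triangle (g u - g t) (g t). have h2 := Cmod_triangle (g t - g u) (g u).
  have e1 : (g u - g t + g t)%C = g u by ring. have e2 : (g t - g u + g u)%C = g t by ring.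
  have e3 : Cmod (g t - g u) = Cmod (g u - g t) by rewrite -Cmod_opp; congr Cmod; ring.
  rewrite e1 in h1. rewrite e2 e3 in h2. rewrite /Rabs. case: Rcase_abs; lra.
Qed.

Lemma Ccont_comp (f : C -> C) (g : R -> C) (t : R) (l : C) :
  cderiv f (g t) l -> Ccont g t -> Ccont (fun u => f (g u)) t.
Proof.
  move=> hf /Ccont_eps hg. apply/Ccont_eps => eps he.
  have [d [dp hd]] := cderiv_Lipschitz f (g t) l hf.
  have lp : 0 < Cmod l + 1 by have := Cmod_ge_0 l; lra.
  have [d2 [dp2 hd2]] := hg (Rmin d (eps / (Cmod l + 1))) ltac:(apply: Rmin_pos => //; apply: Rdiv_lt_0_compat; lra).
  exists d2. split=> // u hu. have k := hd2 u hu.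
  apply: Rle_lt_trans (hd _ (Rlt_le_trans _ _ _ k (Rmin_l _ _))) _.
  have := Rmult_lt_compat_l _ _ _ lp (Rlt_le_trans _ _ _ k (Rmin_r _ _)).
  by replace ((Cmod l + 1) * (eps / (Cmod l + 1))) with eps by (field; lra).
Qed.

Lemma Ccont_mult (f g : R -> C) (t : R) : Ccont f t -> Ccont g t -> Ccont (fun u => f u * g u)%C t.
Proof.
  move=> [f1 f2] [g1 g2]. split.
  - apply: (continuous_minus (V := R_NormedModule) (fun u => Re (f u) * Re (g u)) (fun u => Im (f u) * Im (g u)));
    exact: (continuous_mult (K := R_AbsRing)).
  - apply: (continuous_plus (V := R_NormedModule) (fun u => Re (f u) * Im (g u)) (fun u => Im (f u) * Re (g u)));
    exact: (continuous_mult (K := R_AbsRing)).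
Qed.

Lemma Ccont_RtoC (f : R -> R) (t : R) : continuous f t -> Ccont (fun u => RtoC (f u)) t.
Proof. move=> h. split=> //. exact: continuous_const. Qed.

Definition prim (g : R -> C) (t : R) : C :=
  (RInt (fun u => Re (g u)) 0 t, RInt (fun u => Im (g u)) 0 t).

Lemma prim_0 (g : R -> C) : prim g 0 = RtoC 0.
Proof. by rewrite /prim !RInt_point. Qed.

Lemma prim_rderiv (g : R -> C) (t : R) : (forall u, Ccont g u) -> rderiv (prim g) t (g t).
Proof.
  move=> hg.
  have h : forall f : R -> R, (forall u, continuous f u) -> is_derive (fun t => RInt f 0 t) t (f t).
    move=> f hf. apply: (is_derive_RInt f (fun t => RInt f 0 t) 0 t) => //.
    apply: filter_forall => y. apply: (RInt_correct (V := R_CompleteNormedModule)).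
    apply: (ex_RInt_continuous (V := R_CompleteNormedModule)) => z _. exact: hf.
  apply/rderiv_components. split; apply: h => u; apply (hg u).
Qed.

Lemma rderiv_plus (f g : R -> C) (t : R) (l m : C) : rderiv f t l -> rderiv g t m ->
  rderiv (fun u => f u + g u)%C t (l + m)%C.
Proof.
  move=> /rderiv_components [f1 f2] /rderiv_components [g1 g2]. apply/rderiv_components.
  split; exact: (is_derive_plus (V := R_NormedModule)).
Qed.

Lemma rderiv_minus (f g : R -> C) (t : R) (l m : C) : rderiv f t l -> rderiv g t m ->
  rderiv (fun u => f u - g u)%C t (l - m)%C.
Proof.
  move=> /rderiv_components [f1 f2] /rderiv_components [g1 g2]. apply/rderiv_components.
  split; exact: (is_derive_minus (V := R_NormedModule)).
Qed.

Lemma rderiv_mult (f g : R -> C) (t : R) (l m : C) : rderiv f t l -> rderiv g t m ->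
  rderiv (fun u => f u * g u)%C t (l * g t + f t * m)%C.
Proof.
  move=> /rderiv_components [f1 f2] /rderiv_components [g1 g2]. apply/rderiv_components.
  have M : forall a b : R -> R, forall x y, is_derive a t x -> is_derive b t y ->
     is_derive (fun u => a u * b u) t (x * b t + a t * y).
    move=> a b x y ha hb. exact: (is_derive_mult (K := R_AbsRing) a b t x y ha hb Rmult_comm).
  have eR : Re (l * g t + f t * m)%C =
     (Re l * Re (g t) + Re (f t) * Re m) - (Im l * Im (g t) + Im (f t) * Im m) by rewrite /Re /Im /=; ring.
  have eI : Im (l * g t + f t * m)%C =
     (Re l * Im (g t) + Re (f t) * Im m) + (Im l * Re (g t) + Im (f t) * Re m) by rewrite /Re /Im /=; ring.
  rewrite eR eI. split.
  - exact: (is_derive_minus (V := R_NormedModule) _ _ _ _ _ (M _ _ _ _ f1 g1) (M _ _ _ _ f2 g2)).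
  - exact: (is_derive_plus (V := R_NormedModule) _ _ _ _ _ (M _ _ _ _ f1 g2) (M _ _ _ _ f2 g1)).
Qed.

Lemma rderiv_const (c : C) (t : R) : rderiv (fun _ => c) t (RtoC 0).
Proof. apply/rderiv_components. split; exact: (is_derive_const (V := R_NormedModule)). Qed.

Lemma rderiv_RtoC (t : R) : rderiv RtoC t (RtoC 1).
Proof. apply/rderiv_components. split; [exact: (is_derive_id (K := R_AbsRing)) | exact: (is_derive_const (V := R_NormedModule))]. Qed.

Lemma rderiv_scal (c : C) (g : R -> C) (t : R) (l : C) : rderiv g t l ->
  rderiv (fun u => c * g u)%C t (c * l)%C.
Proof.
  move=> h. have := rderiv_mult _ _ _ _ _ (rderiv_const c t) h.
  by have -> : (RtoC 0 * g t + c * l)%C = (c * l)%C by ring.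
Qed.

Lemma rderiv_line (z : C) (t : R) : rderiv (fun u => RtoC u * z)%C t z.
Proof.
  have := rderiv_mult _ _ _ _ _ (rderiv_RtoC t) (rderiv_const z t).
  by have -> : (RtoC 1 * z + RtoC t * RtoC 0)%C = z by ring.
Qed.

Lemma curve_bound (g dg : R -> C) (M : R) : (forall t, 0 <= t <= 1 -> rderiv g t (dg t)) ->
  (forall t, 0 <= t <= 1 -> Cmod (dg t) <= M) -> Cmod (g 1 - g 0) <= M.
Proof.
  move=> h1 h2.
  have := mean_value_ineq g dg (fun t => M * t) (fun _ => M) 0 1 ltac:(lra) h1 _ h2.
  rewrite Rmult_1_r Rmult_0_r Rminus_0_r. apply=> t _. auto_derive; [done|ring].
Qed.

(* E1 z = (e^z - 1)/z, extended continuously by 1 at z = 0; E2 is its derivative. *)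
Definition E1 (z : C) : C := prim (fun t => cexp (RtoC t * z)) 1.
Definition E2 (z : C) : C := prim (fun t => RtoC t * cexp (RtoC t * z))%C 1.

Lemma Ccont_cexp_line (z : C) (t : R) : Ccont (fun u => cexp (RtoC u * z)) t.
Proof. exact: rderiv_Ccont (rderiv_cexp_line z t). Qed.

Lemma Ccont_tcexp_line (z : C) (t : R) : Ccont (fun u => RtoC u * cexp (RtoC u * z))%C t.
Proof. apply: Ccont_mult; [exact: rderiv_Ccont (rderiv_RtoC t) | exact: Ccont_cexp_line]. Qed.

(** z times the integral of e^(uz) over [0, t], minus e^(tz), has derivative 0 in t. *)
Lemma E1_eq (z : C) : (z * E1 z)%C = (cexp z - 1)%C.
Proof.
  have := curve_bound (fun t => z * prim (fun t => cexp (RtoC t * z)) t - cexp (RtoC t * z))%C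
    (fun t => z * cexp (RtoC t * z) - z * cexp (RtoC t * z))%C 0.
  rewrite prim_0 -/(E1 z). have -> : (RtoC 1 * z)%C = z by ring. have -> : (RtoC 0 * z)%C = RtoC 0 by ring.
  rewrite cexp_0 => h.
  have e : (z * E1 z - cexp z - (z * 0 - 1))%C = RtoC 0.
    apply: Cmod_eq_0. apply: Rle_antisym; last exact: Cmod_ge_0. apply: h.
    - move=> t _. apply: rderiv_minus; last exact: rderiv_cexp_line.
      apply: rderiv_scal. apply: prim_rderiv => u. exact: Ccont_cexp_line.
    - move=> t _. have -> : (z * cexp (RtoC t * z) - z * cexp (RtoC t * z))%C = RtoC 0 by ring.
      rewrite Cmod_0. lra.
  replace (z * E1 z)%C with ((z * E1 z - cexp z - (z * 0 - 1)) + (cexp z - 1))%C by ring. rewrite e. ring.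
Qed.

Lemma Cmod_cexp_line (z : C) (t r : R) : 0 <= t <= 1 -> Cmod z <= r -> Cmod (cexp (RtoC t * z)) <= exp r.
Proof.
  move=> ht hz. rewrite Cmod_cexp.
  have h : Re (RtoC t * z)%C <= r.
    have -> : Re (RtoC t * z)%C = t * Re z by rewrite /Re /=; ring.
    have := Rle_abs (Re z). have := re_le_Cmod z. have := Rabs_pos (Re z). nra.
  case: h => h; [by apply: Rlt_le; exact: exp_increasing | rewrite h; exact: Rle_refl].
Qed.

(** A derivative with bounds uniform on each disc; the uniformity is what lets [kf_segment] treat a
    whole segment at once. *)
Definition quad_bounded (f f' : C -> C) : Prop := forall r, exists B d, 0 <= B /\ 0 < d /\
  forall z w, Cmod z <= r -> Cmod (w - z) <= d ->
  Cmod (f z) <= B /\ Cmod (f' z) <= B /\ Cmod (f w - f z - f' z * (w - z)) <= B * Cmod (w - z) ^ 2.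

(** The estimate is made under the integral: with h = w - z, e^(tw) - e^(tz) - t h e^(tz) = e^(tz)
    (e^(th) - 1 - th), and [cexp_quad] bounds the bracket. *)
Lemma E1_quad : quad_bounded E1 E2.
Proof.
  move=> r. exists (3 * exp r), 1. have ep := exp_pos r.
  split; first lra. split; first lra. move=> z w hz hw.
  have c1 : forall v u, Ccont (fun t => cexp (RtoC t * v)) u by exact: Ccont_cexp_line.
  have c2 : forall v u, Ccont (fun t => RtoC t * cexp (RtoC t * v))%C u by exact: Ccont_tcexp_line.
  split; last split.
  - have := curve_bound (prim (fun t => cexp (RtoC t * z))) (fun t => cexp (RtoC t * z)) (3 * exp r).
    rewrite prim_0 -/(E1 z). have -> : (E1 z - 0)%C = E1 z by ring. apply.
      move=> t _. exact: prim_rderiv.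
    move=> t ht. have := Cmod_cexp_line z t r ht hz. lra.
  - have := curve_bound (prim (fun t => RtoC t * cexp (RtoC t * z))%C) (fun t => RtoC t * cexp (RtoC t * z))%C (3 * exp r).
    rewrite prim_0 -/(E2 z). have -> : (E2 z - 0)%C = E2 z by ring. apply.
      move=> t _. by apply: (prim_rderiv (fun t => RtoC t * cexp (RtoC t * z))%C).
    move=> t ht. have := Cmod_cexp_line z t r ht hz. rewrite Cmod_mult Cmod_R Rabs_pos_eq; last lra.
    have := Cmod_ge_0 (cexp (RtoC t * z)). nra.
  - set h := (w - z)%C in hw *.
    have := curve_bound
      (fun t => prim (fun t => cexp (RtoC t * w)) t - prim (fun t => cexp (RtoC t * z)) t -
         h * prim (fun t => RtoC t * cexp (RtoC t * z))%C t)%C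
      (fun t => cexp (RtoC t * w) - cexp (RtoC t * z) - h * (RtoC t * cexp (RtoC t * z)))%C
      (3 * exp r * Cmod h ^ 2).
    rewrite !prim_0 -/(E1 z) -/(E1 w) -/(E2 z).
    have -> : (E1 w - E1 z - h * E2 z - (0 - 0 - h * 0))%C = (E1 w - E1 z - E2 z * h)%C by ring.
    apply.
    + move=> t _. apply: rderiv_minus; first by apply: rderiv_minus; exact: prim_rderiv.
      apply: rderiv_scal. by apply: (prim_rderiv (fun t => RtoC t * cexp (RtoC t * z))%C).
    + move=> t ht.
      have -> : cexp (RtoC t * w) = (cexp (RtoC t * z) * cexp (RtoC t * h))%C.
        rewrite -cexp_plus. congr cexp. rewrite /h. ring.
      have -> : (cexp (RtoC t * z) * cexp (RtoC t * h) - cexp (RtoC t * z) - h * (RtoC t * cexp (RtoC t * z)))%C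
        = (cexp (RtoC t * z) * (cexp (RtoC t * h) - 1 - RtoC t * h))%C by ring.
      have e : Cmod (RtoC t * h) = t * Cmod h by rewrite Cmod_mult Cmod_R Rabs_pos_eq //; lra.
      have h0 := Cmod_ge_0 h.
      have q := cexp_quad (RtoC t * h) ltac:(rewrite e; nra). rewrite e in q.
      rewrite Cmod_mult. have b := Cmod_cexp_line z t r ht hz.
      apply: Rle_trans (_ : exp r * (3 * Cmod h ^ 2) <= _); last by right; ring.
      apply: Rmult_le_compat => //; try exact: Cmod_ge_0.
      apply: Rle_trans; first exact: q.
      rewrite Rpow_mult_distr. have : t ^ 2 <= 1 by nra. have := pow2_ge_0 (Cmod h). nra.
Qed.

Lemma quad_bounded_cderiv (f f' : C -> C) (z : C) : quad_bounded f f' -> cderiv f z (f' z).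
Proof.
  move=> h. have [B [d [B0 [dp hB]]]] := h (Cmod z).
  apply: (cderiv_quadratic _ _ _ B d) => // w hw. by have [_ [_ ?]] := hB z w (Rle_refl _) (Rlt_le _ _ hw).
Qed.

Lemma quad_bounded_dilate (f f' : C -> C) (a : C) : quad_bounded f f' ->
  quad_bounded (fun z => a * f (a * z))%C (fun z => a * a * f' (a * z))%C.
Proof.
  move=> h r. have a0 := Cmod_ge_0 a.
  have [B [d [B0 [dp hB]]]] := h (Cmod a * Rabs r).
  exists (B * (1 + Cmod a) ^ 3), (d / (Cmod a + 1)).
  have b3 : 1 <= (1 + Cmod a) ^ 3 by apply: pow_R1_Rle; lra.
  split; first nra. split; first by apply: Rdiv_lt_0_compat; lra.
  move=> z w hz hw.
  have hz2 : Cmod (a * z) <= Cmod a * Rabs r.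
    rewrite Cmod_mult. apply: Rmult_le_compat_l => //. apply: Rle_trans; [exact: hz | exact: Rle_abs].
  have hw2 : Cmod (a * w - a * z) = Cmod a * Cmod (w - z) by rewrite -Cmod_mult; congr Cmod; ring.
  have hw3 : Cmod (a * w - a * z) <= d.
    rewrite hw2. have hp := Cmod_ge_0 (w - z).
    have := Rmult_le_compat_l (Cmod a + 1) _ _ ltac:(lra) hw.
    replace ((Cmod a + 1) * (d / (Cmod a + 1))) with d by (field; lra). nra.
  have [h1 [h2 h3]] := hB (a * z)%C (a * w)%C hz2 hw3. rewrite hw2 in h3.
  have p1 : Cmod a <= (1 + Cmod a) ^ 3 by nra.
  have p2 : Cmod a * Cmod a <= (1 + Cmod a) ^ 3 by nra.
  have p3 : Cmod a * Cmod a ^ 2 <= (1 + Cmod a) ^ 3 by nra.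
  split; last split.
  - rewrite Cmod_mult Rmult_comm. apply: Rmult_le_compat => //. exact: Cmod_ge_0.
  - rewrite !Cmod_mult Rmult_comm. apply: Rmult_le_compat => //; [exact: Cmod_ge_0|nra].
  - have -> : (a * f (a * w) - a * f (a * z) - a * a * f' (a * z) * (w - z))%C =
       (a * (f (a * w) - f (a * z) - f' (a * z) * (a * w - a * z)))%C by ring.
    rewrite Cmod_mult. apply: Rle_trans; first exact: (Rmult_le_compat_l _ _ _ a0 h3).
    rewrite Rpow_mult_distr.
    have q : 0 <= B * Cmod (w - z) ^ 2 by apply: Rmult_le_pos => //; exact: pow2_ge_0.
    have := Rmult_le_compat_r _ _ _ q p3. lra.
Qed.

(** Here e^z = 1 only at 0, so [E1] has no zero; differences of two logarithms of the same branch
    lie in this set. *)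
Definition strip (z : C) : Prop := Rabs (Im z) < 2 * PI.

Lemma strip_scale (z : C) (t : R) : 0 <= t <= 1 -> strip z -> strip (RtoC t * z)%C.
Proof.
  rewrite /strip => ht hz. have -> : Im (RtoC t * z)%C = t * Im z by rewrite /Im /=; ring.
  rewrite Rabs_mult (Rabs_pos_eq t); last lra. have := Rabs_pos (Im z). nra.
Qed.

Lemma cexp_eq1 (z : C) : strip z -> cexp z = RtoC 1 -> z = RtoC 0.
Proof.
  move=> hs h. have hm := Cmod_cexp z. rewrite h Cmod_1 in hm.
  have r0 : Re z = 0 by rewrite -(ln_exp (Re z)) -hm ln_1.
  have i0 : Im z = 0.
    have e1 := f_equal fst h. have e2 := f_equal snd h. rewrite /cexp /= r0 exp_0 in e1 e2.
    apply: cos_sin_inj; rewrite ?cos_0 ?sin_0 ?Rminus_0_r //; lra.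
  exact: C_eq.
Qed.

Lemma E1_0 : E1 (RtoC 0) = RtoC 1.
Proof.
  have := curve_bound (fun t => prim (fun t => cexp (RtoC t * RtoC 0)) t - RtoC t)%C
     (fun t => cexp (RtoC t * RtoC 0) - 1)%C 0.
  rewrite prim_0 -/(E1 (RtoC 0)) => h.
  have e : (E1 (RtoC 0) - 1 - (0 - 0))%C = RtoC 0.
    apply: Cmod_eq_0. apply: Rle_antisym; last exact: Cmod_ge_0. apply: h.
    - move=> t _. apply: rderiv_minus; last exact: rderiv_RtoC. apply: prim_rderiv => u. exact: Ccont_cexp_line.
    - move=> t _. have -> : (RtoC t * RtoC 0)%C = RtoC 0 by ring. rewrite cexp_0.
      have -> : (1 - 1)%C = RtoC 0 by ring. rewrite Cmod_0. lra.
  replace (E1 (RtoC 0)) with ((E1 (RtoC 0) - 1 - (0 - 0)) + 1)%C by ring. rewrite e. ring.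
Qed.

Lemma E1_neq0 (z : C) : strip z -> E1 z <> RtoC 0.
Proof.
  move=> hs h. case: (classic (z = RtoC 0)) => hz.
    move: h. rewrite hz E1_0 => /(f_equal fst) /=. lra.
  apply: hz. apply: cexp_eq1 => //. have := E1_eq z. rewrite h => e.
  replace (cexp z) with (cexp z - 1 + 1)%C by ring. rewrite -e. ring.
Qed.

(* kf a z = (e^(a z) - 1)/(e^z - 1), extended continuously by a at z = 0, and its derivative kf'. *)
Definition kf (a z : C) : C := (a * E1 (a * z) / E1 z)%C.
Definition kf' (a z : C) : C := ((a * a * E2 (a * z) - kf a z * E2 z) / E1 z)%C.

Lemma kf_eq (a z : C) : strip z -> z <> RtoC 0 ->
  kf a z = ((cexp (a * z) - 1) / (cexp z - 1))%C.
Proof.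
  move=> hs hz. rewrite -!E1_eq /kf. field. split; first exact: E1_neq0. exact: hz.
Qed.

(** [E1] has a positive minimum c on the segment from 0 to z, so the quotient rule for a E1(a z)
    over E1(z) has a remainder bounded uniformly in t. *)
Lemma kf_segment (a z : C) : strip z -> exists B d, 0 <= B /\ 0 < d /\
  forall t w, 0 <= t <= 1 -> Cmod (w - z) < d ->
    Cmod (kf' a (RtoC t * z)) <= B /\
    Cmod (kf a (RtoC t * w) - kf a (RtoC t * z) - kf' a (RtoC t * z) * (RtoC t * (w - z))) <= B * Cmod (w - z) ^ 2.
Proof.
  move=> hs.
  have [BN [dN [BN0 [dNp hN]]]] := quad_bounded_dilate E1 E2 a E1_quad (Cmod z).
  have [BD [dD [BD0 [dDp hD]]]] := E1_quad (Cmod z).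
  pose B := Rmax 1 (Rmax BN BD).
  have B1 : 1 <= B by exact: Rmax_l.
  have BNB : BN <= B := Rle_trans _ _ _ (Rmax_l BN BD) (Rmax_r 1 _).
  have BDB : BD <= B := Rle_trans _ _ _ (Rmax_r BN BD) (Rmax_r 1 _).
  have [t0 [mt0 ht0]] : exists t0, (forall t, 0 <= t <= 1 -> Cmod (E1 (RtoC t0 * z)) <= Cmod (E1 (RtoC t * z))) /\ 0 <= t0 <= 1.
    have [|t0 [h1 h2]] := continuity_ab_min (fun t => Cmod (E1 (RtoC t * z))) 0 1 ltac:(lra).
      move=> t _. apply/continuity_pt_filterlim. apply: (Ccont_Cmod (fun u => E1 (RtoC u * z))).
      apply: (Ccont_comp E1 (fun u => RtoC u * z)%C).
        exact: (quad_bounded_cderiv E1 E2 _ E1_quad).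
      exact: rderiv_Ccont (rderiv_line z t).
    by exists t0.
  pose c := Cmod (E1 (RtoC t0 * z)).
  have cp : 0 < c by apply/Cmod_gt_0; apply: E1_neq0; exact: strip_scale.
  have hc : forall t, 0 <= t <= 1 -> c <= Cmod (E1 (RtoC t * z)) by exact: mt0.
  (* The bound c / (4 B) keeps the denominator at t w at least c / 2 in modulus. *)
  pose d := Rmin 1 (Rmin (Rmin dN dD) (c / (4 * B))).
  have dp : 0 < d by repeat apply: Rmin_pos => //; try lra; apply: Rdiv_lt_0_compat; lra.
  have d1 : d <= 1 by exact: Rmin_l.
  have ddN : d <= dN by apply: Rle_trans; [exact: Rmin_r | apply: Rle_trans; [exact: Rmin_l | exact: Rmin_l]].
  have ddD : d <= dD by apply: Rle_trans; [exact: Rmin_r | apply: Rle_trans; [exact: Rmin_l | exact: Rmin_r]].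
  have dc : d <= c / (4 * B) by apply: Rle_trans; [exact: Rmin_r | exact: Rmin_r].
  (* P bounds N' - k D', the numerator in the derivative of the quotient k = N/D, as |k| <= B /
     c. *)
  pose P := (B + B / c * B).
  have Bc : 0 < B / c by apply: Rdiv_lt_0_compat; lra.
  have Pp : 0 < P by rewrite /P; nra.
  exists (P / c + P * (2 / c) + P * (2 * B) * (2 / (c * c))), d.
  have ic : 0 < / c by exact: Rinv_0_lt_compat.
  have t1 : 0 <= P / c by apply: Rlt_le; apply: Rdiv_lt_0_compat.
  have t2 : 0 <= P * (2 / c) by apply: Rmult_le_pos; [lra | apply: Rlt_le; apply: Rdiv_lt_0_compat; lra].
  have t3 : 0 <= P * (2 * B) * (2 / (c * c)).
    apply: Rmult_le_pos; first nra. apply: Rlt_le; apply: Rdiv_lt_0_compat; nra.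
  split; first lra. split=> // t w ht hw.
  set h := (w - z)%C in hw *. have h0 := Cmod_ge_0 h.
  set z1 := (RtoC t * z)%C. set w1 := (RtoC t * w)%C. set h1 := (RtoC t * h)%C.
  have eh : (w1 - z1)%C = h1 by rewrite /w1 /z1 /h1 /h; ring.
  have mh : Cmod h1 <= Cmod h by rewrite /h1 Cmod_mult Cmod_R Rabs_pos_eq; nra.
  have mh0 := Cmod_ge_0 h1.
  have mz : Cmod z1 <= Cmod z by rewrite /z1 Cmod_mult Cmod_R Rabs_pos_eq; have := Cmod_ge_0 z; nra.
  have [n1 [n2 n3]] := hN z1 w1 mz ltac:(rewrite eh; lra).
  have [e1 [e2 e3]] := hD z1 w1 mz ltac:(rewrite eh; lra).
  rewrite eh in n3 e3.
  move: n1 n2 n3 e1 e2 e3.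
  rewrite /kf' /kf.
  set N := (a * E1 (a * z1))%C. set N' := (a * a * E2 (a * z1))%C. set Nw := (a * E1 (a * w1))%C.
  set D := E1 z1. set D' := E2 z1. set Dw := E1 w1.
  move=> n1 n2 n3 e1 e2 e3.
  have cD : c <= Cmod D by exact: hc.
  have q2 : Cmod h1 ^ 2 <= Cmod h ^ 2 by nra.
  have rN : Cmod (Nw - N - N' * h1) <= B * Cmod h ^ 2.
    apply: Rle_trans; first exact: n3. have := pow2_ge_0 (Cmod h1). nra.
  have rD : Cmod (Dw - D - D' * h1) <= B * Cmod h ^ 2.
    apply: Rle_trans; first exact: e3. have := pow2_ge_0 (Cmod h1). nra.
  have incD : Cmod (Dw - D) <= 2 * B * Cmod h.
    have := Cmod_triangle (Dw - D - D' * h1) (D' * h1). rewrite Cmod_mult.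
    have -> : (Dw - D - D' * h1 + D' * h1)%C = (Dw - D)%C by ring.
    have : Cmod D' * Cmod h1 <= B * Cmod h by apply: Rmult_le_compat => //; [exact: Cmod_ge_0 | lra].
    have : Cmod h ^ 2 <= Cmod h by nra. nra.
  have cDw : c / 2 <= Cmod Dw.
    have := Cmod_triangle Dw (- (Dw - D)). rewrite Cmod_opp.
    have -> : (Dw + - (Dw - D))%C = D by ring.
    have : 2 * B * Cmod h <= c / 2.
      have := Rmult_le_compat_l (2 * B) _ _ ltac:(lra) (Rle_trans _ _ _ (Rlt_le _ _ hw) dc).
      by replace (2 * B * (c / (4 * B))) with (c / 2) by (field; lra).
    lra.
  have D0 : D <> RtoC 0 by apply/Cmod_gt_0; lra.
  have Dw0 : Dw <> RtoC 0 by apply/Cmod_gt_0; lra.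
  set k := (N / D)%C.
  have kb : Cmod k <= B / c.
    rewrite /k Cmod_div // /Rdiv. apply: Rmult_le_compat; [exact: Cmod_ge_0 | | lra |].
      apply: Rlt_le. apply: Rinv_0_lt_compat. lra.
    exact: Rinv_le_contravar.
  have Pb : forall x y m, 0 <= m -> Cmod x <= B * m -> Cmod y <= B * m -> Cmod (x - k * y) <= P * m.
    move=> x y m m0 hx hy. apply: Rle_trans; first exact: Cmod_triangle. rewrite Cmod_opp Cmod_mult.
    have := Rmult_le_compat _ _ _ _ (Cmod_ge_0 k) (Cmod_ge_0 y) kb hy. rewrite /P. lra.
  have P1 : Cmod (N' - k * D') <= P.
    rewrite -(Rmult_1_r P). apply: Pb; lra.
  have iD : / Cmod D <= / c by exact: Rinv_le_contravar.
  have iDw : / Cmod Dw <= 2 / c.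
    replace (2 / c) with (/ (c / 2)) by (field; lra). apply: Rinv_le_contravar; lra.
  have iD0 : 0 < / Cmod D by apply: Rinv_0_lt_compat; lra.
  have iDw0 : 0 < / Cmod Dw by apply: Rinv_0_lt_compat; lra.
  split.
    rewrite Cmod_div // /Rdiv.
    apply: Rle_trans (_ : P * / c <= _); last by rewrite /Rdiv in t1 t2 t3 *; lra.
    apply: Rmult_le_compat => //; [exact: Cmod_ge_0 | lra].
  have -> : (Nw / Dw - k - (N' - k * D') / D * h1)%C =
     (((Nw - N - N' * h1) - k * (Dw - D - D' * h1)) / Dw - (N' - k * D') * h1 * (Dw - D) / (D * Dw))%C.
    rewrite /k. field. by split.
  apply: Rle_trans; first exact: Cmod_triangle. rewrite Cmod_opp.
  have T1 : Cmod ((Nw - N - N' * h1 - k * (Dw - D - D' * h1)) / Dw) <= P * (2 / c) * Cmod h ^ 2.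
    rewrite Cmod_div // /Rdiv.
    have := Pb _ _ _ (pow2_ge_0 (Cmod h)) rN rD => hp.
    apply: Rle_trans (_ : (P * Cmod h ^ 2) * (2 / c) <= _); last by rewrite /Rdiv; right; ring.
    apply: Rmult_le_compat => //; [exact: Cmod_ge_0 | lra].
  have T2 : Cmod ((N' - k * D') * h1 * (Dw - D) / (D * Dw)) <= P * (2 * B) * (2 / (c * c)) * Cmod h ^ 2.
    rewrite Cmod_div; last exact: Cmult_neq_0.
    rewrite (Cmod_mult (_ * h1)) (Cmod_mult (N' - k * D') h1) (Cmod_mult D) /Rdiv Rinv_mult.
    apply: Rle_trans (_ : (P * Cmod h * (2 * B * Cmod h)) * (/ c * (2 / c)) <= _); last by right; field; lra.
    apply: Rmult_le_compat.
    - repeat apply: Rmult_le_pos; exact: Cmod_ge_0.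
    - apply: Rmult_le_pos; lra.
    - apply: Rmult_le_compat.
      + by apply: Rmult_le_pos; exact: Cmod_ge_0.
      + exact: Cmod_ge_0.
      + by apply: Rmult_le_compat; [exact: Cmod_ge_0 | exact: Cmod_ge_0 | |].
      + done.
    - apply: Rmult_le_compat => //; lra.
  have := pow2_ge_0 (Cmod h). nra.
Qed.

Lemma cderiv_kf (a z : C) : strip z -> cderiv (kf a) z (kf' a z).
Proof.
  move=> hs. have [B [d [B0 [dp h]]]] := kf_segment a z hs.
  apply: (cderiv_quadratic _ _ _ B d) => // w hw.
  have [_] := h 1 w ltac:(lra) hw.
  have -> : (RtoC 1 * w)%C = w by ring. have -> : (RtoC 1 * z)%C = z by ring. by have -> : (RtoC 1 * (w - z))%C = (w - z)%C by ring.
Qed.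

(** Extends curves given on [0, 1] to the whole line, as [prim_rderiv] and [local_to_global] need
    their hypotheses at every real. *)
Definition clamp (t : R) : R := Rmax 0 (Rmin 1 t).

Lemma clamp_range (t : R) : 0 <= clamp t <= 1.
Proof.
  rewrite /clamp. split; first exact: Rmax_l. apply: Rmax_lub; [lra | exact: Rmin_l].
Qed.

Lemma clamp_id (t : R) : 0 <= t <= 1 -> clamp t = t.
Proof. move=> h. rewrite /clamp Rmin_right ?Rmax_right; lra. Qed.

Lemma clamp_continuous (t : R) : continuous clamp t.
Proof.
  apply/continuous_eps => eps he. exists eps. split=> // u hu. apply: Rle_lt_trans hu.
  rewrite /clamp /Rmax /Rmin /Rabs. repeat case: Rle_dec; repeat case: Rcase_abs; lra.
Qed.

(* Kf a z is the integral of kf a along the segment from 0 to z. *)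
Definition Kprim (a z : C) (t : R) : C := (z * prim (fun u => kf a (RtoC (clamp u) * z)) t)%C.
Definition Kf (a z : C) : C := Kprim a z 1.

Lemma Kprim_rderiv (a z : C) (t : R) : strip z -> 0 <= t <= 1 ->
  rderiv (Kprim a z) t (z * kf a (RtoC t * z))%C.
Proof.
  move=> hs ht. rewrite -{2}(clamp_id t ht).
  apply: rderiv_scal. apply: (prim_rderiv (fun u => kf a (RtoC (clamp u) * z))) => u.
  apply: (Ccont_comp (kf a) (fun u => RtoC (clamp u) * z)%C).
    apply: cderiv_kf. apply: strip_scale => //. exact: clamp_range.
  apply: Ccont_mult; first by apply: Ccont_RtoC; exact: clamp_continuous.
  exact: rderiv_Ccont (rderiv_const z u).
Qed.

(** The strip is star-shaped about 0. The remainder is the value at t = 1 of a curve that vanishes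
    at t = 0 and, with h = w - z, has derivative w (kf(tw) - kf(tz) - kf'(tz) t h) + t h^2 kf'(tz),
    quadratically small by [kf_segment]. *)
Lemma cderiv_Kf (a z : C) : strip z -> cderiv (Kf a) z (kf a z).
Proof.
  move=> hs. have [B [d [B0 [dp h]]]] := kf_segment a z hs.
  pose d2 := Rmin 1 (Rmin d (2 * PI - Rabs (Im z))).
  have d2p : 0 < d2 by rewrite /d2; rewrite /strip in hs; repeat apply: Rmin_pos; lra.
  have z0 := Cmod_ge_0 z.
  apply: (cderiv_quadratic _ _ _ ((Cmod z + 2) * B) d2) => //; first nra.
  move=> w hw. set hh := (w - z)%C in hw *.
  have hw1 : Cmod hh < 1 := Rlt_le_trans _ _ _ hw (Rmin_l _ _).
  have hw' := Rlt_le_trans _ _ _ hw (Rmin_r _ _).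
  have hwd : Cmod hh < d := Rlt_le_trans _ _ _ hw' (Rmin_l _ _).
  have sw : strip w.
    rewrite /strip. have := Rlt_le_trans _ _ _ hw' (Rmin_r _ _). have := im_le_Cmod hh.
    have := Rabs_triang (Im hh) (Im z). have -> : Im hh + Im z = Im w by rewrite /hh /Im /=; ring. lra.
  have := curve_bound (fun t => Kprim a w t - Kprim a z t - RtoC t * kf a (RtoC t * z) * hh)%C
    (fun t => w * kf a (RtoC t * w) - z * kf a (RtoC t * z) -
      (kf a (RtoC t * z) + RtoC t * (kf' a (RtoC t * z) * z)) * hh)%C ((Cmod z + 2) * B * Cmod hh ^ 2).
  rewrite -/(Kf a w) -/(Kf a z).
  have -> : (Kf a w - Kf a z - RtoC 1 * kf a (RtoC 1 * z) * hh - (Kprim a w 0 - Kprim a z 0 - RtoC 0 * kf a (RtoC 0 * z) * hh))%C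
    = (Kf a w - Kf a z - kf a z * hh)%C.
    rewrite /Kprim !prim_0. have -> : (RtoC 1 * z)%C = z by ring. ring.
  apply.
  - move=> t ht. apply: rderiv_minus; first by apply: rderiv_minus; exact: Kprim_rderiv.
    have k1 := rderiv_mult _ _ _ _ _ (rderiv_RtoC t)
       (cderiv_rderiv (kf a) (fun u => RtoC u * z)%C t _ _ (cderiv_kf a _ (strip_scale z t ht hs)) (rderiv_line z t)).
    have k2 := rderiv_mult _ _ _ _ _ k1 (rderiv_const hh t).
    move: k2.
    by have -> : ((RtoC 1 * kf a (RtoC t * z) + RtoC t * (kf' a (RtoC t * z) * z)) * hh + RtoC t * kf a (RtoC t * z) * RtoC 0)%C
      = ((kf a (RtoC t * z) + RtoC t * (kf' a (RtoC t * z) * z)) * hh)%C by ring.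
  - move=> t ht. have [k1 k2] := h t w ht hwd. rewrite -/hh in k2.
    have -> : (w * kf a (RtoC t * w) - z * kf a (RtoC t * z) -
      (kf a (RtoC t * z) + RtoC t * (kf' a (RtoC t * z) * z)) * hh)%C =
      (w * (kf a (RtoC t * w) - kf a (RtoC t * z) - kf' a (RtoC t * z) * (RtoC t * hh)) + RtoC t * (hh * hh) * kf' a (RtoC t * z))%C.
      rewrite /hh. ring.
    apply: Rle_trans; first exact: Cmod_triangle.
    rewrite (Cmod_mult w) (Cmod_mult (RtoC t * (hh * hh))) (Cmod_mult (RtoC t)) (Cmod_mult hh) Cmod_R Rabs_pos_eq; last lra.
    have mw : Cmod w <= Cmod z + 1.
      have := Cmod_triangle hh z. have -> : (hh + z)%C = w by rewrite /hh; ring. lra.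
    have hh0 := Cmod_ge_0 hh.
    have s1 := Rmult_le_compat _ _ _ _ (Cmod_ge_0 w) (Cmod_ge_0 _) mw k2.
    have s2 : t * (Cmod hh * Cmod hh) * Cmod (kf' a (RtoC t * z)) <= Cmod hh ^ 2 * B.
      apply: Rmult_le_compat => //; try exact: Cmod_ge_0; nra.
    lra.
Qed.

(** In the strip Re (a z) <= 2 pi |Im a|, so the numerator stays bounded, while e^(Re z) >= 2 gives
    |e^z - 1| >= e^(Re z)/2. *)
Lemma kf_decay (a z : C) : Re a <= -1 -> strip z -> 1 <= Re z ->
  Cmod (kf a z) <= (exp (2 * PI * Rabs (Im a)) + 1) * 2 * exp (- Re z).
Proof.
  move=> ha hs hz.
  have z0 : z <> RtoC 0 by move=> e; move: hz; rewrite e /=; lra.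
  rewrite kf_eq //.
  have ez : 2 <= exp (Re z) by have := exp_ineq1_le (Re z); lra.
  have ep := exp_pos (- Re z).
  have ee : exp (- Re z) * exp (Re z) = 1 by rewrite -exp_plus Rplus_opp_l exp_0.
  have lo : exp (Re z) / 2 <= Cmod (cexp z - 1).
    have := Cmod_triangle (cexp z - 1) 1. rewrite Cmod_1.
    have -> : (cexp z - 1 + 1)%C = cexp z by ring. rewrite Cmod_cexp. lra.
  have d0 : (cexp z - 1)%C <> RtoC 0 by apply/Cmod_gt_0; lra.
  rewrite Cmod_div //.
  have up : Cmod (cexp (a * z) - 1) <= exp (2 * PI * Rabs (Im a)) + 1.
    apply: Rle_trans; first exact: Cmod_triangle. rewrite Cmod_opp Cmod_1 Cmod_cexp.
    have : Re (a * z)%C <= 2 * PI * Rabs (Im a).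
      have -> : Re (a * z)%C = Re a * Re z - Im a * Im z by [].
      have := Rle_abs (- (Im a * Im z)). rewrite Rabs_Ropp Rabs_mult. rewrite /strip in hs.
      have := Rabs_pos (Im a). nra.
    case=> h; [have := exp_increasing _ _ h; lra | rewrite h; lra].
  have e1 := exp_pos (2 * PI * Rabs (Im a)).
  rewrite /Rdiv Rmult_assoc. apply: Rmult_le_compat => //.
  - exact: Cmod_ge_0.
  - apply: Rlt_le. apply: Rinv_0_lt_compat. lra.
  - apply: (Rmult_le_reg_r (Cmod (cexp z - 1))); first lra.
    rewrite Rinv_l; last lra.
    have := Rmult_le_compat_l (2 * exp (- Re z)) _ _ ltac:(lra) lo.
    replace (2 * exp (- Re z) * (exp (Re z) / 2)) with (exp (- Re z) * exp (Re z)) by field. lra.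
Qed.

(** [kf] is integrated along the straight segment, whose length is at most D + 4 pi: D times the
    decaying exponential integrates to at most its value at the left end, and 4 pi covers the
    vertical displacement. So far to the right Kf hardly depends on the imaginary part, as both ends
    of the contour require. *)
Lemma Kf_decay (a : C) : Re a <= -1 -> exists M, 0 < M /\ forall z w, strip z -> strip w ->
  1 <= Re z <= Re w -> Cmod (Kf a w - Kf a z) <= M * exp (- Re z).
Proof.
  move=> ha. have hp := PI_RGT_0.
  pose M0 := (exp (2 * PI * Rabs (Im a)) + 1) * 2.
  have M0p : 0 < M0 by rewrite /M0; have := exp_pos (2 * PI * Rabs (Im a)); lra.
  exists (M0 * (1 + 4 * PI)). split; first by apply: Rmult_lt_0_compat; lra.
  move=> z w sz sw hzw. set D := Re w - Re z.
  pose L := fun u : R => (z + RtoC u * (w - z))%C.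
  have reL : forall u, Re (L u) = Re z + u * D by move=> u; rewrite /L /D /Re /=; ring.
  have sL : forall u, 0 <= u <= 1 -> strip (L u).
    move=> u hu. rewrite /strip. have -> : Im (L u) = (1 - u) * Im z + u * Im w by rewrite /L /Im /=; ring.
    have := Rabs_triang ((1 - u) * Im z) (u * Im w). rewrite !Rabs_mult (Rabs_pos_eq u) ?(Rabs_pos_eq (1 - u)); try lra.
    rewrite /strip in sz sw. case: (Rle_dec u (1 / 2)) => hu2 tr.
      have := Rmult_lt_0_compat (1 - u) (2 * PI - Rabs (Im z)) ltac:(lra) ltac:(lra). nra.
    have := Rmult_lt_0_compat u (2 * PI - Rabs (Im w)) ltac:(lra) ltac:(lra). nra.
  have dL : forall u, rderiv L u (w - z)%C.
    move=> u. have := rderiv_plus _ _ _ _ _ (rderiv_const z u) (rderiv_line (w - z) u).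
    by have -> : (RtoC 0 + (w - z))%C = (w - z)%C by ring.
  have wz : Cmod (w - z) <= D + 4 * PI.
    apply: Rle_trans; first exact: Cmod_le_sum.
    have -> : Re (w - z)%C = D by []. have -> : Im (w - z)%C = Im w - Im z by [].
    rewrite Rabs_pos_eq; last by rewrite /D; lra.
    have := Rabs_triang (Im w) (- Im z). rewrite Rabs_Ropp. rewrite /strip in sz sw.
    rewrite -/(Rminus (Im w) (Im z)). lra.
  have := mean_value_ineq (fun u => Kf a (L u)) (fun u => kf a (L u) * (w - z))%C
    (fun u => M0 * (- exp (- (Re z + u * D)) + 4 * PI * exp (- Re z) * u))
    (fun u => M0 * (D * exp (- (Re z + u * D)) + 4 * PI * exp (- Re z))) 0 1 ltac:(lra).
  have -> : L 1 = w by rewrite /L; ring. have -> : L 0 = z by rewrite /L; ring.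
  move=> h. apply: Rle_trans (h _ _ _) _.
  - move=> u hu. apply: cderiv_rderiv => //. apply: cderiv_Kf. exact: sL.
  - move=> u hu. auto_derive; first done. ring.
  - move=> u hu. rewrite Cmod_mult.
    have D0 : 0 <= D by rewrite /D; lra.
    have k := kf_decay a (L u) ha (sL u hu) ltac:(rewrite reL; nra).
    rewrite reL -/M0 in k.
    have ex := exp_pos (- (Re z + u * D)).
    apply: Rle_trans; first exact: (Rmult_le_compat _ _ _ _ (Cmod_ge_0 _) (Cmod_ge_0 _) k wz).
    have mono : exp (- (Re z + u * D)) <= exp (- Re z).
      case: (Req_dec (u * D) 0) => e; first by rewrite e Rplus_0_r; exact: Rle_refl.
      apply: Rlt_le. apply: exp_increasing. nra.
    rewrite Rmult_assoc. apply: Rmult_le_compat_l; first lra. nra.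
  - rewrite !Rmult_0_l !Rmult_0_r !Rmult_1_r Rmult_1_l !Rplus_0_r.
    have := exp_pos (- (Re z + D)). have := exp_pos (- Re z). nra.
Qed.

(** * Contours and their logarithmic integrals *)

(* The part of [encircling_contour] that does not mention the spectrum. *)
Record tame_contour (g : R -> C) : Prop := {
  tc_cont : forall t, Ccont g t;
  tc_Re : piecewise_C1 (fun t => Re (g t));
  tc_Im : piecewise_C1 (fun t => Im (g t));
  tc_in : exists (a : R) (u : C), 0 < Re u /\ forall t, t <= a ->
    g t = (g a + RtoC (a - t) * u)%C /\ 0 < Im (g t);
  tc_out : exists (b : R) (v : C), 0 < Re v /\ forall t, b <= t ->
    g t = (g b + RtoC (t - b) * v)%C /\ Im (g t) < 0 }.

Lemma continuous_bounded (f : R -> R) : (forall t, continuous f t) ->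
  forall a b, exists M, forall t, a <= t <= b -> Rabs (f t) <= M.
Proof. move=> h. apply: regulated_bounded. exact: regulated_continuous. Qed.

Lemma tame_growth (g : R -> C) : tame_contour g ->
  exists al be, 0 < al /\ 0 <= be /\ forall t, al * Rabs t - be <= Re (g t).
Proof.
  move=> h. have [a [u [up hu]]] := tc_in _ h. have [b [v [vp hv]]] := tc_out _ h.
  have [M hM] := continuous_bounded (fun t => Re (g t)) (fun t => proj1 (tc_cont _ h t)) a b.
  pose al := Rmin (Re u) (Re v). have alp : 0 < al by exact: Rmin_pos.
  have al1 : al <= Re u by exact: Rmin_l. have al2 : al <= Re v by exact: Rmin_r.
  exists al, (Rabs (Re (g a)) + Rabs (Re (g b)) + Rabs M + al * (Rabs a + Rabs b)).
  have ra := Rabs_pos a. have rb := Rabs_pos b. have rM := Rabs_pos M.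
  have ga := Rabs_pos (Re (g a)). have gb := Rabs_pos (Re (g b)).
  split=> //. split; first nra. move=> t.
  case: (Rle_dec t a) => ta.
    have [-> _] := hu t ta.
    have -> : Re (g a + RtoC (a - t) * u)%C = Re (g a) + (a - t) * Re u by rewrite /Re /=; ring.
    have h1 : Rabs t <= Rabs a + (a - t).
      have := Rabs_triang a (t - a). replace (a + (t - a)) with t by ring. rewrite (Rabs_left1 (t - a)); lra.
    have := Rle_abs (- Re (g a)). rewrite Rabs_Ropp. nra.
  case: (Rle_dec b t) => tb.
    have [-> _] := hv t tb.
    have -> : Re (g b + RtoC (t - b) * v)%C = Re (g b) + (t - b) * Re v by rewrite /Re /=; ring.
    have h1 : Rabs t <= Rabs b + (t - b).
      have := Rabs_triang b (t - b). replace (b + (t - b)) with t by ring. rewrite (Rabs_pos_eq (t - b)); lra.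
    have := Rle_abs (- Re (g b)). rewrite Rabs_Ropp. nra.
  have := hM t ltac:(lra). have := Rle_abs (- Re (g t)). rewrite Rabs_Ropp. have := Rle_abs M.
  have h1 : Rabs t <= Rabs a + Rabs b by move: ta tb; rewrite /Rabs; repeat case: Rcase_abs; lra.
  have : al * Rabs t <= al * (Rabs a + Rabs b) by apply: Rmult_le_compat_l; lra.
  lra.
Qed.

Lemma tame_escape (g : R -> C) (r : R) : tame_contour g ->
  exists T, 0 < T /\ forall t, T <= Rabs t -> r <= Re (g t).
Proof.
  move=> h. have [al [be [alp [be0 hg]]]] := tame_growth g h.
  exists ((Rabs r + be + 1) / al). split.
    apply: Rdiv_lt_0_compat => //. have := Rabs_pos r. lra.
  move=> t ht. have := Rmult_le_compat_l al _ _ ltac:(lra) ht.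
  replace (al * ((Rabs r + be + 1) / al)) with (Rabs r + be + 1) by (field; lra).
  have := hg t. have := Rle_abs r. lra.
Qed.

Lemma tame_dist (g : R -> C) (q : C) : tame_contour g -> (forall t, g t <> q) ->
  exists d, 0 < d /\ forall t, d <= Cmod (g t - q).
Proof.
  move=> h hq. have [T [Tp hT]] := tame_escape g (Re q + 1) h.
  have cq : forall t, Ccont (fun u => g u - q)%C t.
    move=> t. have [c1 c2] := tc_cont _ h t.
    split; apply: (continuous_minus (V := R_NormedModule)) => //; exact: continuous_const.
  have [|t0 [m1 m2]] := continuity_ab_min (fun t => Cmod (g t - q)) (- T) T ltac:(lra).
    move=> t _. apply/continuity_pt_filterlim. exact: (Ccont_Cmod (fun u => g u - q)%C).
  have p : 0 < Cmod (g t0 - q).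
    apply/Cmod_gt_0 => e. apply: (hq t0). replace (g t0) with (g t0 - q + q)%C by ring. rewrite e. ring.
  exists (Rmin 1 (Cmod (g t0 - q))). split; first by apply: Rmin_pos; lra.
  move=> t. case: (Rle_dec T (Rabs t)) => ht.
    apply: Rle_trans; first exact: Rmin_l. have := hT t ht. have := Rle_trans _ _ _ (Rle_abs _) (re_le_Cmod (g t - q)).
    have -> : Re (g t - q)%C = Re (g t) - Re q by []. lra.
  apply: Rle_trans; first exact: Rmin_r. apply: m1.
  move: ht. rewrite /Rabs. case: Rcase_abs; lra.
Qed.

Lemma tame_derive (g : R -> C) (t : R) : tame_contour g ->
  locally' t (fun u => rderiv g u (path_derive g u)).
Proof.
  move=> h. have [_ h1] := piecewise_regulated _ (tc_Re _ h). have [_ h2] := piecewise_regulated _ (tc_Im _ h).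
  apply: filter_imp (filter_and _ _ (h1 t) (h2 t)) => u [k1 k2].
  apply/rderiv_components. split; exact: Derive_correct.
Qed.

Lemma affine_derive (f : R -> R) (c k a t : R) (P : R -> Prop) : locally t P ->
  (forall u, P u -> f u = c + (u - a) * k) -> Derive f t = k.
Proof.
  move=> hP hf. apply: is_derive_unique.
  apply: (is_derive_ext_loc (fun u => c + (u - a) * k)).
    apply: filter_imp hP => u hu. by rewrite hf.
  auto_derive; [done | ring].
Qed.

Lemma tame_derive_bounded (g : R -> C) : tame_contour g ->
  exists M, 0 < M /\ forall t, Cmod (path_derive g t) <= M.
Proof.
  move=> h. have [a [u [up hu]]] := tc_in _ h. have [b [v [vp hv]]] := tc_out _ h.
  have [r1 _] := piecewise_regulated _ (tc_Re _ h). have [r2 _] := piecewise_regulated _ (tc_Im _ h).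
  have [M1 hM1] := regulated_bounded _ r1 a b. have [M2 hM2] := regulated_bounded _ r2 a b.
  exists (Rabs M1 + Rabs M2 + Cmod u + Cmod v + 1).
  have := Rabs_pos M1. have := Rabs_pos M2. have := Cmod_ge_0 u. have := Cmod_ge_0 v => v0 u0 m2 m1.
  split; first lra. move=> t.
  case: (Rlt_dec t a) => ta.
    have lo : locally t (fun x => x < a) by exact: open_lt.
    have -> : path_derive g t = (- u)%C.
      apply: C_eq.
      - apply: (affine_derive _ (Re (g a)) _ a t _ lo) => x hx. have [e _] := hu x ltac:(lra). rewrite e /Re /=. ring.
      - apply: (affine_derive _ (Im (g a)) _ a t _ lo) => x hx. have [e _] := hu x ltac:(lra). rewrite e /Im /=. ring.
    rewrite Cmod_opp. lra.
  case: (Rlt_dec b t) => tb.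
    have lo : locally t (fun x => b < x) by exact: open_gt.
    have -> : path_derive g t = v.
      apply: C_eq.
      - apply: (affine_derive _ (Re (g b)) _ b t _ lo) => x hx. have [e _] := hv x ltac:(lra). rewrite e /Re /=. ring.
      - apply: (affine_derive _ (Im (g b)) _ b t _ lo) => x hx. have [e _] := hv x ltac:(lra). rewrite e /Im /=. ring.
    lra.
  apply: Rle_trans; first exact: Cmod_le_sum.
  have := hM1 t ltac:(lra). have := hM2 t ltac:(lra). have := Rle_abs M1. have := Rle_abs M2.
  rewrite /path_derive /=. lra.
Qed.

Lemma is_RInt_pair (f : R -> C) (a b : R) (l : C) :
  is_RInt (fun t => Re (f t)) a b (Re l) -> is_RInt (fun t => Im (f t)) a b (Im l) ->
  Cis_RInt f a b l.
Proof.
  move=> h1 h2. rewrite [l]surjective_pairing.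
  exact: (is_RInt_fct_extend_pair (U := R_NormedModule) (V := R_NormedModule)).
Qed.

Lemma contour_FTC (g : R -> C) (f P : C -> C) : tame_contour g ->
  (forall t, cderiv P (g t) (f (g t))) -> (forall t, Ccont (fun u => f (g u)) t) ->
  forall a b, Cis_RInt (fun t => f (g t) * path_derive g t)%C a b (P (g b) - P (g a))%C.
Proof.
  move=> h hP hf a b.
  have cP : forall t, Ccont (fun u => P (g u)) t by move=> t; apply: (Ccont_comp P g t (f (g t))) => //; exact: (tc_cont _ h).
  have dP : forall t, locally' t (fun u => rderiv (fun x => P (g x)) u (f (g u) * path_derive g u)%C).
    move=> t. apply: filter_imp (tame_derive g t h) => u hu. exact: cderiv_rderiv.
  have [r1 _] := piecewise_regulated _ (tc_Re _ h). have [r2 _] := piecewise_regulated _ (tc_Im _ h).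
  have f1 : regulated (fun t => Re (f (g t))) by apply: regulated_continuous => t; apply (hf t).
  have f2 : regulated (fun t => Im (f (g t))) by apply: regulated_continuous => t; apply (hf t).
  have ng : forall k, regulated k -> regulated (fun t => -1 * k t).
    move=> k hk. apply: (regulated_mult (fun _ => -1)) => //. apply: regulated_continuous => t. exact: continuous_const.
  apply: is_RInt_pair.
  - apply: (FTC_regulated (fun t => Re (P (g t))) (fun t => Re (f (g t) * path_derive g t)%C)).
    + move=> t. apply (cP t).
    + have := regulated_plus _ _ (regulated_mult _ _ f1 r1) (ng _ (regulated_mult _ _ f2 r2)).
      move=> k. have -> : (fun t => Re (f (g t) * path_derive g t)%C) = (fun t =>
         Re (f (g t)) * Derive (fun u => Re (g u)) t + -1 * (Im (f (g t)) * Derive (fun u => Im (g u)) t)); last exact: k.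
      apply: functional_extensionality => t. rewrite /path_derive /Re /Im /=. ring.
    + move=> t. apply: filter_imp (dP t) => u /rderiv_components [h1 _]. exact: h1.
  - apply: (FTC_regulated (fun t => Im (P (g t))) (fun t => Im (f (g t) * path_derive g t)%C)).
    + move=> t. apply (cP t).
    + have := regulated_plus _ _ (regulated_mult _ _ f1 r2) (regulated_mult _ _ f2 r1).
      done.
    + move=> t. apply: filter_imp (dP t) => u /rderiv_components [_ h1]. exact: h1.
Qed.

Lemma RInt_gen_intro (phi : R -> C) (J : R -> R -> C) (l : C) :
  (forall a b, Cis_RInt phi a b (J a b)) ->
  (forall eps, 0 < eps -> exists T, forall a b, a <= - T -> T <= b -> Cmod (J a b - l) < eps) ->
  Cis_RInt_gen phi l.
Proof.
  move=> hJ hl P [eps hP].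
  have [T hT] := hl eps (cond_pos eps).
  apply: (Filter_prod _ _ _ (fun a => a < - T) (fun b => T < b)).
  - by exists (- T).
  - by exists T.
  - move=> a b ha hb. exists (J a b). split; first exact: hJ.
    apply: hP. apply: C_NormedModule_mixin_compat1. apply: hT; lra.
Qed.

Lemma contour_primitive (g : R -> C) (f P : C -> C) (l : C) : tame_contour g ->
  (forall t, cderiv P (g t) (f (g t))) -> (forall t, Ccont (fun u => f (g u)) t) ->
  (forall eps, 0 < eps -> exists T, forall a b, a <= - T -> T <= b -> Cmod (P (g b) - P (g a) - l) < eps) ->
  Cis_RInt_gen (fun t => f (g t) * path_derive g t)%C l /\
  forall a b, Cex_RInt (fun t => f (g t) * path_derive g t)%C a b.
Proof.
  move=> h hP hf hl. have F := contour_FTC g f P h hP hf. split.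
    exact: RInt_gen_intro F hl.
  move=> a b. by exists (P (g b) - P (g a))%C.
Qed.

Lemma Ccont_minus (f g : R -> C) (t : R) : Ccont f t -> Ccont g t -> Ccont (fun u => f u - g u)%C t.
Proof. move=> [f1 f2] [g1 g2]. split; exact: (continuous_minus (V := R_NormedModule)). Qed.

Lemma Ccont_const (c : C) (t : R) : Ccont (fun _ => c) t.
Proof. split; exact: continuous_const. Qed.

Lemma Ccont_inv (f : R -> C) (t : R) : Ccont f t -> f t <> RtoC 0 -> Ccont (fun u => / f u)%C t.
Proof. move=> h h0. exact: (Ccont_comp (fun z => / z)%C f t _ (cderiv_inv _ h0) h). Qed.

(* The integral of dz/(z - p) - dz/(z - q) along g is l; the difference makes it converge at infinity. *)
Definition log_diff (g : R -> C) (p q l : C) : Prop :=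
  Cis_RInt_gen (fun t => (/ (g t - p) - / (g t - q)) * path_derive g t)%C l /\
  forall a b, Cex_RInt (fun t => (/ (g t - p) - / (g t - q)) * path_derive g t)%C a b.

Lemma Ccont_log_diff (g : R -> C) (p q : C) t : tame_contour g -> g t <> p -> g t <> q ->
  Ccont (fun u => / (g u - p) - / (g u - q))%C t.
Proof.
  have sub0 : forall x y : C, x <> y -> (x - y)%C <> RtoC 0.
    move=> x y hxy e. apply: hxy. replace x with (x - y + y)%C by ring. rewrite e. ring.
  move=> h hp hq. apply: Ccont_minus; apply: Ccont_inv; try exact: sub0;
  apply: Ccont_minus; try exact: Ccont_const; exact: (tc_cont _ h).
Qed.

Lemma clog_1 : clog PI (RtoC 1) = RtoC 0.
Proof.
  have hp := PI_RGT_0.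
  have -> : clog PI (RtoC 1) = (ln (Cmod 1), 0).
    rewrite /clog. congr pair. apply: carg_unique; first by move=> /(f_equal fst) /=; lra.
    split; first lra. rewrite cos_0 sin_0 Cmod_1. apply: C_eq => /=; ring.
  by rewrite Cmod_1 ln_1.
Qed.

(* (g - p)/(g - q) stays in the disc |w - 1| < 1 and tends to 1, so its principal logarithm is a primitive
   with equal limits at both ends. *)
Lemma log_diff_near (g : R -> C) (p q : C) (d : R) : tame_contour g ->
  (forall t, d <= Cmod (g t - q)) -> Cmod (p - q) < d -> log_diff g p q (RtoC 0).
Proof.
  move=> h hd hpq. have hp := PI_RGT_0.
  have pq0 := Cmod_ge_0 (p - q).
  have q0 : forall t, (g t - q)%C <> RtoC 0 by move=> t; apply/Cmod_gt_0; have := hd t; lra.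
  have p0 : forall t, (g t - p)%C <> RtoC 0.
    move=> t e. have := hd t. have e2 : g t = p by replace (g t) with (g t - p + p)%C by ring; rewrite e; ring.
    rewrite e2. lra.
  have neq : forall x y : C, (x - y)%C <> RtoC 0 -> x <> y by move=> x y hxy e; apply: hxy; rewrite e; ring.
  pose r := fun z => (1 + (q - p) * / (z - q))%C.
  have small : forall t, Cmod ((q - p) * / (g t - q))%C = Cmod (p - q) / Cmod (g t - q).
    move=> t. rewrite Cmod_mult Cmod_inv //. rewrite -(Cmod_opp (q - p)). congr (Cmod _ / _). ring.
  have rr : forall t, 0 < Re (r (g t)).
    move=> t. have -> : Re (r (g t)) = 1 + Re ((q - p) * / (g t - q))%C by [].
    have := re_le_Cmod ((q - p) * / (g t - q)). rewrite small.
    have : Cmod (p - q) / Cmod (g t - q) < 1.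
      have := hd t => hdt. apply: (Rmult_lt_reg_r (Cmod (g t - q))); first lra.
      rewrite /Rdiv Rmult_assoc Rinv_l; lra.
    have := Rle_abs (- Re ((q - p) * / (g t - q))%C). rewrite Rabs_Ropp. lra.
  have nc : forall t, ~ on_cut PI (r (g t)).
    move=> t [x [x0 e]]. have := rr t. rewrite e cos_PI sin_PI /Re /=. lra.
  apply: (contour_primitive g (fun z => / (z - p) - / (z - q))%C (fun z => clog PI (r z))) => //.
  - move=> t.
    have d1 : cderiv (fun z => z - q)%C (g t) (RtoC 1).
      apply: (cderiv_ext_val _ _ _ _ (cderiv_plus _ _ _ _ _ (cderiv_id _) (cderiv_const (- q) _))). ring.
    have d2 := cderiv_comp (fun z => / z)%C (fun z => z - q)%C _ _ _ (cderiv_inv _ (q0 t)) d1.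
    have d3 := cderiv_plus _ _ _ _ _ (cderiv_const 1 (g t)) (cderiv_scal (q - p) _ _ _ d2).
    have d4 := cderiv_comp (clog PI) r _ _ _ (cderiv_clog PI _ ltac:(lra) (nc t)) d3.
    apply: cderiv_ext_val d4 _. rewrite /r. field. by split.
  - move=> t. apply: Ccont_log_diff => //; exact: neq.
  - move=> eps he.
    have c1 : ~ on_cut PI (RtoC 1).
      move=> [x [x0 e]]. have := f_equal fst e. rewrite cos_PI sin_PI /=. lra.
    have [d1 [dp1 L]] := cderiv_Lipschitz _ _ _ (cderiv_clog PI 1 ltac:(lra) c1).
    have i1 : Cmod (/ 1) = 1.
      rewrite Cmod_inv; last by move=> /(f_equal fst) /=; lra. by rewrite Cmod_1 Rinv_1.
    rewrite clog_1 i1 in L.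
    pose m := Rmin d1 (eps / 4). have mp : 0 < m by apply: Rmin_pos; lra.
    have [T [Tp hT]] := tame_escape g (Re q + (Cmod (p - q) + 1) / m) h.
    have key : forall t, T <= Rabs t -> Cmod (clog PI (r (g t))) < eps / 2.
      move=> t ht. have k := hT t ht.
      have k2 : (Cmod (p - q) + 1) / m <= Cmod (g t - q).
        have := Rle_trans _ _ _ (Rle_abs _) (re_le_Cmod (g t - q)). have -> : Re (g t - q)%C = Re (g t) - Re q by []. lra.
      have k3 : Cmod (r (g t) - 1) < m.
        have -> : (r (g t) - 1)%C = ((q - p) * / (g t - q))%C by rewrite /r; ring.
        rewrite small. have gp : 0 < Cmod (g t - q) by apply/Cmod_gt_0.
        apply: (Rmult_lt_reg_r (Cmod (g t - q))) => //.
        rewrite /Rdiv Rmult_assoc Rinv_l; last lra.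
        have := Rmult_le_compat_l m _ _ ltac:(lra) k2.
        replace (m * ((Cmod (p - q) + 1) / m)) with (Cmod (p - q) + 1) by (field; lra). lra.
      have := L (r (g t)) (Rlt_le_trans _ _ _ k3 (Rmin_l _ _)).
      have -> : (clog PI (r (g t)) - 0)%C = clog PI (r (g t)) by ring.
      have := Rlt_le_trans _ _ _ k3 (Rmin_r _ _). lra.
    exists (T + 1) => a b ha hb.
    have k1 := key a ltac:(rewrite Rabs_left; lra). have k2 := key b ltac:(rewrite Rabs_pos_eq; lra).
    have -> : (clog PI (r (g b)) - clog PI (r (g a)) - 0)%C = (clog PI (r (g b)) + - clog PI (r (g a)))%C by ring.
    apply: Rle_lt_trans; first exact: Cmod_triangle. rewrite Cmod_opp. lra.
Qed.

(** * Residues *)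

Lemma log_diff_trans (g : R -> C) (p q r l m : C) :
  log_diff g p q l -> log_diff g q r m -> log_diff g p r (l + m)%C.
Proof.
  move=> [h1 h2] [k1 k2]. rewrite /log_diff.
  have -> : (fun t => (/ (g t - p) - / (g t - r)) * path_derive g t)%C =
    (fun t => plus (G := C_R_NormedModule) ((/ (g t - p) - / (g t - q)) * path_derive g t)%C
         ((/ (g t - q) - / (g t - r)) * path_derive g t)%C).
    apply: functional_extensionality => t.
    change ((/ (g t - p) - / (g t - r)) * path_derive g t = (/ (g t - p) - / (g t - q)) * path_derive g t +
      (/ (g t - q) - / (g t - r)) * path_derive g t)%C. ring.
  split; first exact: (is_RInt_gen_plus (V := C_R_NormedModule)).
  move=> a b. exact: (ex_RInt_plus (V := C_R_NormedModule)).
Qed.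

Lemma log_diff_sym (g : R -> C) (p q l : C) : log_diff g p q l -> log_diff g q p (- l)%C.
Proof.
  move=> [h1 h2]. rewrite /log_diff.
  have -> : (fun t => (/ (g t - q) - / (g t - p)) * path_derive g t)%C =
    (fun t => opp (G := C_R_NormedModule) ((/ (g t - p) - / (g t - q)) * path_derive g t)%C).
    apply: functional_extensionality => t.
    change ((/ (g t - q) - / (g t - p)) * path_derive g t = - ((/ (g t - p) - / (g t - q)) * path_derive g t))%C. ring.
  split; first exact: (is_RInt_gen_opp (V := C_R_NormedModule)).
  move=> a b. exact: (ex_RInt_opp (V := C_R_NormedModule)).
Qed.

Lemma carg_upper (theta : R) (w : C) : PI / 2 <= theta <= 2 * PI -> 0 < Re w -> 0 < Im w ->
  carg theta w = atan (Im w / Re w).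
Proof.
  move=> ht hx hy. have [b1 b2] := atan_bound (Im w / Re w).
  have p : 0 < atan (Im w / Re w) by rewrite -atan_0; apply: atan_increasing; exact: Rdiv_lt_0_compat.
  apply: carg_unique; first by move=> e; move: hx; rewrite e /=; lra.
  split; [lra | exact: polar_right].
Qed.

Lemma carg_lower (theta : R) (w : C) : PI / 2 < theta < PI -> 0 < Re w ->
  carg theta w = atan (Im w / Re w).
Proof.
  move=> ht hx. have [b1 b2] := atan_bound (Im w / Re w).
  apply: carg_unique; first by move=> e; move: hx; rewrite e /=; lra.
  split; [lra | exact: polar_right].
Qed.

Lemma carg_lower_2PI (w : C) : 0 < Re w -> Im w < 0 ->
  carg (2 * PI) w = 2 * PI + atan (Im w / Re w).
Proof.
  move=> hx hy. have [b1 b2] := atan_bound (Im w / Re w). have hp := PI_RGT_0.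
  have p : atan (Im w / Re w) < 0.
    rewrite -atan_0. apply: atan_increasing. have := Rdiv_lt_0_compat (- Im w) (Re w) ltac:(lra) hx.
    rewrite /Rdiv. lra.
  apply: carg_unique; first by move=> e; move: hx; rewrite e /=; lra.
  split; first lra.
  rewrite cos_plus sin_plus cos_2PI sin_2PI. rewrite {1}(polar_right w hx).
  apply: C_eq => /=; ring.
Qed.

(** w - X = w (1 - X/w), and the argument b of the second factor is small. The two candidates for
    the argument of w - X differ by less than pi + 1 < 2 pi, hence agree. *)
Lemma shift_log_small (w : C) (X : R) : 0 < Re w -> 0 < Re w - X -> Rabs X / Cmod w <= 1 / 2 ->
  Rabs (ln (Cmod (w - X)) - ln (Cmod w)) <= 2 * (Rabs X / Cmod w) /\
  Rabs (atan (Im w / (Re w - X)) - atan (Im w / Re w)) <= 2 * (Rabs X / Cmod w).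
Proof.
  move=> h1 h2 h3.
  have w0 : w <> RtoC 0 by move=> e; move: h1; rewrite e /=; lra.
  have wp : 0 < Cmod w by apply/Cmod_gt_0.
  pose h := (- RtoC X / w)%C.
  have eh : Cmod h = Rabs X / Cmod w by rewrite /h Cmod_div // Cmod_opp Cmod_R.
  rewrite -eh in h3 *.
  have [l1 [l2 l3]] := log_near_1 h h3.
  have ew : (w - X)%C = (w * (1 + h))%C by rewrite /h; field.
  have p1 : 0 < Cmod (1 + h) by apply/Cmod_gt_0 => e; move: l3; rewrite e /=; lra.
  split.
    rewrite ew Cmod_mult ln_mult //. by replace (ln (Cmod w) + ln (Cmod (1 + h)) - ln (Cmod w)) with (ln (Cmod (1 + h))) by ring.
  set b := atan (Im (1 + h)%C / Re (1 + h)%C) in l2.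
  suff -> : atan (Im w / (Re w - X)) = atan (Im w / Re w) + b.
    by replace (atan (Im w / Re w) + b - atan (Im w / Re w)) with b by ring.
  have pr1 := polar_right w h1. have pr2 := polar_right (1 + h) l3.
  have pr3 := polar_right (w - X) h2.
  have i3 : Im (w - X)%C = Im w by rewrite /Im /=; ring.
  have r3 : Re (w - X)%C = Re w - X by [].
  rewrite i3 r3 in pr3. rewrite -/b in pr2.
  have [a1 a2] := atan_bound (Im w / Re w). have [a3 a4] := atan_bound (Im w / (Re w - X)).
  apply: (polar_inj (Cmod (w - X))).
  - rewrite ew Cmod_mult. nra.
  - have [x1 x2] : - 1 <= b <= 1 by move: l2; rewrite /Rabs; case: Rcase_abs; lra.
    have : 2 < PI by have := PI2_1; lra. move=> hp. apply: Rabs_def1; lra.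
  - rewrite -pr3 {1}ew {1}pr1 {1}pr2 ew Cmod_mult cos_plus sin_plus. apply: C_eq => /=; ring.
Qed.

(* For X to the right of the bounded part of g, the curve avoids the ray [X, oo), so log (g - X) exists with
   argument in (0, 2 pi). *)
Lemma log_diff_far (g : R -> C) (theta : R) : tame_contour g -> PI / 2 < theta < PI ->
  (forall t, ~ on_cut theta (g t)) ->
  exists X0, forall X, X0 <= X -> (forall t, g t <> RtoC X) /\ log_diff g (RtoC X) (RtoC 0) (RtoC (2 * PI) * Ci)%C.
Proof.
  move=> h ht hcut. have hp := PI_RGT_0.
  have [a [u [up hu]]] := tc_in _ h. have [b [v [vp hv]]] := tc_out _ h.
  have [M hM] := continuous_bounded (fun t => Re (g t)) (fun t => proj1 (tc_cont _ h t)) a b.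
  exists (Rabs M + 1) => X hX.
  have Mp := Rle_abs M. have M0 := Rabs_pos M.
  have off : forall t x, 0 <= x -> g t <> RtoC (X + x).
    move=> t x x0 e. have ei : Im (g t) = 0 by rewrite e. have er : Re (g t) = X + x by rewrite e.
    case: (Rle_dec t a) => ta; first by have [_ k] := hu t ta; lra.
    case: (Rle_dec b t) => tb; first by have [_ k] := hv t tb; lra.
    have := hM t ltac:(lra). rewrite er Rabs_pos_eq; lra.
  have offX : forall t, g t <> RtoC X.
    move=> t. have := off t 0 (Rle_refl 0). by rewrite Rplus_0_r.
  have g0 : forall t, g t <> RtoC 0 by move=> t e; apply: (hcut t); rewrite e; exact: on_cut_0.
  split=> //.
  have cut2 : forall t, ~ on_cut (2 * PI) (g t - X).
    move=> t [x [x0 e]]. apply: (off t x x0).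
    replace (g t) with (g t - X + X)%C by ring. rewrite e cos_2PI sin_2PI RtoC_plus. apply: C_eq => /=; ring.
  (* The first logarithm is cut along the ray [X, oo), the second along the ray at angle theta; the
     contour avoids both. *)
  pose P := fun z : C => (clog (2 * PI) (z - RtoC X) + (- (1)) * clog theta z)%C.
  apply: (contour_primitive g (fun z => / (z - X) - / (z - 0))%C P) => //.
  - move=> t.
    have d1 : cderiv (fun z => z - RtoC X)%C (g t) (RtoC 1).
      apply: (cderiv_ext_val _ _ _ _ (cderiv_plus _ _ _ _ _ (cderiv_id _) (cderiv_const (- RtoC X) _))). ring.
    have d2 := cderiv_comp (clog (2 * PI)) (fun z => z - RtoC X)%C (g t) _ _ (cderiv_clog (2 * PI) _ ltac:(lra) (cut2 t)) d1.
    have d3 := cderiv_scal (- (1)) _ _ _ (cderiv_clog theta (g t) ltac:(lra) (hcut t)).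
    apply: cderiv_ext_val (cderiv_plus _ _ _ _ _ d2 d3) _.
    have -> : (g t - 0)%C = g t by ring. ring.
  - move=> t. exact: Ccont_log_diff.
  - move=> eps he.
    have X0 := Rabs_pos X.
    have [T [Tp hT]] := tame_escape g (Rabs X + 1 + 2 * Rabs X + 8 * (Rabs X + 1) / eps) h.
    have key : forall t, T <= Rabs t -> 0 < Re (g t) /\ 0 < Re (g t) - X /\
       Rabs X / Cmod (g t) <= 1 / 2 /\ 8 * (Rabs X / Cmod (g t)) < eps.
      move=> t htt. have k := hT t htt. have ax := Rle_abs X.
      have e8 : 0 < 8 * (Rabs X + 1) / eps by apply: Rdiv_lt_0_compat; lra.
      have k1 : Rabs X + 1 + 2 * Rabs X + 8 * (Rabs X + 1) / eps <= Cmod (g t).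
        have := Rle_trans _ _ _ (Rle_abs _) (re_le_Cmod (g t)). lra.
      have gp : 0 < Cmod (g t) by lra.
      split; first lra. split; first lra. split.
        apply: (Rmult_le_reg_r (Cmod (g t))) => //. rewrite /Rdiv Rmult_assoc Rinv_l; lra.
      apply: (Rmult_lt_reg_r (Cmod (g t))) => //.
      rewrite /Rdiv !Rmult_assoc Rinv_l; last lra.
      have : 8 * (Rabs X + 1) / eps <= Cmod (g t) by lra.
      move=> k2. have := Rmult_le_compat_l eps _ _ ltac:(lra) k2.
      replace (eps * (8 * (Rabs X + 1) / eps)) with (8 * (Rabs X + 1)) by (field; lra). lra.
    exists (T + Rabs a + Rabs b) => x y hx hy.
    have ra := Rle_abs (- a). have rb := Rle_abs b. rewrite Rabs_Ropp in ra.
    have pa := Rabs_pos a. have pb := Rabs_pos b.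
    have [_ ix] := hu x ltac:(lra). have [_ iy] := hv y ltac:(lra).
    have [x1 [x2 [x3 x4]]] := key x ltac:(rewrite Rabs_left1; lra).
    have [y1 [y2 [y3 y4]]] := key y ltac:(rewrite Rabs_pos_eq; lra).
    have [xs1 xs2] := shift_log_small (g x) X x1 x2 x3. have [ys1 ys2] := shift_log_small (g y) X y1 y2 y3.
    have iX : forall z : C, Im (z - X)%C = Im z by move=> z; rewrite /Im /=; ring.
    have rX : forall z : C, Re (z - X)%C = Re z - X by [].
    (* At the incoming end the two arguments nearly agree; at the outgoing end, below the real axis,
       the branch with values in (0, 2 pi) exceeds the other by nearly 2 pi. This is the origin of 2
       pi i. *)
    have cx1 : carg (2 * PI) (g x - X) = atan (Im (g x) / (Re (g x) - X)).
      rewrite carg_upper ?iX ?rX //; lra.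
    have cx2 : carg theta (g x) = atan (Im (g x) / Re (g x)) by apply: carg_upper => //; lra.
    have cy1 : carg (2 * PI) (g y - X) = 2 * PI + atan (Im (g y) / (Re (g y) - X)).
      rewrite carg_lower_2PI ?iX ?rX //.
    have cy2 : carg theta (g y) = atan (Im (g y) / Re (g y)) by apply: carg_lower.
    set Lx := ln (Cmod (g x - X)) - ln (Cmod (g x)) in xs1. set Ly := ln (Cmod (g y - X)) - ln (Cmod (g y)) in ys1.
    set Ax := atan (Im (g x) / (Re (g x) - X)) - atan (Im (g x) / Re (g x)) in xs2.
    set Ay := atan (Im (g y) / (Re (g y) - X)) - atan (Im (g y) / Re (g y)) in ys2.
    have -> : (P (g y) - P (g x) - RtoC (2 * PI) * Ci)%C = (Ly - Lx, Ay - Ax).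
      rewrite /P /clog cx1 cx2 cy1 cy2 /Lx /Ly /Ax /Ay. apply: C_eq => /=; ring.
    apply: Rle_lt_trans; first exact: Cmod_le_sum. rewrite /=.
    have := Rabs_triang Ly (- Lx). have := Rabs_triang Ay (- Ax). rewrite !Rabs_Ropp.
    rewrite -/(Rminus Ly Lx) -/(Rminus Ay Ax). lra.
Qed.

Lemma continuous_Ccont (c : R -> C) (t : R) : continuous c t -> Ccont c t.
Proof.
  move=> h. split.
  - apply/continuous_eps => eps he. have [d hd] := proj1 (filterlim_locally c (c t)) h (mkposreal _ he).
    exists d. split; first exact: cond_pos. move=> u hu. exact: (proj1 (hd u hu)).
  - apply/continuous_eps => eps he. have [d hd] := proj1 (filterlim_locally c (c t)) h (mkposreal _ he).
    exists d. split; first exact: cond_pos. move=> u hu. exact: (proj2 (hd u hu)).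
Qed.

(** The pole is moved from p to a large real number along a path off the contour. Small moves change
    nothing by [log_diff_near], and [log_diff_far] evaluates the integral at the end of the path. *)
Lemma log_diff_interior (g : R -> C) (theta : R) (p : C) : tame_contour g -> PI / 2 < theta < PI ->
  (forall t, ~ on_cut theta (g t)) -> Defs.interior g p ->
  (forall t, g t <> p) /\ log_diff g p (RtoC 0) (RtoC (2 * PI) * Ci)%C.
Proof.
  move=> h ht hcut [X hX]. have [X0 hX0] := log_diff_far g theta h ht hcut.
  have [c [cc [c0 [c1 coff]]]] := hX (Rmax X X0) (Rmax_l _ _).
  have [_ far] := hX0 (Rmax X X0) (Rmax_r _ _).
  split; first by move=> t e; apply: (coff 0 t); [lra | rewrite c0 e].
  pose k := fun u => c (clamp u).
  have kc : forall u, Ccont k u.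
    move=> u. have [k1 k2] := continuous_Ccont c _ (cc (clamp u)).
    have cl := clamp_continuous u. split.
      exact: (continuous_comp clamp (fun t => Re (c t)) u cl k1). exact: (continuous_comp clamp (fun t => Im (c t)) u cl k2).
  have E : forall x y, log_diff g (k y) (k x) (RtoC 0).
    apply: local_to_global.
    - move=> x y hxy. have := log_diff_sym _ _ _ _ hxy. by have -> : (- RtoC 0)%C = RtoC 0 by ring.
    - move=> x y z h1 h2. have := log_diff_trans _ _ _ _ _ _ h2 h1. by have -> : (RtoC 0 + RtoC 0)%C = RtoC 0 by ring.
    - move=> x. have [d [dp hd]] := tame_dist g (k x) h (fun t e => coff (clamp x) t (clamp_range x) (eq_sym e)).
      have [dl [dlp hdl]] := proj1 (Ccont_eps k x) (kc x) d dp.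
      exists dl. split=> // y hy. apply: (log_diff_near g _ _ d) => //. exact: hdl.
  have := E 1 0. rewrite /k !clamp_id; try lra. rewrite c0 c1 => h0.
  have := log_diff_trans _ _ _ _ _ _ h0 far. by have -> : (RtoC 0 + RtoC (2 * PI) * Ci)%C = (RtoC (2 * PI) * Ci)%C by ring.
Qed.

Lemma is_RInt_Cscal (c : C) (f : R -> C) (a b : R) (l : C) :
  Cis_RInt f a b l ->
  Cis_RInt (fun t => c * f t)%C a b (c * l)%C.
Proof.
  move=> h.
  have h1 := is_RInt_fct_extend_fst (U := R_NormedModule) (V := R_NormedModule) _ _ _ _ h.
  have h2 := is_RInt_fct_extend_snd (U := R_NormedModule) (V := R_NormedModule) _ _ _ _ h.
  apply: is_RInt_pair.
  - apply: (is_RInt_minus (V := R_NormedModule) (fun t => Re c * Re (f t)) (fun t => Im c * Im (f t))); exact: (is_RInt_scal (V := R_NormedModule)).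
  - apply: (is_RInt_plus (V := R_NormedModule) (fun t => Re c * Im (f t)) (fun t => Im c * Re (f t))); exact: (is_RInt_scal (V := R_NormedModule)).
Qed.

Lemma is_RInt_gen_Cscal (c : C) (f : R -> C) (l : C) :
  Cis_RInt_gen f l ->
  Cis_RInt_gen (fun t => c * f t)%C (c * l)%C.
Proof.
  move=> h P [eps hP].
  have cp : 0 < Cmod c + 1 by have := Cmod_ge_0 c; lra.
  have e2 : 0 < eps / (2 * (Cmod c + 1)) by apply: Rdiv_lt_0_compat; [exact: cond_pos | lra].
  have s2 : sqrt 2 < 2 by rewrite -{2}(sqrt_Rsqr 2); [apply: sqrt_lt_1; rewrite /Rsqr; lra | lra].
  have hb : locally (T := C_R_NormedModule) l (fun y => P (c * y)%C).
    exists (mkposreal _ e2) => y hy. apply: hP. apply: C_NormedModule_mixin_compat1.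
    have := C_NormedModule_mixin_compat2 l y (mkposreal _ e2) hy.
    have -> : minus (G := C_AbelianGroup) (c * y)%C (c * l)%C = (c * (y - l))%C.
      change (c * y - c * l = c * (y - l))%C. ring.
    rewrite Cmod_mult [pos _]/= => k. change (Cmod (y - l) < sqrt 2 * (eps / (2 * (Cmod c + 1)))) in k.
    have k2 : Cmod (y - l) < 2 * (eps / (2 * (Cmod c + 1))) by nra.
    have := Rmult_lt_compat_l _ _ _ cp k2.
    replace ((Cmod c + 1) * (2 * (eps / (2 * (Cmod c + 1))))) with (eps : R) by (field; lra).
    have := Cmod_ge_0 (y - l). nra.
  have [Q1 Q2 q1 q2 hQ] := h _ hb.
  apply: (Filter_prod _ _ _ Q1 Q2 q1 q2) => x y hx hy.
  have [v [hv1 hv2]] := hQ x y hx hy.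
  exists (c * v)%C. split=> //. exact: is_RInt_Cscal.
Qed.

(* Subtracting p^(-s) (1/(z - p) - 1/z) from z^(-s)/(z - p) removes the pole; the substitution
   w = log z - log p turns what remains into p^(-s) kf (1 - s) w dw, whose primitive Kf has equal limits at
   both ends of the contour. *)
Lemma residue_integral (g : R -> C) (theta : R) (p s : C) : tame_contour g -> PI / 2 < theta < PI ->
  (forall t, ~ on_cut theta (g t)) -> ~ on_cut theta p -> Defs.interior g p -> 2 <= Re s ->
  Cis_RInt_gen (fun t => (cpow theta (g t) (- s) / (p - g t)) * path_derive g t)%C (- (RtoC (2 * PI) * Ci) * cpow theta p (- s))%C /\
  forall a b, Cex_RInt (fun t => (cpow theta (g t) (- s) / (p - g t)) * path_derive g t)%C a b.
Proof.
  move=> h ht hcut pcut hin hs.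
  have hp := PI_RGT_0. have ht2 : 0 < theta <= 2 * PI by lra.
  have [gp [LD1 LD2]] := log_diff_interior g theta p h ht hcut hin.
  have p0 : p <> RtoC 0 by move=> e; apply: pcut; rewrite e; exact: on_cut_0.
  have pm : 0 < Cmod p by apply/Cmod_gt_0.
  have g0 : forall t, g t <> RtoC 0 by move=> t e; apply: (hcut t); rewrite e; exact: on_cut_0.
  (* In the variable log z the differential dz = z d(log z) raises the exponent -s by one; Re s >= 2
     gives the Re a <= -1 that [Kf_decay] asks for. *)
  pose a := (1 - s)%C.
  have ra : Re a <= -1 by rewrite /a /Re /=; rewrite /Re in hs; lra.
  pose L := clog theta p. pose ps := cpow theta p (- s).
  have ps0 : ps <> RtoC 0 by exact: cexp_neq0.
  pose eta := fun z => (clog theta z + - L)%C.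
  have seta : forall t, strip (eta (g t)).
    move=> t. rewrite /strip /eta. have [[k1 k2] _] := carg_spec theta (g t) ht2 (hcut t).
    have [[k3 k4] _] := carg_spec theta p ht2 pcut.
    have -> : Im (clog theta (g t) + - L)%C = carg theta (g t) - carg theta p by [].
    apply: Rabs_def1; lra.
  have eE : forall t, cexp (eta (g t)) = (g t / p)%C.
    move=> t. rewrite /eta cexp_plus cexp_opp /L !cexp_clog //.
  have eta0 : forall t, eta (g t) <> RtoC 0.
    move=> t e. apply: (gp t). have := eE t. rewrite e cexp_0 => e1.
    replace (g t) with (g t / p * p)%C by (field; done). rewrite -e1. ring.
  pose f1 := fun z => (ps * (kf a (eta z) * / z))%C.
  pose P1 := fun z => (ps * Kf a (eta z))%C.
  have ceta : forall t, cderiv eta (g t) (/ g t)%C.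
    move=> t. apply: cderiv_ext_val (cderiv_plus _ _ _ _ _ (cderiv_clog theta (g t) ht2 (hcut t)) (cderiv_const (- L)%C _)) _. ring.
  have [A1 A2] : Cis_RInt_gen (fun t => f1 (g t) * path_derive g t)%C (RtoC 0) /\
    forall a b, Cex_RInt (fun t => f1 (g t) * path_derive g t)%C a b.
    apply: (contour_primitive g f1 P1) => //.
    - move=> t. apply: cderiv_scal. exact: (cderiv_comp (Kf a) eta _ _ _ (cderiv_Kf a _ (seta t)) (ceta t)).
    - move=> t. apply: Ccont_mult; first exact: Ccont_const.
      apply: Ccont_mult; last by apply: Ccont_inv => //; exact: (tc_cont _ h).
      apply: (Ccont_comp (fun z => kf a (eta z)) g t _ _ (tc_cont _ h t)).
      exact: (cderiv_comp (kf a) eta _ _ _ (cderiv_kf a _ (seta t)) (ceta t)).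
    - move=> eps he.
      have [M [Mp hM]] := Kf_decay a ra.
      have psp : 0 < Cmod ps by apply/Cmod_gt_0.
      (* |z| >= 3 |p| makes Re (eta z) >= 1, as e <= 3; the second summand pushes the bound from
         [Kf_decay], proportional to |p|/|z|, below eps. *)
      pose r := 3 * Cmod p + 3 * (Cmod ps * M * Cmod p) / eps.
      have q0 : 0 < 3 * (Cmod ps * M * Cmod p) / eps.
        apply: Rdiv_lt_0_compat => //. apply: Rmult_lt_0_compat; first lra. repeat apply: Rmult_lt_0_compat => //.
      have [T [Tp hT]] := tame_escape g r h.
      have key : forall t, T <= Rabs t -> 1 <= Re (eta (g t)) /\ Cmod ps * (M * exp (- Re (eta (g t)))) < eps.
        move=> t htt. have gt : r <= Cmod (g t).
          have := hT t htt. have := Rle_trans _ _ _ (Rle_abs _) (re_le_Cmod (g t)). lra.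
        have gtp : 0 < Cmod (g t) by rewrite /r in gt; lra.
        have reE : Re (eta (g t)) = ln (Cmod (g t)) - ln (Cmod p) by [].
        have ex : exp (- Re (eta (g t))) = Cmod p / Cmod (g t).
          rewrite reE. replace (- (ln (Cmod (g t)) - ln (Cmod p))) with (ln (Cmod p) + - ln (Cmod (g t))) by ring.
          rewrite exp_plus exp_Ropp !exp_ln //.
        split.
          rewrite reE -ln_div // -(ln_exp 1). apply: ln_le; first exact: exp_pos.
          apply: Rle_trans exp_le_3 _. apply: (Rmult_le_reg_r (Cmod p)) => //.
          rewrite /Rdiv Rmult_assoc Rinv_l; last lra. rewrite /r in gt. lra.
        rewrite ex. apply: (Rmult_lt_reg_r (Cmod (g t))) => //.
        have k2 : 3 * (Cmod ps * M * Cmod p) / eps <= Cmod (g t) by rewrite /r in gt; lra.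
        have k3 := Rmult_le_compat_l eps _ _ ltac:(lra) k2.
        replace (eps * (3 * (Cmod ps * M * Cmod p) / eps)) with (3 * (Cmod ps * M * Cmod p)) in k3 by (field; lra).
        replace (Cmod ps * (M * (Cmod p / Cmod (g t))) * Cmod (g t)) with (Cmod ps * M * Cmod p) by (field; lra).
        have : 0 < Cmod ps * M * Cmod p by repeat apply: Rmult_lt_0_compat => //. lra.
      exists (T + 1) => x y hx hy.
      have [x1 x2] := key x ltac:(rewrite Rabs_left; lra). have [y1 y2] := key y ltac:(rewrite Rabs_pos_eq; lra).
      have -> : (P1 (g y) - P1 (g x) - 0)%C = (ps * (Kf a (eta (g y)) - Kf a (eta (g x))))%C by rewrite /P1; ring.
      rewrite Cmod_mult.
      case: (Rle_dec (Re (eta (g x))) (Re (eta (g y)))) => hle.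
        have := hM _ _ (seta x) (seta y) (conj x1 hle) => k.
        apply: Rle_lt_trans x2. apply: Rmult_le_compat_l => //. exact: Rlt_le.
      have hge : Re (eta (g y)) <= Re (eta (g x)) by lra.
      have := hM _ _ (seta y) (seta x) (conj y1 hge) => k.
      apply: Rle_lt_trans y2. apply: Rmult_le_compat_l; first exact: Rlt_le.
      rewrite -Cmod_opp. by have -> : (- (Kf a (eta (g y)) - Kf a (eta (g x))))%C = (Kf a (eta (g x)) - Kf a (eta (g y)))%C by ring.
  have e : (fun t => (cpow theta (g t) (- s) / (p - g t)) * path_derive g t)%C =
    (fun t => minus (G := C_R_NormedModule) (opp (G := C_R_NormedModule) (f1 (g t) * path_derive g t)%C)
       (ps * ((/ (g t - p) - / (g t - 0)) * path_derive g t))%C).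
    apply: functional_extensionality => t.
    change (cpow theta (g t) (- s) / (p - g t) * path_derive g t = - (f1 (g t) * path_derive g t) +
       - (ps * ((/ (g t - p) - / (g t - 0)) * path_derive g t)))%C.
    (* This is (z/p)^(1 - s); the identity between the integrands is then rational in z, p, z^(-s)
       and p^(-s). *)
    have ea : cexp (a * eta (g t)) = (g t / p * (cpow theta (g t) (- s) / ps))%C.
      have -> : (a * eta (g t) = eta (g t) + (- s * clog theta (g t) + - (- s * L)))%C by rewrite /a /eta; ring.
      rewrite (cexp_plus (eta (g t))) (cexp_plus _ (- (- s * L))) cexp_opp eE //.
    have gp1 : (g t - p)%C <> RtoC 0.
      move=> e. apply: (gp t). replace (g t) with (g t - p + p)%C by ring. rewrite e. ring.
    have gp2 : (p - g t)%C <> RtoC 0.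
      move=> e. apply: gp1. replace (g t - p)%C with (- (p - g t))%C by ring. rewrite e. ring.
    rewrite /f1 kf_eq // ea eE. field. by repeat split.
  rewrite e.
  have S1 : Cis_RInt_gen (fun t => ps * ((/ (g t - p) - / (g t - 0)) * path_derive g t))%C (ps * (RtoC (2 * PI) * Ci))%C.
    exact: is_RInt_gen_Cscal.
  have S2 : forall a b, Cex_RInt (fun t => ps * ((/ (g t - p) - / (g t - 0)) * path_derive g t))%C a b.
    move=> x y. have [l hl] := LD2 x y. exists (ps * l)%C. exact: is_RInt_Cscal.
  split.
    have -> : (- (RtoC (2 * PI) * Ci) * cpow theta p (- s))%C =
      minus (G := C_R_NormedModule) (opp (G := C_R_NormedModule) (RtoC 0)) (ps * (RtoC (2 * PI) * Ci))%C.
      change (- (RtoC (2 * PI) * Ci) * cpow theta p (- s) = - RtoC 0 + - (ps * (RtoC (2 * PI) * Ci)))%C. rewrite /ps. ring.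
    apply: (is_RInt_gen_minus (V := C_R_NormedModule)) => //.
    exact: (is_RInt_gen_opp (V := C_R_NormedModule)).
  move=> x y. apply: (ex_RInt_minus (V := C_R_NormedModule)) => //.
  exact: (ex_RInt_opp (V := C_R_NormedModule)).
Qed.

(** * Summation under the integral sign *)

Lemma Cseries_tail (a : nat -> C) (b : nat -> R) (l : C) (N : nat) :
  (forall n, Cmod (a n) <= b n) -> ex_series b -> Cis_series a l ->
  Cmod (l - Csum_n a N) <= Series (fun k => b (S N + k)%nat).
Proof.
  move=> hab hb hl.
  apply: (Cis_series_norm (fun k => a (S N + k)%nat)) => //.
    by apply/(ex_series_incr_n b (S N)).
  apply: (is_series_incr_n (V := C_R_NormedModule) a (S N)); first lia.
  match goal with |- is_series _ ?x => replace x with l; first done end.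
  change (l = l - Csum_n a N + Csum_n a N)%C. ring.
Qed.

Lemma RInt_gen_elim (phi : R -> C) (l : C) (eps : R) : 0 < eps ->
  Cis_RInt_gen phi l ->
  exists T, 0 < T /\ forall a b, a <= - T -> T <= b ->
    exists v, Cis_RInt phi a b v /\ Cmod (v - l) < eps.
Proof.
  move=> he h.
  have e2 : 0 < eps / 2 by lra.
  have hb : locally (T := C_R_NormedModule) l (fun y => Cmod (y - l) < eps).
    exists (mkposreal _ e2) => y hy.
    have := C_NormedModule_mixin_compat2 l y (mkposreal _ e2) hy.
    rewrite [pos _]/= => k. change (Cmod (y - l) < sqrt 2 * (eps / 2)) in k.
    have s2 : sqrt 2 < 2 by rewrite -{2}(sqrt_Rsqr 2); [apply: sqrt_lt_1; rewrite /Rsqr; lra | lra].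
    nra.
  have [Q1 Q2 [m1 q1] [m2 q2] hQ] := h _ hb.
  exists (Rabs m1 + Rabs m2 + 1).
  have := Rabs_pos m1. have := Rabs_pos m2. have := Rle_abs m2. have := Rle_abs (- m1). rewrite Rabs_Ropp.
  move=> h1 h2 h3 h4. split; first lra. move=> a b ha hb2.
  apply: hQ; [apply: q1; lra | apply: q2; lra].
Qed.

(** The integral of 1/(1 + t^2) over any interval is a difference of arctangents, at most pi. *)
Lemma RInt_dominated (phi : R -> C) (c a b : R) (v : C) : a <= b ->
  (forall t, Cmod (phi t) <= c * / (1 + t ^ 2)) ->
  Cis_RInt phi a b v -> Cmod v <= c * PI.
Proof.
  move=> ab hphi hv.
  have c0 : 0 <= c.
    have := hphi 0. have := Cmod_ge_0 (phi 0). replace (/ (1 + 0 ^ 2)) with 1 by field. lra.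
  have hi : is_RInt (fun t => c * / (1 + t ^ 2)) a b (c * (atan b - atan a)).
    apply: (is_RInt_scal (V := R_NormedModule)).
    apply: (is_RInt_derive (V := R_CompleteNormedModule) atan (fun t => / (1 + t ^ 2))).
      move=> x _. have := is_derive_atan x. by rewrite Rsqr_pow2.
    move=> x _. apply: (ex_derive_continuous (fun t => / (1 + t ^ 2))). auto_derive. nra.
  have := norm_RInt_le phi (fun t => c * / (1 + t ^ 2)) a b v _ ab _ hv hi.
  rewrite C_R_norm => k. apply: Rle_trans (k _) _.
    move=> x _. rewrite C_R_norm. exact: hphi.
  apply: Rmult_le_compat_l => //. have [a1 a2] := atan_bound a. have [b1 b2] := atan_bound b. lra.
Qed.

(** On a bounded interval the series converges uniformly and is integrated term by term. The tails
    in n are at most pi times those of [bet], uniformly in the interval, so summation commutes with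
    letting the interval grow. *)
Lemma series_RInt_gen (phi : nat -> R -> C) (Phi : R -> C) (I : nat -> C) (bet : nat -> R) :
  (forall n t, Cmod (phi n t) <= bet n * / (1 + t ^ 2)) -> ex_series bet ->
  (forall t, Cis_series (fun n => phi n t) (Phi t)) ->
  (forall n, Cis_RInt_gen (phi n) (I n)) ->
  (forall n a b, Cex_RInt (phi n) a b) ->
  ex_series (fun n => Cmod (I n)) /\ exists l, Cis_series I l /\
    Cis_RInt_gen Phi l.
Proof.
  move=> hphi hb hPhi hI hex.
  have hp := PI_RGT_0.
  have b0 : forall n, 0 <= bet n.
    move=> n. have := hphi n 0. have := Cmod_ge_0 (phi n 0). replace (/ (1 + 0 ^ 2)) with 1 by field. lra.
  have hbp : ex_series (fun n => bet n * PI) by exact: ex_series_scal_r.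
  pose J := fun n a b => RInt (V := C_R_CompleteNormedModule) (phi n) a b.
  have hJ : forall n a b, Cis_RInt (phi n) a b (J n a b).
    move=> n a b. exact: (RInt_correct (V := C_R_CompleteNormedModule)).
  have Jb : forall n a b, a <= b -> Cmod (J n a b) <= bet n * PI.
    move=> n a b ab. exact: RInt_dominated ab (hphi n) (hJ n a b).
  have Jlim : forall n eps, 0 < eps -> exists T, 0 < T /\ forall a b, a <= - T -> T <= b -> Cmod (J n a b - I n) < eps.
    move=> n eps he. have [T [Tp hT]] := RInt_gen_elim _ _ eps he (hI n). exists T. split=> // a b ha hb2.
    have [v [hv1 hv2]] := hT a b ha hb2.
    have -> : J n a b = v by apply: (is_RInt_unique (V := C_R_CompleteNormedModule)).
    done.
  have Ib : forall n, Cmod (I n) <= bet n * PI.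
    move=> n. apply: Rnot_lt_le => lt.
    have [T [Tp hT]] := Jlim n (Cmod (I n) - bet n * PI) ltac:(lra).
    have k := hT (- T) T ltac:(lra) ltac:(lra). have k2 := Jb n (- T) T ltac:(lra).
    move: k k2. set j := J n (- T) T => k k2.
    have := Cmod_triangle j (- (j - I n)). rewrite Cmod_opp.
    have -> : (j + - (j - I n))%C = I n by ring. lra.
  have exI : ex_series (fun n => Cmod (I n)).
    apply: ex_series_le_nonneg hbp => n. split; [exact: Cmod_ge_0 | exact: Ib].
  split=> //. have [l hl] := Cis_series_abs I exI. exists l. split=> //.
  pose Sm := fun (u : nat -> C) N => Csum_n u N.
  have hS : forall N a b, Cis_RInt (fun t => Sm (fun n => phi n t) N) a b (Sm (fun n => J n a b) N).
    move=> N a b. elim: N => [|N IH].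
      rewrite /Sm sum_O. apply: is_RInt_ext (hJ 0%nat a b) => x _. by rewrite /Sm sum_O.
    rewrite /Sm sum_Sn. apply: is_RInt_ext (is_RInt_plus (V := C_R_NormedModule) _ _ _ _ _ _ IH (hJ (S N) a b)) => x _.
    by rewrite /Sm sum_Sn.
  have phib : forall n t, Cmod (phi n t) <= bet n.
    move=> n t. apply: Rle_trans (hphi n t) _. rewrite -{2}(Rmult_1_r (bet n)). apply: Rmult_le_compat_l => //.
    rewrite -[X in _ <= X]Rinv_1. apply: Rinv_le_contravar; nra.
  have unif : filterlim (fun N t => Sm (fun n => phi n t) N) eventually (locally (T := fct_UniformSpace R C_R_NormedModule) Phi).
    apply/filterlim_locally => eps.
    have [N hN] := Series_tail_small bet eps hb (cond_pos eps).
    exists N => n hn t. apply: C_NormedModule_mixin_compat1.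
    change (Cmod (Sm (fun n => phi n t) n - Phi t) < eps).
    rewrite -Cmod_opp. have -> : (- (Sm (fun n => phi n t) n - Phi t))%C = (Phi t - Sm (fun n => phi n t) n)%C by ring.
    apply: Rle_lt_trans (Cseries_tail _ bet _ n (fun k => phib k t) hb (hPhi t)) _.
    apply: Rle_lt_trans hN.
    have mono : forall m, Series (fun k => bet (S (S m) + k)%nat) <= Series (fun k => bet (S m + k)%nat).
      move=> m. have exm : ex_series (fun k => bet (S m + k)%nat) by apply/(ex_series_incr_n bet (S m)).
      rewrite (Series_incr_1 (fun k => bet (S m + k)%nat)) //.
      have -> : Series (fun k => bet (S (S m) + k)%nat) = Series (fun k => bet (S m + S k)%nat).
        apply: Series_ext => k. congr bet. lia.
      have := b0 (S m + 0)%nat. lra.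
    elim: n hn => [|n IH] hn; first by replace N with 0%nat by lia; exact: Rle_refl.
    case: (Nat.eq_dec N (S n)) => [->|ne]; first exact: Rle_refl.
    apply: Rle_trans; first exact: mono. apply: IH. lia.
  have JJ : forall a b, exists v, Cis_RInt Phi a b v /\
      Cis_series (fun n => J n a b) v.
    move=> a b.
    have [v [v1 v2]] := filterlim_RInt (V := C_R_CompleteNormedModule) (fun N t => Sm (fun n => phi n t) N) a b eventually _ Phi
      (fun N => Sm (fun n => J n a b) N) (fun N => hS N a b) unif.
    by exists v.
  pose JP := fun a b => RInt (V := C_R_CompleteNormedModule) Phi a b.
  have hJP : forall a b, Cis_RInt Phi a b (JP a b) /\
      Cis_series (fun n => J n a b) (JP a b).
    move=> a b. have [v [v1 v2]] := JJ a b.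
    have -> : JP a b = v by apply: (is_RInt_unique (V := C_R_CompleteNormedModule)). done.
  apply: (RInt_gen_intro Phi JP) => [a b|eps he]; first by apply hJP.
  have [N hN] := Series_tail_small _ (eps / 4) hbp ltac:(lra).
  have [T [Tp hT]] : exists T, 0 < T /\ forall a b, a <= - T -> T <= b -> Cmod (Sm (fun n => J n a b) N - Sm I N) < eps / 4.
    have : 0 < eps / 4 by lra. elim: N {hN} (eps / 4) => [|N IH] e ep.
      have [T [Tp hT]] := Jlim 0%nat e ep. exists T. split=> // a b ha hb2. rewrite /Sm !sum_O. exact: hT.
    have [T1 [T1p h1]] := IH (e / 2) ltac:(lra). have [T2 [T2p h2]] := Jlim (S N) (e / 2) ltac:(lra).
    exists (T1 + T2). split; first lra. move=> a b ha hb2. rewrite /Sm !sum_Sn.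
    have k1 := h1 a b ltac:(lra) ltac:(lra). have k2 := h2 a b ltac:(lra) ltac:(lra).
    have := Cmod_triangle (Sm (fun n => J n a b) N - Sm I N) (J (S N) a b - I (S N)).
    have -> : (Sm (fun n => J n a b) N - Sm I N + (J (S N) a b - I (S N)) =
      plus (Sm (fun n => J n a b) N) (J (S N) a b) - plus (Sm I N) (I (S N)))%C.
      change (Sm (fun n => J n a b) N - Sm I N + (J (S N) a b - I (S N)) =
        (Sm (fun n => J n a b) N + J (S N) a b) - (Sm I N + I (S N)))%C. ring.
    rewrite /Sm in k1 *. lra.
  exists T => a b ha hb2.
  have t1 := Cseries_tail _ _ _ N (fun n => Jb n a b ltac:(lra)) hbp (proj2 (hJP a b)).
  have t2 := Cseries_tail _ _ _ N Ib hbp hl.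
  have t3 := hT a b ha hb2. rewrite /Sm in t3.
  set s1 := Csum_n (fun n => J n a b) N in t1 t3.
  set s2 := Csum_n I N in t2 t3.
  have -> : (JP a b - l)%C = ((JP a b - s1) + (s1 - s2) + - (l - s2))%C by ring.
  apply: Rle_lt_trans; first exact: Cmod_triangle. rewrite Cmod_opp.
  have := Cmod_triangle (JP a b - s1) (s1 - s2). lra.
Qed.

(** * The zeta function as a contour integral *)

Lemma encircling_tame (theta : R) {H : HilbertSpace} (A : operator H) (g : R -> C) :
  encircling_contour theta A g -> tame_contour g.
Proof.
  move=> h. split.
  - move=> t. apply: continuous_Ccont. exact: (contour_continuous _ _ _ h).
  - exact: (contour_C1_Re _ _ _ h).
  - exact: (contour_C1_Im _ _ _ h).
  - exact: (contour_in _ _ _ h).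
  - exact: (contour_out _ _ _ h).
Qed.

(** Linear growth for large |t|, and the positive distance of the contour from 0 for the other t. *)
Lemma tame_lower (g : R -> C) : tame_contour g -> (forall t, g t <> RtoC 0) ->
  exists k, 0 < k /\ forall t, k * (1 + Rabs t) <= Cmod (g t).
Proof.
  move=> h h0. have [d [dp hd]] := tame_dist g (RtoC 0) h h0.
  have [al [be [alp [bep hg]]]] := tame_growth g h.
  pose t1 := 2 * be / al + 1.
  have t1p : 1 <= t1 by rewrite /t1; have := Rdiv_le_0_compat (2 * be) al ltac:(lra) alp; lra.
  exists (Rmin (al / 4) (d / (1 + t1))).
  split; first by apply: Rmin_pos; apply: Rdiv_lt_0_compat; lra.
  move=> t. have tp := Rabs_pos t.
  case: (Rle_dec t1 (Rabs t)) => ht.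
    have := Rmult_le_compat_r (1 + Rabs t) _ _ ltac:(lra) (Rmin_l (al / 4) (d / (1 + t1))).
    have k := hg t. have := Rle_trans _ _ _ (Rle_abs _) (re_le_Cmod (g t)).
    have := Rmult_le_compat_l al _ _ ltac:(lra) ht.
    have -> : al * t1 = 2 * be + al by rewrite /t1; field; lra. nra.
  have := Rmult_le_compat_r (1 + Rabs t) _ _ ltac:(lra) (Rmin_r (al / 4) (d / (1 + t1))).
  have k := hd t. have e : (g t - 0)%C = g t by ring. rewrite e in k.
  have := Rmult_le_compat_l (d / (1 + t1)) (1 + Rabs t) (1 + t1) ltac:(apply: Rlt_le; apply: Rdiv_lt_0_compat; lra) ltac:(lra).
  have -> : d / (1 + t1) * (1 + t1) = d by field; lra. lra.
Qed.

(** An affine function that stays positive on a half-line has nonnegative slope. *)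
Lemma tail_Im_lower (f : R -> R) (a k : R) : (forall x, 0 <= x -> 0 < a + x * k) ->
  forall x, 0 <= x -> a <= a + x * k.
Proof.
  move=> h x hx. have ap : 0 < a by have := h 0 (Rle_refl 0); lra.
  have : 0 <= k; last nra.
  apply: Rnot_lt_le => kn.
  have := h (a / - k) ltac:(apply: Rdiv_le_0_compat; lra).
  have -> : a + a / - k * k = 0 by field; lra. lra.
Qed.

(** On each half-line |Im (g t)| is at least its value at the end point, which bounds the distance
    from every real number. The middle part is bounded, so all but finitely many mu n are far from
    it, and each of the others has positive distance from the contour. *)
Lemma tame_real_dist (g : R -> C) (mu : nat -> R) (P : nat -> Prop) (z0 : C) : tame_contour g ->
  (forall r, exists N, forall n, (N <= n)%nat -> P n -> r <= Cmod (mu n - z0)) ->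
  (forall n t, P n -> g t <> RtoC (mu n)) ->
  exists d, 0 < d /\ forall n t, P n -> d <= Cmod (mu n - g t).
Proof.
  move=> h hesc hne.
  have sw : forall x y : C, Cmod (x - y) = Cmod (y - x) by move=> x y; rewrite -Cmod_opp; congr Cmod; ring.
  have [a [u [up hu]]] := tc_in _ h. have [b [v [vp hv]]] := tc_out _ h.
  have [M1 hM1] := continuous_bounded (fun t => Re (g t)) (fun t => proj1 (tc_cont _ h t)) a b.
  have [M2 hM2] := continuous_bounded (fun t => Im (g t)) (fun t => proj2 (tc_cont _ h t)) a b.
  have [N hN] := hesc (1 + Rabs M1 + Rabs M2 + Cmod z0).
  have ex : forall n, exists d, 0 < d /\ (P n -> forall t, d <= Cmod (mu n - g t)).
    move=> n. case: (classic (P n)) => hP; last by exists 1; split; [lra|].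
    have [d [dp hd]] := tame_dist g (RtoC (mu n)) h (fun t => hne n t hP).
    exists d. split=> // _ t. rewrite sw. exact: hd.
  have [dd hdd] := choice _ ex.
  have [d1 [d1p hd1]] := finite_min_pos (fun _ => True) dd N (fun n _ => proj1 (hdd n)).
  have ia : 0 < Im (g a) by have [_ k] := hu a (Rle_refl a).
  have ib : Im (g b) < 0 by have [_ k] := hv b (Rle_refl b).
  exists (Rmin d1 (Rmin 1 (Rmin (Im (g a)) (- Im (g b))))).
  split; first by repeat apply: Rmin_pos; lra.
  have m1 := Rmin_l d1 (Rmin 1 (Rmin (Im (g a)) (- Im (g b)))).
  have m2 := Rmin_r d1 (Rmin 1 (Rmin (Im (g a)) (- Im (g b)))).
  have m3 := Rmin_l 1 (Rmin (Im (g a)) (- Im (g b))). have m4 := Rmin_r 1 (Rmin (Im (g a)) (- Im (g b))).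
  have m5 := Rmin_l (Im (g a)) (- Im (g b)). have m6 := Rmin_r (Im (g a)) (- Im (g b)).
  have im : forall n t, Rabs (Im (g t)) <= Cmod (mu n - g t).
    move=> n t. have := im_le_Cmod (mu n - g t).
    have -> : Im (mu n - g t)%C = - Im (g t) by rewrite /Im /=; ring. by rewrite Rabs_Ropp.
  move=> n t hP.
  case: (Rle_dec t a) => ta.
    apply: Rle_trans (im n t).
    have [e k] := hu t ta. have := tail_Im_lower id (Im (g a)) (Im u) _ (a - t) ltac:(lra).
    have -> : Im (g a) + (a - t) * Im u = Im (g t) by rewrite e /Im /=; ring.
    move=> k2. rewrite Rabs_pos_eq; last lra.
    apply: Rle_trans (k2 _); first lra.
    move=> x hx. have [e2 k3] := hu (a - x) ltac:(lra).
    have -> : Im (g a) + x * Im u = Im (g (a - x)) by rewrite e2 /Im /=; ring. done.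
  case: (Rle_dec b t) => tb.
    apply: Rle_trans (im n t).
    have [e k] := hv t tb. have := tail_Im_lower id (- Im (g b)) (- Im v) _ (t - b) ltac:(lra).
    have -> : - Im (g b) + (t - b) * - Im v = - Im (g t) by rewrite e /Im /=; ring.
    move=> k2. rewrite Rabs_left; last lra.
    apply: Rle_trans (k2 _); first lra.
    move=> x hx. have [e2 k3] := hv (b + x) ltac:(lra).
    have -> : - Im (g b) + x * - Im v = - Im (g (b + x)) by rewrite e2 /Im /=; ring. lra.
  case: (le_lt_dec N n) => hn; last first.
    apply: Rle_trans (proj2 (hdd n) hP t). apply: Rle_trans (hd1 n hn Logic.I). done.
  apply: Rle_trans (_ : 1 <= _); first lra.
  have k := hN n hn hP.
  have gb : Cmod (g t) <= Rabs M1 + Rabs M2.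
    apply: Rle_trans; first exact: Cmod_le_sum.
    have := hM1 t ltac:(lra). have := hM2 t ltac:(lra). have := Rle_abs M1. have := Rle_abs M2. lra.
  have := Cmod_triangle (mu n - g t) (g t - z0). have := Cmod_triangle (g t) (- z0). rewrite Cmod_opp.
  have -> : (mu n - g t + (g t - z0))%C = (mu n - z0)%C by ring.
  have -> : (g t + - z0)%C = (g t - z0)%C by ring. lra.
Qed.

Lemma Cmod_cpow (theta : R) (z s : C) : Cmod (cpow theta z s) = exp (Re s * ln (Cmod z) - Im s * carg theta z).
Proof. by rewrite /cpow Cmod_cexp. Qed.

(** With w = |z|/k >= y >= 1, |z^(-s)| is at most a constant times w^(-3): the argument is bounded,
    so Im s adds only a constant factor. One power pays for 1 + |z| <= (1 + k) w, and two remain. *)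
Lemma cpow_bound (theta k : R) (s : C) : PI / 2 < theta < PI -> 3 <= Re s -> 0 < k ->
  exists M, 0 < M /\ forall z y, ~ on_cut theta z -> 1 <= y -> k * y <= Cmod z ->
    Cmod (cpow theta z (- s)) * (1 + Cmod z) <= M / y ^ 2.
Proof.
  move=> ht hs kp. have hp := PI_RGT_0.
  pose E := exp (- Re s * ln k + 2 * PI * Rabs (Im s)). have Ep : 0 < E by exact: exp_pos.
  exists (E * (1 + k)). split; first by apply: Rmult_lt_0_compat; lra.
  move=> z y hc hy hz.
  have zp : 0 < Cmod z by nra.
  set w := Cmod z / k.
  have wy : y <= w.
    apply: (Rmult_le_reg_l k) => //. by have -> : k * w = Cmod z by rewrite /w; field; lra.
  have w1 : 1 <= w by lra.
  have zE : Cmod z = k * w by rewrite /w; field; lra.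
  have [[a1 a2] _] := carg_spec theta z ltac:(lra) hc.
  have le : Cmod (cpow theta z (- s)) <= E * / w ^ 3.
    rewrite Cmod_cpow /E.
    have -> : / w ^ 3 = exp (- (3 * ln w)).
      rewrite exp_Ropp. congr Rinv. replace (3 * ln w) with (ln w + ln w + ln w) by ring.
      rewrite !exp_plus exp_ln; [ring | lra].
    rewrite -exp_plus zE ln_mult //; last lra.
    have -> : Re (- s)%C = - Re s by []. have -> : Im (- s)%C = - Im s by [].
    have lw : 0 <= ln w by rewrite -ln_1; apply: ln_le; lra.
    have tb : Im s * carg theta z <= 2 * PI * Rabs (Im s).
      apply: Rle_trans; first exact: Rle_abs. rewrite Rabs_mult Rmult_comm.
      apply: Rmult_le_compat_r; first exact: Rabs_pos. rewrite /Rabs. case: Rcase_abs; lra.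
    have key : - Re s * (ln k + ln w) - - Im s * carg theta z <= - Re s * ln k + 2 * PI * Rabs (Im s) + - (3 * ln w) by nra.
    case: key => key; [by apply: Rlt_le; exact: exp_increasing | rewrite key; exact: Rle_refl].
  apply: Rle_trans (_ : (E * / w ^ 3) * ((1 + k) * w) <= _).
    apply: Rmult_le_compat => //; [exact: Cmod_ge_0 | lra | rewrite zE; nra].
  have -> : E * / w ^ 3 * ((1 + k) * w) = E * (1 + k) * / w ^ 2 by field; lra.
  rewrite /Rdiv. apply: Rmult_le_compat_l; first by apply: Rmult_le_pos; lra.
  apply: Rinv_le_contravar; first by apply: pow_lt; lra. apply: pow_incr. lra.
Qed.

Lemma is_series_finite (a : nat -> C) (l : list nat) : NoDup l ->
  (forall n, ~ In n l -> a n = RtoC 0) -> Cis_series a (lsum a l).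
Proof.
  move=> nd h0.
  have [M hM] : exists M, forall n, In n l -> (n <= M)%nat.
    elim: (l) => [|j k [M IH]]; first by exists 0%nat.
    exists (Nat.max M j) => i [<-|hi]; first lia. have := IH i hi. lia.
  apply/Cis_series_iff. apply: (is_lim_seq_ext_loc (fun _ => 0)); last exact: is_lim_seq_const.
  exists M => n hn.
  suff -> : Csum_n a n = lsum a l.
    have -> : (lsum a l - lsum a l)%C = RtoC 0 by ring. by rewrite Cmod_0.
  rewrite -(lsum_map_seq a (fun i => i)) map_id.
  pose p := fun j => if in_dec Nat.eq_dec j l then false else true.
  have perm : Permutation (List.seq 0 (S n)) (l ++ filter p (List.seq 0 (S n))).
    apply: NoDup_Permutation; first exact: seq_NoDup.
      apply: NoDup_app => //; first by apply: NoDup_filter; exact: seq_NoDup.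
      move=> x hx /filter_In [_]. rewrite /p. by case: in_dec.
    move=> x. rewrite in_app_iff filter_In /p. case: in_dec => hx.
      split=> [|_]; first by left. apply in_seq. have := hM x hx. lia.
    split=> [|[|[]]] //. by right.
  rewrite (lsum_perm a _ _ perm) lsum_app (lsum_zero a (filter _ _)); first by cring.
  move=> j /filter_In [_]. rewrite /p. case: in_dec => // hj _. exact: h0.
Qed.

Lemma Cis_series_scal (c : C) (a : nat -> C) (l : C) : Cis_series a l ->
  Cis_series (fun n => c * a n)%C (c * l)%C.
Proof.
  move=> /Cis_series_iff h. apply/Cis_series_iff.
  have k := is_lim_seq_scal_l _ (Cmod c) _ h. rewrite /= Rmult_0_r in k.
  apply: is_lim_seq_ext k => n. rewrite -Cmod_mult. congr Cmod.
  have -> : Csum_n (fun n => c * a n)%C n = (c * Csum_n a n)%C.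
    elim: n => [|n IH]; first by rewrite !sum_O. rewrite !sum_Sn IH.
    change (c * Csum_n a n + c * a (S n) = c * (Csum_n a n + a (S n)))%C. ring.
  ring.
Qed.

Lemma regularized_trace_series {H : HilbertSpace} (S : operator H) f mu z0 z :
  self_adjoint S -> is_eigenbasis S f mu -> resolvent_summable f mu z0 ->
  (forall n, f n <> zero -> RtoC (mu n) <> z) -> z <> RtoC 0 ->
  Cis_series
    (fun n => if excluded_middle_informative (f n <> zero /\ mu n <> 0) then / (mu n - z) else RtoC 0)%C
    (trace (resolvent S z) + / z * RtoC (INR (multiplicity S (RtoC 0))))%C.
Proof.
  move=> sa hf hs hz z00.
  have hr := eigenbasis_resolvent S f mu z0 z sa hf hs hz.
  have ht := resolvent_trace S f mu z sa hf (resolvent_summable_all S f mu z0 z hf hs hz) hr.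
  have [l [nd hl]] := finite_level S f mu z0 (RtoC 0) hf hs.
  have hm := multiplicity_eq S (RtoC 0) _ (eigenspace_dim S f mu (RtoC 0) l sa hf nd hl).
  (* m(0; S)/z is spread over the indices with eigenvalue 0, so that the cancellation takes place
     term by term. *)
  pose c := fun n => if in_dec Nat.eq_dec n l then (/ z)%C else RtoC 0.
  have hc : Cis_series c (/ z * RtoC (INR (multiplicity S (RtoC 0))))%C.
    rewrite hm. have -> : (/ z * RtoC (INR (length l)))%C = lsum c l.
      rewrite (lsum_const c (/ z)%C); first ring. move=> i hi. rewrite /c. by case: in_dec.
    apply: is_series_finite => // n hn. rewrite /c. by case: in_dec.
  apply: is_series_ext (is_series_plus _ _ _ _ ht hc) => n.
  match goal with |- @eq _ ?a ?b => change (@eq C a b) end.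
  change (RtoC (norm (f n)) / (mu n - z) + c n =
    if excluded_middle_informative (f n <> zero /\ mu n <> 0) then / (mu n - z) else RtoC 0)%C.
  rewrite /c. case: in_dec => hn; case: excluded_middle_informative => hk.
  - move: hn => /hl [_ e]. exfalso. apply: (proj2 hk). exact: (f_equal fst e).
  - move: hn => /hl [fn e]. rewrite e (eb_norm S f mu) //. field. by repeat split; move=> // e2; apply: z00; replace z with (- (- z))%C by ring; rewrite ?e2; ring.
  - rewrite (eb_norm S f mu); [|exact: hf|exact (proj1 hk)]. rewrite /Cdiv. ring.
  - have fn : f n = zero.
      apply: NNPP => fn. apply: hn. apply/hl. split=> //.
      have -> : mu n = 0 by apply: NNPP => hmu; apply: hk. done.
    rewrite fn norm_zero /Cdiv. ring.
Qed.

Theorem lemma2p6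
  (H : HilbertSpace) (H_sep : separable H)
  (S : operator H) (S_sa : self_adjoint S) (S_below : bounded_below S)
  (S_tr : exists z, resolvent_set S z /\ trace_class (resolvent S z))
  (theta : R) (theta_range : PI / 2 < theta < PI)
  (gamma : R -> C) (gamma_contour : encircling_contour theta S gamma)
  (tr_bound : exists (K : R) (N : nat), forall t : R,
     Cmod (trace (fun x =>
       resolvent S (gamma t) (minus x (spectral_proj S (RtoC 0) x))))
     <= K * (1 + Cmod (gamma t)) ^ N) :
  exists s0 : R, 0 < s0 /\ forall s : C, s0 < Re s ->
    let f := fun z : C =>
      (cpow theta z (- s)
         * (trace (resolvent S z) + / z * RtoC (INR (multiplicity S (RtoC 0)))))%C in
    ex_zeta theta S s /\
    ex_contour_int gamma f /\
    zeta theta S s = (- / (RtoC (2 * PI) * Ci) * contour_int gamma f)%C.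
Proof.
  have [z0 [hz0 htr]] := S_tr.
  have [e [mu [he [edom [eeig [ene esum]]]]]] := eigenbasis S z0 S_sa hz0 htr.
  have hf : is_eigenbasis S e mu by split.
  have hs : resolvent_summable e mu z0 by split.
  have tame := encircling_tame theta S gamma gamma_contour.
  have hcut := contour_off_cut _ _ _ gamma_contour.
  have g0 := contour_not_zero _ _ _ gamma_contour.
  (* The indices that count: neither padding vectors nor the eigenvalue 0. *)
  pose act := fun n => e n <> zero /\ mu n <> 0.
  have sp : forall n, act n -> Defs.interior gamma (RtoC (mu n)).
    move=> n [en mn]. apply: (contour_encircles _ _ _ gamma_contour); last by move=> /(f_equal fst) /=.
    apply/(eigenbasis_spectrum S e mu z0) => //. by exists n.
  have gne : forall n t, act n -> gamma t <> RtoC (mu n).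
    move=> n t hn. exact: (proj1 (log_diff_interior gamma theta _ tame theta_range hcut (sp n hn))).
  (* As sin theta > 0, the cut meets the real axis only at 0; so negative eigenvalues are off it
     too. *)
  have mcut : forall n, act n -> ~ on_cut theta (RtoC (mu n)).
    move=> n [_ mn] [r [r0 er]]. have := f_equal snd er. rewrite /= => e2.
    have sth : 0 < sin theta by apply: sin_gt_0; have := PI_RGT_0; lra.
    have e3 : r * sin theta = 0 by lra.
    have rz : r = 0 by case: (Rmult_integral _ _ e3); lra.
    apply: mn. have := f_equal fst er. rewrite /= rz. lra.
  have gres : forall t n, e n <> zero -> RtoC (mu n) <> gamma t.
    move=> t n en e2. case: (Req_dec (mu n) 0) => mn.
      apply: (g0 t). by rewrite -e2 mn.
    by apply: (gne n t).
  have [d [dp hd]] := tame_real_dist gamma mu act z0 tame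
    (fun r => let: ex_intro N hN := eigenvalues_escape S e mu z0 r hf hs in
       ex_intro _ N (fun n hn ha => hN n hn (proj1 ha))) gne.
  have [k [kp hk]] := tame_lower gamma tame g0.
  have [Md [Mdp hMd]] := tame_derive_bounded gamma tame.
  exists 3. split; first lra. move=> s hs3 f.
  have [M [Mp hM]] := cpow_bound theta k s theta_range (Rlt_le _ _ hs3) kp.
  pose phi := fun n t => if excluded_middle_informative (act n)
    then (cpow theta (gamma t) (- s) / (mu n - gamma t) * path_derive gamma t)%C else RtoC 0.
  pose I := fun n => if excluded_middle_informative (act n)
    then (- (RtoC (2 * PI) * Ci) * cpow theta (RtoC (mu n)) (- s))%C else RtoC 0.
  (* The constants from comparing mu n - z with mu n - z0, from the derivative of the contour and
     from [cpow_bound]. *)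
  pose c0 := (1 + (1 + Cmod z0) / d) * Md * M.
  have z00 := Cmod_ge_0 z0.
  have c0p : 0 <= c0.
    rewrite /c0. have := Rdiv_lt_0_compat (1 + Cmod z0) d ltac:(lra) dp => q.
    apply: Rlt_le. repeat apply: Rmult_lt_0_compat => //. lra.
  have hI : forall n, Cis_RInt_gen (phi n) (I n) /\
      forall a b, Cex_RInt (phi n) a b.
    move=> n. rewrite /phi /I. case: excluded_middle_informative => ha.
      exact: (residue_integral gamma theta _ s tame theta_range hcut (mcut n ha) (sp n ha) ltac:(lra)).
    have z : forall a b, Cis_RInt (fun _ => RtoC 0) a b (RtoC 0).
      move=> a b. have := is_RInt_const (V := C_R_NormedModule) a b (RtoC 0).
      have -> : scal (b - a) (RtoC 0 : C_R_NormedModule) = RtoC 0; last done.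
      exact: (scal_zero_r (V := C_R_ModuleSpace)).
    split; last by move=> a b; exists (RtoC 0).
    apply: (RInt_gen_intro _ (fun _ _ => RtoC 0)) => // eps hp. exists 0 => a b _ _.
    have -> : (RtoC 0 - RtoC 0)%C = RtoC 0 by ring. by rewrite Cmod_0.
  have [exI [l [hl hgen]]] : ex_series (fun n => Cmod (I n)) /\ exists l, Cis_series I l /\
    Cis_RInt_gen (fun t => f (gamma t) * path_derive gamma t)%C l.
    apply: (series_RInt_gen phi _ I (fun n => c0 * (norm (e n) / Cmod (mu n - z0)))).
    - move=> n t. rewrite /phi.
      have tp := Rabs_pos t.
      case: excluded_middle_informative => ha; last first.
        rewrite Cmod_0. apply: Rmult_le_pos; last by apply: Rlt_le; apply: Rinv_0_lt_compat; nra.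
        apply: Rmult_le_pos => //.
        apply: Rmult_le_pos; first exact: norm_ge_0.
        case: (Req_dec (Cmod (mu n - z0)) 0) => [->|hne]; first by rewrite Rinv_0; lra.
        apply: Rlt_le. apply: Rinv_0_lt_compat. have := Cmod_ge_0 (mu n - z0). lra.
      have [b1 b2] := resolvent_term_le S e mu z0 (gamma t) d n hf hs dp (fun _ => hd n t ha).
      rewrite (eb_norm S e mu) in b1 b2 *; try exact: hf; try exact: (proj1 ha).
      set w := 1 / Cmod (mu n - z0) in b2 *.
      have w0 : 0 <= w.
        apply: Rmult_le_pos; first lra. apply: Rlt_le. apply: Rinv_0_lt_compat. apply/Cmod_gt_0. apply: Cminus_neq0. exact: (ene n (proj1 ha)).
      have dn : (mu n - gamma t)%C <> RtoC 0 by apply/Cmod_gt_0; have := hd n t ha; lra.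
      rewrite Cmod_mult Cmod_div //.
      have hy := hM (gamma t) (1 + Rabs t) (hcut t) ltac:(lra) (hk t).
      set p := Cmod (cpow theta (gamma t) (- s)) in hy *.
      have p0 : 0 <= p by exact: Cmod_ge_0. have gp := Cmod_ge_0 (gamma t).
      (* Turns the factor from [resolvent_term_le] into a multiple of 1 + |z|, the form that
         [cpow_bound] absorbs. *)
      have tri : 1 + Cmod (gamma t - z0) / d <= (1 + (1 + Cmod z0) / d) * (1 + Cmod (gamma t)).
        have := Cmod_triangle (gamma t) (- z0). rewrite Cmod_opp => tr.
        have id : 0 < / d by exact: Rinv_0_lt_compat.
        have : Cmod (gamma t - z0) / d <= (Cmod (gamma t) + Cmod z0) / d by apply: Rmult_le_compat_r; [lra | exact: tr].
        have : 0 <= (1 + Cmod z0 * Cmod (gamma t)) * / d.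
          apply: Rmult_le_pos; last lra. have := Rmult_le_pos _ _ z00 gp. lra.
        rewrite /Rdiv. lra.
      have s1 : p * (1 + Cmod (gamma t - z0) / d) <= (1 + (1 + Cmod z0) / d) * (M / (1 + Rabs t) ^ 2).
        apply: Rle_trans (Rmult_le_compat_l _ _ _ p0 tri) _.
        have q : 0 <= 1 + (1 + Cmod z0) / d by have := Rdiv_lt_0_compat (1 + Cmod z0) d ltac:(lra) dp; lra.
        have := Rmult_le_compat_l _ _ _ q hy. lra.
      have s2 : M / (1 + Rabs t) ^ 2 <= M * / (1 + t ^ 2).
        apply: Rmult_le_compat_l; first lra. apply: Rinv_le_contravar; first nra.
        rewrite -(pow2_abs t). nra.
      have q : 0 < 1 + (1 + Cmod z0) / d by have := Rdiv_lt_0_compat (1 + Cmod z0) d ltac:(lra) dp; lra.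
      have s3 : p * (1 / Cmod (mu n - gamma t)) <= ((1 + (1 + Cmod z0) / d) * (M * / (1 + t ^ 2))) * w.
        apply: Rle_trans (Rmult_le_compat_l _ _ _ p0 b2) _.
        rewrite -Rmult_assoc. apply: Rmult_le_compat_r => //.
        apply: Rle_trans s1 _. apply: Rmult_le_compat_l => //. lra.
      have -> : p / Cmod (mu n - gamma t) = p * (1 / Cmod (mu n - gamma t)) by rewrite /Rdiv; ring.
      apply: Rle_trans (Rmult_le_compat _ _ _ _ _ (Cmod_ge_0 _) s3 (hMd t)) _.
        by apply: Rmult_le_pos.
      right. rewrite /c0. ring.
    - apply: (ex_series_scal_l c0). exact: esum.
    - move=> t.
      have ser := regularized_trace_series S e mu z0 (gamma t) S_sa hf hs (fun n => gres t n) (g0 t).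
      have := Cis_series_scal (cpow theta (gamma t) (- s) * path_derive gamma t)%C _ _ ser.
      have -> : (cpow theta (gamma t) (- s) * path_derive gamma t * (trace (resolvent S (gamma t)) + / gamma t * RtoC (INR (multiplicity S (RtoC 0)))))%C
         = (f (gamma t) * path_derive gamma t)%C by rewrite /f; ring.
      apply: is_series_ext => n. rewrite /phi /act.
      match goal with |- @eq _ ?a ?b => change (@eq C a b) end.
      case: excluded_middle_informative => ha; rewrite ?/Cdiv; ring.
    - move=> n. exact (proj1 (hI n)).
    - move=> n. exact (proj2 (hI n)).
  have ec : contour_int gamma f = l.
    exact (is_RInt_gen_unique (V := C_R_CompleteNormedModule) (fun t => f (gamma t) * path_derive gamma t)%C l hgen).
  have tpi : (RtoC (2 * PI) * Ci)%C <> RtoC 0.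
    move=> e2. have := f_equal snd e2. rewrite /=. have := PI_RGT_0. lra.
  set w := (- / (RtoC (2 * PI) * Ci))%C.
  have hz : is_zeta theta S s (w * l)%C.
    apply: (eigenbasis_zeta theta S e mu z0 s _ (fun n => w * I n)%C) => //.
    - move=> n en mn. rewrite /I. case: excluded_middle_informative => ha; last by case: ha; split.
      rewrite /w. move: tpi. generalize (RtoC (2 * PI) * Ci)%C => tp tpi. by field.
    - move=> n hn. rewrite /I. case: excluded_middle_informative => ha; last by ring.
      case: ha => h1 h2. by case: hn.
    - apply: (ex_series_ext (fun n => Cmod w * Cmod (I n))); first by move=> n; rewrite Cmod_mult.
      exact: (ex_series_scal_l (Cmod w)).
    - exact: Cis_series_scal.
  split; first by exists (w * l)%C. split; first by exists l.
  by rewrite (zeta_eq theta S s _ hz) ec.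
Qed.
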